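(* Let $(M,g,I,J,K)$ be an HKT manifold with HKT connection $\nabla$ and let $X$ be a special homothety of type $(a,b)$ on $M$ with $a\neq 0$ and $a\neq b$. Let $\mu=\frac{2}{a(a-b)}\,g(X,X)$, which is an HKT potential for $g$. Suppose $f$ is a smooth real-valued function, and, away from the set $\{\mu=0\}$, put $$g_f=f'(\mu)\,g+\tfrac12 f''(\mu)\,(d^{\mathbb H}\mu)^2 .$$ Then $f(\mu)$ is a potential for an HKT metric $g_f$ (with respect to the same $I,J,K$) with $X$ a special homothety of type $(a',b')$ if either (a) $f(\mu)=|\mu|^k$, $k\neq 0,\ b/a$, and $(a',b')=(ka,b)$; or (b) $f(\mu)=\log|\mu|$ and $(a',b')=(0,b)$. Up to homothety, these are the only possibilities for $g_f$.
   Context: HKT manifold: a $4m$-manifold $M$ with integrable complex structures $I,J,K$ satisfying the quaternion identities ($I^2=J^2=K^2=-1$, $IJ=K=-JI$), a pseudo-Riemannian metric $g$ of signature $(4p,4q)$ Hermitian with respect to $I,J,K$, and a (unique) connection $\nabla$ with $\nabla g=0$, $\nabla I=\nabla J=\nabla K=0$ whose torsion $T(Y,Z)=\nabla_YZ-\nabla_ZY-[Y,Z]$ is totally skew, i.e. $c(W,Y,Z)=g(W,T(Y,Z))$ is a 3-form. The metric $g$ is then called an HKT metric. For an $r$-form $\beta$ set $I\beta=\beta(-I\cdot,\dots,-I\cdot)$ and $d_I\beta=(-1)^r I\,d\,I\beta$; similarly for $J,K$. Set $F_I(Y,Z)=g(IY,Z)$, etc. A function $\mu$ is an HKT potential for $g$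 if $F_I=\tfrac12(dd_I+d_Jd_K)\mu$ and the same holds after cyclic permutation of $I,J,K$. Special homothety of type $(a,b)$, $a,b\in\mathbb R$ constants: a vector field $X$ with $L_Xg=ag$; $L_{IX}g=L_{JX}g=L_{KX}g=0$; $L_{IX}I=L_{JX}J=L_{KX}K=0$; and $L_{IX}J=bK$, $L_{JX}K=bI$, $L_{KX}I=bJ$. $(d^{\mathbb H}\mu)^2=(d\mu)^2+(Id\mu)^2+(Jd\mu)^2+(Kd\mu)^2$ (sum of symmetric squares of one-forms).
   Formalization: Case (b) requires b≠0 (for b=0 the form g_f is degenerate); the ''only possibilities'' clause excludes dim M=4 with a'=b', where other metrics g_f exist, and ''up to homothety'' means a nonzero constant multiple on each connected component of {μ≠0}. *)

(* Defs.v *)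
From HB Require Import structures.
From mathcomp Require Import all_boot all_order all_algebra.
From mathcomp Require Import all_classical all_reals all_analysis.

Set Implicit Arguments.
Unset Strict Implicit.
Unset Printing Implicit Defensive.

Import Order.TTheory GRing.Theory Num.Theory numFieldNormedType.Exports.
Local Open Scope classical_set_scope.
Local Open Scope ring_scope.

Section SmoothFunctions.
Context {R : realType} {V : normedModType R}.

Fixpoint Ck (k : nat) (D : set V) (f : V -> R) : Prop :=
  if k is k'.+1 then
    (forall x, D x -> differentiable f x) /\
    (forall u : V, Ck k' D (fun x => 'D_u f x))
  else True.

(* Infinitely differentiable on D; only used for open D. *)
Definition Cinfty (D : set V) (f : V -> R) : Prop := forall k, Ck k D f.

End SmoothFunctions.

Section Manifolds.
Context {R : realType} {n : nat} {M : topologicalType}.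

(* chart_inv is total; only its values on chart_map @` chart_dom matter. *)
Record chart := Chart {
  chart_dom : set M;
  chart_map : M -> 'rV[R]_n;
  chart_inv : 'rV[R]_n -> M }.

Record is_chart (c : chart) : Prop := {
  chart_dom_open : open (chart_dom c);
  chart_img_open : open (chart_map c @` chart_dom c);
  chart_mapK : forall p, chart_dom c p -> chart_inv c (chart_map c p) = p;
  chart_map_cont : forall p, chart_dom c p -> {for p, continuous (chart_map c)};
  chart_inv_cont : forall x, (chart_map c @` chart_dom c) x ->
    {for x, continuous (chart_inv c)} }.

Record smooth_manifold (A : set chart) : Prop := {
  manifold_hausdorff : hausdorff_space M;
  manifold_countable : @second_countable M;
  atlas_chart : forall c, A c -> is_chart c;
  atlas_cover : forall p, exists2 c, A c & chart_dom c p;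
  atlas_compat : forall c c' (j : 'I_n), A c -> A c' ->
    Cinfty (chart_map c @` (chart_dom c `&` chart_dom c'))
           (fun x => chart_map c' (chart_inv c x) 0 j) }.

Variable A : set chart.

(* f is smooth on a neighbourhood of p. *)
Definition smooth_at (p : M) (f : M -> R) : Prop :=
  exists c (D : set 'rV[R]_n),
    [/\ A c, chart_dom c p, open D, D (chart_map c p) &
        Cinfty D (f \o chart_inv c)].

Definition smooth_on (W : set M) (f : M -> R) : Prop :=
  forall p, W p -> smooth_at p f.

(* A tangent vector at p is a directional derivative in a chart, regarded as a
   functional on functions smooth near p. It is set to 0 on the other functions
   so that equality of tangent vectors is equality of functionals; vector space
   operations are then those of (M -> R) -> R. *)
Local Notation vec := ((M -> R) -> R).

Definition tangent (p : M) (v : vec) : Prop :=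
  exists c (u : 'rV[R]_n),
    [/\ A c, chart_dom c p &
      forall f, v f = if `[< smooth_at p f >]
                      then 'D_u (f \o chart_inv c) (chart_map c p) else 0].

(* X is a smooth vector field on a neighbourhood of p (values elsewhere are
   irrelevant). Tensorial identities on an open set W are stated below at each
   point p of W against all vector fields smooth near p, so that they are local
   by construction and W is regarded as an open submanifold. *)
Definition vfield_at (p : M) (X : M -> vec) : Prop :=
  \forall q \near p, tangent q (X q) /\
    (forall f, smooth_at q f -> smooth_at q (fun r => X r f)).

Definition vfield_on (W : set M) (X : M -> vec) : Prop :=
  forall p, W p -> vfield_at p X.

Definition bracket (X Y : M -> vec) : M -> vec := fun p f =>
  if `[< smooth_at p f >] then X p (fun q => Y q f) - Y p (fun q => X q f)
  else 0.

(* Fields of endomorphisms of the tangent bundle; only the values on tangent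
   vectors matter, here and for the other tensors. *)
Local Notation endo := (M -> vec -> vec).

Definition ap (J : endo) (Y : M -> vec) : M -> vec := fun p => J p (Y p).

Record endo_on (W : set M) (J : endo) : Prop := {
  endo_tangent : forall p v, W p -> tangent p v -> tangent p (J p v);
  endo_linear : forall p (t : R) v w, W p -> tangent p v -> tangent p w ->
    J p (t *: v + w) = t *: J p v + J p w;
  endo_smooth : forall p Y, W p -> vfield_at p Y -> vfield_at p (ap J Y) }.

(* Integrability is the vanishing of the Nijenhuis tensor. *)
Record complex_structure (W : set M) (J : endo) : Prop := {
  cplx_endo : endo_on W J;
  cplx_sqr : forall p v, W p -> tangent p v -> J p (J p v) = - v;
  cplx_integrable : forall p Y Z, W p -> vfield_at p Y -> vfield_at p Z ->
    bracket (ap J Y) (ap J Z) p - J p (bracket (ap J Y) Z p)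
    - J p (bracket Y (ap J Z) p) - bracket Y Z p = 0 }.

Record hypercomplex (W : set M) (I J K : endo) : Prop := {
  hcplx_I : complex_structure W I;
  hcplx_J : complex_structure W J;
  hcplx_K : complex_structure W K;
  hcplx_IJ : forall p v, W p -> tangent p v -> I p (J p v) = K p v;
  hcplx_JI : forall p v, W p -> tangent p v -> J p (I p v) = - K p v }.

Local Notation form2 := (M -> vec -> vec -> R).

(* Signature (4r, 4s) at each point, with (r, s) locally constant by continuity:
   on a disconnected manifold it may vary between components. *)
Record pseudo_metric (W : set M) (g : form2) : Prop := {
  pm_linear : forall p (t : R) u v w, W p ->
    tangent p u -> tangent p v -> tangent p w ->
    g p (t *: u + v) w = t * g p u w + g p v w;
  pm_sym : forall p v w, W p -> tangent p v -> tangent p w -> g p v w = g p w v;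
  pm_smooth : forall p Y Z, W p -> vfield_at p Y -> vfield_at p Z ->
    smooth_at p (fun q => g q (Y q) (Z q));
  pm_signature : forall p, W p ->
    exists (r s : nat) (e : 'I_n -> vec),
      [/\ n = (4 * r + 4 * s)%N,
          forall i, tangent p (e i),
          forall v, tangent p v ->
            exists x : 'I_n -> R, v = \sum_(i < n) x i *: e i &
          forall i j, g p (e i) (e j) =
            if i == j then (if (i < 4 * r)%N then 1 else - 1) else 0] }.

Definition hermitian (W : set M) (g : form2) (J : endo) : Prop :=
  forall p v w, W p -> tangent p v -> tangent p w ->
    g p (J p v) (J p w) = g p v w.

(* nabla p v Z is the covariant derivative at p of Z in the direction v. *)
Local Notation conn := (M -> vec -> (M -> vec) -> vec).

Definition cov (nabla : conn) (Y Z : M -> vec) : M -> vec :=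
  fun p => nabla p (Y p) Z.

Record connection (W : set M) (nabla : conn) : Prop := {
  conn_tangent : forall p v Z, W p -> tangent p v -> vfield_at p Z ->
    tangent p (nabla p v Z);
  conn_linear : forall p (t : R) v w Z, W p ->
    tangent p v -> tangent p w -> vfield_at p Z ->
    nabla p (t *: v + w) Z = t *: nabla p v Z + nabla p w Z;
  conn_add : forall p v Y Z, W p -> tangent p v ->
    vfield_at p Y -> vfield_at p Z ->
    nabla p v (fun q => Y q + Z q) = nabla p v Y + nabla p v Z;
  conn_leibniz : forall p v h Z, W p -> tangent p v ->
    smooth_at p h -> vfield_at p Z ->
    nabla p v (fun q => h q *: Z q) = v h *: Z p + h p *: nabla p v Z;
  conn_smooth : forall p Y Z, W p -> vfield_at p Y -> vfield_at p Z ->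
    vfield_at p (cov nabla Y Z) }.

Definition torsion (nabla : conn) (Y Z : M -> vec) : M -> vec :=
  fun p => cov nabla Y Z p - cov nabla Z Y p - bracket Y Z p.

Definition torsion3 (g : form2) (nabla : conn) (V Y Z : M -> vec) (p : M) : R :=
  g p (V p) (torsion nabla Y Z p).

Definition parallel_metric (W : set M) (g : form2) (nabla : conn) : Prop :=
  forall p v Y Z, W p -> tangent p v -> vfield_at p Y -> vfield_at p Z ->
    v (fun q => g q (Y q) (Z q)) = g p (nabla p v Y) (Z p) + g p (Y p) (nabla p v Z).

Definition parallel_endo (W : set M) (J : endo) (nabla : conn) : Prop :=
  forall p v Y, W p -> tangent p v -> vfield_at p Y ->
    nabla p v (ap J Y) = J p (nabla p v Y).

(* A connection with these properties is unique, so that its mere existence is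
   required in HKT_metric. *)
Record HKT_connection (W : set M) (g : form2) (I J K : endo) (nabla : conn)
    : Prop := {
  hktc_conn : connection W nabla;
  hktc_g : parallel_metric W g nabla;
  hktc_I : parallel_endo W I nabla;
  hktc_J : parallel_endo W J nabla;
  hktc_K : parallel_endo W K nabla;
  hktc_skew12 : forall p V Y Z, W p ->
    vfield_at p V -> vfield_at p Y -> vfield_at p Z ->
    torsion3 g nabla V Y Z p = - torsion3 g nabla Y V Z p;
  hktc_skew23 : forall p V Y Z, W p ->
    vfield_at p V -> vfield_at p Y -> vfield_at p Z ->
    torsion3 g nabla V Y Z p = - torsion3 g nabla V Z Y p }.

Record HKT (W : set M) (g : form2) (I J K : endo) (nabla : conn) : Prop := {
  hkt_hypercomplex : hypercomplex W I J K;
  hkt_metric : pseudo_metric W g;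
  hkt_hermI : hermitian W g I;
  hkt_hermJ : hermitian W g J;
  hkt_hermK : hermitian W g K;
  hkt_conn : HKT_connection W g I J K nabla }.

Definition HKT_metric (W : set M) (g : form2) (I J K : endo) : Prop :=
  exists nabla, HKT W g I J K nabla.

(* The operators d, beta |-> I beta = beta (- I _, ..) and
   d_I beta = (-1)^r I d (I beta), in the degrees occurring in d d_I and
   d_J d_K. A 2-form produced by d is given by its values on vector fields. *)

Definition d0 (h : M -> R) : M -> vec -> R := fun p v => v h.

Definition d1 (al : M -> vec -> R) (Y Z : M -> vec) (p : M) : R :=
  Y p (fun q => al q (Z q)) - Z p (fun q => al q (Y q)) - al p (bracket Y Z p).

Definition act1 (J : endo) (al : M -> vec -> R) : M -> vec -> R :=
  fun p v => al p (- J p v).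

Definition act2 (J : endo) (be : (M -> vec) -> (M -> vec) -> M -> R)
    (Y Z : M -> vec) (p : M) : R :=
  be (fun q => - ap J Y q) (fun q => - ap J Z q) p.

Definition dJ0 (J : endo) (h : M -> R) : M -> vec -> R := act1 J (d0 h).

Definition dJ1 (J : endo) (al : M -> vec -> R) (Y Z : M -> vec) (p : M) : R :=
  - act2 J (d1 (act1 J al)) Y Z p.

Definition kform (g : form2) (J : endo) : form2 := fun p v w => g p (J p v) w.

Definition potential_eq (W : set M) (mu : M -> R) (g : form2) (I J K : endo)
    : Prop :=
  forall p Y Z, W p -> vfield_at p Y -> vfield_at p Z ->
    kform g I p (Y p) (Z p) =
      2^-1 * (d1 (dJ0 I mu) Y Z p + dJ1 J (dJ0 K mu) Y Z p).

Record HKT_potential (W : set M) (mu : M -> R) (g : form2) (I J K : endo)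
    : Prop := {
  pot_smooth : smooth_on W mu;
  pot_I : potential_eq W mu g I J K;
  pot_J : potential_eq W mu g J K I;
  pot_K : potential_eq W mu g K I J }.

(* L_X g = t g on W. *)
Definition lie_metric (W : set M) (X : M -> vec) (g : form2) (t : R) : Prop :=
  forall p Y Z, W p -> vfield_at p Y -> vfield_at p Z ->
    X p (fun q => g q (Y q) (Z q))
    - g p (bracket X Y p) (Z p) - g p (Y p) (bracket X Z p)
    = t * g p (Y p) (Z p).

(* L_X J = t K on W. *)
Definition lie_endo (W : set M) (X : M -> vec) (J : endo) (t : R) (K : endo)
    : Prop :=
  forall p Y, W p -> vfield_at p Y ->
    bracket X (ap J Y) p - J p (bracket X Y p) = t *: K p (Y p).

Record special_homothety (W : set M) (g : form2) (I J K : endo)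
    (X : M -> vec) (a b : R) : Prop := {
  sh_field : vfield_on W X;
  sh_g : lie_metric W X g a;
  sh_Ig : lie_metric W (ap I X) g 0;
  sh_Jg : lie_metric W (ap J X) g 0;
  sh_Kg : lie_metric W (ap K X) g 0;
  sh_II : lie_endo W (ap I X) I 0 I;
  sh_JJ : lie_endo W (ap J X) J 0 J;
  sh_KK : lie_endo W (ap K X) K 0 K;
  sh_IJ : lie_endo W (ap I X) J b K;
  sh_JK : lie_endo W (ap J X) K b I;
  sh_KI : lie_endo W (ap K X) I b J }.

(* (d^H mu)^2, a sum of symmetric squares of 1-forms. *)
Definition dH2 (I J K : endo) (mu : M -> R) : form2 := fun p v w =>
  d0 mu p v * d0 mu p w + act1 I (d0 mu) p v * act1 I (d0 mu) p w
  + act1 J (d0 mu) p v * act1 J (d0 mu) p w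
  + act1 K (d0 mu) p v * act1 K (d0 mu) p w.

Definition deformed_metric (g : form2) (I J K : endo) (mu : M -> R) (f : R -> R)
    : form2 := fun p v w =>
  derive1 f (mu p) * g p v w + 2^-1 * derive1n 2 f (mu p) * dH2 I J K mu p v w.

Definition homothety_potential (g : form2) (X : M -> vec) (a b : R) : M -> R :=
  fun p => 2 / (a * (a - b)) * g p (X p) (X p).

(* On W: f(mu) is a potential for the HKT metric g_f, and X is a special
   homothety of type (a', b') of g_f. *)
Definition deformation_on (W : set M) (g : form2) (I J K : endo)
    (X : M -> vec) (mu : M -> R) (f : R -> R) (a' b' : R) : Prop :=
  let gf := deformed_metric g I J K mu f in
  [/\ HKT_metric W gf I J K,
      HKT_potential W (f \o mu) gf I J K &
      special_homothety W gf I J K X a' b'].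

(* On W, g1 is a nonzero constant multiple of g2. *)
Definition homothetic_on (W : set M) (g1 g2 : form2) : Prop :=
  exists2 c : R, c != 0 &
    forall p v w, W p -> tangent p v -> tangent p w -> g1 p v w = c * g2 p v w.

End Manifolds.
Arguments chart : clear implicits.

Definition abs_pow {R : realType} (k : R) : R -> R := fun t => `|t| `^ k.
Definition log_abs {R : realType} : R -> R := fun t => ln `|t|.

(* Main.v *)
Require Import Defs.
From mathcomp Require Import all_boot all_order all_algebra.
From mathcomp Require Import all_classical all_reals all_analysis.
From mathcomp Require Import ring lra zify.
Import Order.TTheory GRing.Theory Num.Theory numFieldNormedType.Exports.
Local Open Scope classical_set_scope.
Local Open Scope ring_scope.
Set Implicit Arguments.
Unset Strict Implicit.
Unset Printing Implicit Defensive.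

(** Write X^flat for g(X, .), put k = 2 / (a - b), and let q range over 1, I, J, K.

    A special homothety satisfies nabla X = (a / 2) id (nabla_X): the symmetric part
    is given by L_X g = a g, and the Killing equations of IX, JX, KX make the skew part
    commute and anticommute with K at the same time. It follows that d mu = k X^flat,
    that the torsion T vanishes on X, and that the conditions on L_IX J etc. compute the
    commutators of T(IX, .), T(JX, .), T(KX, .) with I, J, K: these endomorphisms are
    - (a + b) / 2 times I, J, K plus endomorphisms that commute with I, J and K
    (hkt_quat_torsion, torsion_qlin). The potential equation for a function f(mu)
    thereby becomes an identity at each point (deform_form_potential, fpotential_eq), of
    which f = id is the case of mu and g.

    Because d mu = k X^flat, one has g_f = f' g + psi sum_q (qX)^flat (qX)^flat with
    psi = k^2 f'' / 2. So g_f is f' g on the orthogonal of the quaternionic line of X and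
    (f' + a / (a - b) mu f'') g on this line. For f = |mu|^k the last factor is
    (k a - b) / (a - b) f', which accounts for the exclusion of k = b / a, and of b = 0
    in the case of the logarithm. Where both factors are nonzero g_f is nondegenerate
    and hyperhermitian, and the quaternionic Gram-Schmidt process shows that its
    signature consists of multiples of 4 (quat_signature). Its HKT connection is written
    down: it is nabla plus a tensor, explicit in g, X and the torsion, that is
    quaternionic linear, whose symmetric part accounts for the derivative of g_f, and
    whose skew part makes the new torsion a 3-form (correction, deformed_HKT).

    X commutes with IX, JX, KX and X mu = a mu, so L_X g_f is again a combination of g and
    of the sum of squares, and L_X g_f = a' g_f reduces to
    mu f'' = (a' / a - 1) f' (deformed_special_homothety), which powers and the
    logarithm satisfy. Conversely L_X g_f = a' g_f, evaluated on a vector orthogonal to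
    the quaternionic line of X if there is one, gives back this equation; in dimension 4
    the metric is u g with u = f' + a / (a - b) mu f'', and u satisfies the same
    equation. Separation of variables on a component of the set where mu does not vanish
    (homogeneous_on_component) identifies g_f up to a constant, and b' = b because L_IX J
    does not involve the metric.

    Tangent vectors being functionals on functions, the differential geometry rests on two
    facts: the commutator of vector fields is a field of tangent vectors
    (bracket_tangent), by the symmetry of second derivatives (derive_comm), and every
    tangent vector extends to a field (tangent_extend). *)

(** * Functions of class C^k on a normed space *)

Section NormedCalculus.
Context {R : realType} {V : normedModType R}.
Implicit Types (D E : set V) (f g : V -> R).


Lemma near_eq_differentiable (W : normedModType R) (f g : V -> W) (x : V) :
  (\forall y \near x, f y = g y) -> differentiable f x -> differentiable g x.
Proof.
move=> fg df.
have fgx := nbhs_singleton fg.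
have [dfc /eqaddoP dfo] := (diff_locallyP x f).1 df.
suff H : continuous ('d f x) /\ g \o shift x = cst (g x) + 'd f x +o_ 0 id.
  apply/diffP => /=.
  apply: (@getPex _ (fun (df : {linear V -> W}) => continuous df /\
    forall y, g y = g (lim (nbhs x)) + df (y - lim (nbhs x))
                  +o_(y \near x) (y - lim (nbhs x)))).
  exists ('d f x); split; first by case: H.
  case: H => _ dxg; apply: eqaddoEx => y.
  move: dxg; rewrite funeqE => /(_ _) dxg'.
  have {}dxg' h := dxg' h; rewrite /= in dxg'.
  rewrite lim_id // -[in LHS](subrK x y) dxg'; congr (_ + _).
  rewrite -(comp_centerK x id) -[X in the_littleo _ _ _ X](comp_centerK x).
  by rewrite -[_ (y - x)]/((_ \o (center x)) y) -littleo_center0.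
split=> //; apply/eqaddoP => e e0.
have := dfo _ e0.
have fg0 : \forall y \near 0, f (y + x) = g (y + x).
  by have := fg; rewrite (near_shift 0) /=; apply: filterS => y /=; rewrite subr0.
by apply: filter_app; near=> y; rewrite !fctE /= -fgx (near fg0 y).
Unshelve. all: by end_near. Qed.


Lemma CkW k D f : Ck k.+1 D f -> Ck k D f.
Proof.
elim: k f => [//|k IH] f [df Df]; split=> // u.
exact: IH (Df u).
Qed.

Lemma Ck_subset k D E f : D `<=` E -> Ck k E f -> Ck k D f.
Proof.
move=> DE; elim: k f => [//|k IH] f [df Df]; split=> [x /DE/df //|u].
exact: IH (Df u).
Qed.

Lemma near_open D (P : V -> Prop) x : open D -> D x -> (forall y, D y -> P y) ->
  \forall y \near x, P y.
Proof.
move=> oD Dx DP; apply: filterS DP _.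
exact: open_nbhs_nbhs.
Qed.

Lemma Ck_eq k D f g : open D -> (forall x, D x -> f x = g x) ->
  Ck k D f -> Ck k D g.
Proof.
move=> oD; elim: k f g => [//|k IH] f g fg [df Df]; split=> [x Dx|u].
  by apply: near_eq_differentiable (df x Dx); exact: near_open fg.
apply: IH (Df u) => x Dx; apply: near_eq_derive; exact: near_open fg.
Qed.

Lemma Ck_cst k D c : Ck k D (fun _ => c).
Proof.
elim: k c => [//|k IH] c; split=> [x _|u]; first exact: differentiable_cst.
by under eq_fun do rewrite derive_cst.
Qed.

Lemma CkD k D f g : open D -> Ck k D f -> Ck k D g -> Ck k D (fun x => f x + g x).
Proof.
move=> oD; elim: k f g => [//|k IH] f g [df Df] [dg Dg]; split=> [x Dx|u].
  by apply: differentiableD; [exact: df|exact: dg].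
apply: Ck_eq (IH _ _ (Df u) (Dg u)) => // x Dx.
by rewrite deriveD //; apply: diff_derivable; [exact: df|exact: dg].
Qed.

Lemma CkM k D f g : open D -> Ck k D f -> Ck k D g -> Ck k D (fun x => f x * g x).
Proof.
move=> oD; elim: k f g => [//|k IH] f g Cf Cg.
have [[df Df] [dg Dg]] := (Cf, Cg); split=> [x Dx|u].
  by apply: differentiableM; [exact: df|exact: dg].
apply: (@Ck_eq _ _ (fun x => f x * 'D_u g x + g x * 'D_u f x)) => //.
  move=> x Dx.
  by rewrite deriveM //; apply: diff_derivable; [exact: df|exact: dg].
apply: CkD => //; [exact: IH (CkW Cf) (Dg u)|exact: IH (CkW Cg) (Df u)].
Qed.

Lemma Ck_sum k D (I : Type) (s : seq I) (F : I -> V -> R) : open D ->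
  (forall i, Ck k D (F i)) -> Ck k D (fun x => \sum_(i <- s) F i x).
Proof.
move=> oD CF; elim: s => [|i s IH].
  rewrite (_ : (fun _ => _) = fun=> 0); first exact: Ck_cst.
  by apply/funext => x; rewrite big_nil.
rewrite (_ : (fun _ => _) = fun x => F i x + \sum_(j <- s) F j x).
  exact: CkD.
by apply/funext => x; rewrite big_cons.
Qed.

Lemma derive_sum_scale (W : normedModType R) n (e : 'I_n -> W)
    (F : 'I_n -> V -> R) x :
  (forall j, differentiable (F j) x) ->
  differentiable (fun y => \sum_j F j y *: e j) x /\
  forall u, 'd (fun y => \sum_j F j y *: e j) x u = \sum_j 'D_u (F j) x *: e j.
Proof.
move=> dF.
have -> : (fun y => \sum_j F j y *: e j) = \sum_j (fun y => F j y *: e j).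
  by apply/funext => y; rewrite fct_sumE.
have dFe j : differentiable (fun y => F j y *: e j) x.
  exact: differentiableZl.
have dS : differentiable (\sum_j (fun y => F j y *: e j)) x.
  exact: differentiable_sum.
split=> // u; rewrite -deriveE // derive_sum; last first.
  by move=> j; exact: diff_derivable.
by apply: eq_bigr => j _; rewrite deriveE // diffZl //= deriveE.
Qed.

(** The inner map is given by its coordinates in a finite family e, so that its
    components are real functions, of which Ck speaks; the chain rule then
    expresses the derivatives of the composite by functions of the same kind. *)
Lemma Ck_comp (W : normedModType R) n (e : 'I_n -> W) (F : 'I_n -> V -> R)
    (h : W -> R) k D (E : set W) : open D ->
  (forall x, D x -> E (\sum_j F j x *: e j)) ->
  (forall j, Ck k D (F j)) -> Ck k E h ->
  Ck k D (fun x => h (\sum_j F j x *: e j)).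
Proof.
move=> oD DE; elim: k h => [//|k IH] h CF [dh Dh].
have dF j x : D x -> differentiable (F j) x by have [+ _] := CF j; exact.
have dG x Dx := (derive_sum_scale e (fun j => dF j x Dx)).1.
have dhG x : D x -> differentiable (fun x => h (\sum_j F j x *: e j)) x.
  by move=> Dx; apply: differentiable_comp; [exact: dG|apply/dh/DE].
split=> // u.
apply: (@Ck_eq _ _
  (fun x => \sum_j 'D_u (F j) x * 'D_(e j) h (\sum_j F j x *: e j))) => //.
  move=> x Dx; rewrite deriveE; last exact: dhG.
  have dhx : differentiable h (\sum_j F j x *: e j) by apply/dh/DE.
  rewrite (@diff_comp _ _ _ _ (fun x => \sum_j F j x *: e j) h) //=; last exact: dG.
  rewrite (derive_sum_scale e (fun j => dF j x Dx)).2 linear_sum.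
  by apply: eq_bigr => j _; rewrite linearZ /= (deriveE _ dhx).
apply: Ck_sum => // j; apply: CkM => //; first exact: (CF j).2 u.
by apply: (IH (fun y => 'D_(e j) h y)) => [i|]; [exact: CkW (CF i)|exact: Dh].
Qed.

Lemma Ck_comp1 (F : V -> R) (h : R -> R) k D (E : set R) : open D ->
  (forall x, D x -> E (F x)) -> Ck k D F -> Ck k E h -> Ck k D (fun x => h (F x)).
Proof.
move=> oD DE CF Ch.
have E1 (x : V) : \sum_(j < 1) F x *: (1 : R) = F x.
  by rewrite big_ord1; exact: mulr1.
rewrite (_ : (fun x => h (F x)) = fun x => h (\sum_(j < 1) F x *: (1 : R))).
  apply: (@Ck_comp R 1 (fun=> 1) (fun=> F) h k D E) => //. by move=> x /DE; rewrite E1.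
by apply/funext => x; rewrite E1.
Qed.

End NormedCalculus.

Lemma Ck_inv {R : realType} k : Ck k [set t : R | t != 0] (fun t : R => t^-1).
Proof.
have oN0 : open [set t : R | t != 0] by exact: open_neq.
elim: k => [//|k IH]; split=> [x x0|u]; first exact: differentiable_Rinv.
apply: (@Ck_eq _ _ _ _ (fun t : R => (- u) * (t^-1 * t^-1))) => //.
  move=> x x0; rewrite deriveE; last exact: differentiable_Rinv.
  rewrite diff_Rinv //= expr2 invfM /GRing.scale /=; ring.
by apply: CkM => //; [exact: Ck_cst|exact: CkM].
Qed.

(** * The mean value theorem along directions *)

Section MeanValue.
Context {R : realType} {V : normedModType R}.
Implicit Types (D E : set V) (f g : V -> R).

Lemma is_derive_line f (y w : V) (s : R) : differentiable f (y + s *: w) ->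
  is_derive s 1 (fun r : R => f (y + r *: w)) ('D_w f (y + s *: w)).
Proof.
move=> df.
have dl : differentiable (fun r : R => y + r *: w) s.
  by apply: differentiableD => //; apply: differentiableZl.
have dc : differentiable (fun r : R => f (y + r *: w)) s.
  exact: (@differentiable_comp _ _ _ _ (fun r : R => y + r *: w) f).
apply: DeriveDef; first exact: diff_derivable.
rewrite deriveE // (@diff_comp _ _ _ _ (fun r : R => y + r *: w) f) //= deriveE //.
congr ('d f _ _).
rewrite -deriveE // (@deriveD _ _ _ (cst y) (fun r : R => r *: w)) //.
- rewrite derive_cst add0r deriveE; last exact: differentiableZl.
  by rewrite diffZl //= diff_val /= scale1r.
- by apply: diff_derivable; exact: differentiableZl.
Qed.

Lemma directional_MVT D f (y w : V) (t : R) : 0 < t ->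
  (forall s, 0 <= s <= t -> D (y + s *: w)) ->
  (forall x, D x -> differentiable f x) ->
  exists2 c, 0 < c < t & f (y + t *: w) - f y = t * 'D_w f (y + c *: w).
Proof.
move=> t0 Dt df.
have dl s : 0 <= s <= t -> is_derive s 1 (fun r : R => f (y + r *: w))
    ('D_w f (y + s *: w)).
  by move=> st; apply/is_derive_line/df/Dt.
have [||c] := @MVT R (fun r : R => f (y + r *: w))
    (fun s => 'D_w f (y + s *: w)) 0 t t0.
- by move=> s; rewrite in_itv /= => /andP[s0 st]; apply: dl; rewrite !ltW.
- apply: derivable_within_continuous => s; rewrite in_itv /= => st.
  by have [] := dl _ st.
rewrite in_itv /= scale0r addr0 subr0 => c0 ->.
by exists c => //; rewrite mulrC.
Qed.

(** The second difference is the first difference along v of the first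
    difference along u; the mean value theorem applies to each in turn. *)
Lemma directional_MVT2 D f (x u v : V) (t : R) : 0 < t ->
  (forall r s, 0 <= r <= t -> 0 <= s <= t -> D (x + r *: u + s *: v)) ->
  Ck 2 D f ->
  exists r s, [/\ 0 < r < t, 0 < s < t &
    f (x + t *: u + t *: v) - f (x + t *: u) - (f (x + t *: v) - f x)
    = t * (t * 'D_v (fun y => 'D_u f y) (x + r *: u + s *: v))].
Proof.
move=> t0 Dt [df /(_ u) [ddf _]].
have tt : 0 <= t <= t by apply/andP; split; rewrite // ltW.
have z0 : 0 <= (0 : R) <= t by apply/andP; split; rewrite // ltW.
pose E := [set y | D y /\ D (y + t *: v)].
pose h y := f (y + t *: v) - f y.
have dsh y : differentiable (fun z : V => z + t *: v) y by apply: differentiableD.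
have dhs y : E y -> differentiable (fun z => f (z + t *: v)) y.
  move=> [_ Dy]; apply: (@differentiable_comp _ _ _ _ (fun z => z + t *: v) f) => //.
  exact: df.
have dh y : E y -> differentiable h y.
  by move=> Ey; apply: differentiableB; [exact: dhs|apply: df; case: Ey].
have [|r rt hr] := @directional_MVT E h x u t t0 _ dh.
  by move=> s st; split; [have := Dt s 0 st z0; rewrite scale0r addr0|exact: Dt].
have rt' : 0 <= r <= t by case/andP: rt => /ltW -> /ltW ->.
have Er : E (x + r *: u).
  by split; [have := Dt r 0 rt' z0; rewrite scale0r addr0|exact: Dt].
have [|s st hs] := @directional_MVT D (fun y => 'D_u f y) (x + r *: u) v t t0 _ ddf.
  by move=> s st; exact: Dt.
exists r, s; split=> //.
rewrite -hs -/(h _) [X in _ - X](_ : _ = h x) // hr; congr (_ * _).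
rewrite deriveB; [|exact/diff_derivable/dhs|by apply/diff_derivable/df; case: Er].
congr (_ - _).
rewrite deriveE; last exact: dhs.
rewrite (@diff_comp _ _ _ _ (fun z => z + t *: v) f) //; last by apply: df; case: Er.
rewrite /= -deriveE; last by apply: df; case: Er.
congr ('D_ _ f _).
rewrite -deriveE // (@deriveD _ _ _ id (cst (t *: v))) //.
by rewrite derive_id derive_cst addr0.
Qed.

(** Both mixed derivatives are limits of the same second difference quotient,
    by the mean value theorem used once in each direction. *)
Lemma derive_comm D f (x u v : V) : open D -> D x -> Ck 3 D f ->
  'D_u (fun y => 'D_v f y) x = 'D_v (fun y => 'D_u f y) x.
Proof.
move=> oD Dx Cf.
pose P y := 'D_v (fun y => 'D_u f y) y; pose Q y := 'D_u (fun y => 'D_v f y) y.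
have cP : {for x, continuous P}.
  by apply: differentiable_continuous; case: Cf => _ /(_ u) [_ /(_ v) [+ _]]; exact.
have cQ : {for x, continuous Q}.
  by apply: differentiable_continuous; case: Cf => _ /(_ v) [_ /(_ u) [+ _]]; exact.
apply/eqP; rewrite -subr_eq0 -normr_eq0 eq_le normr_ge0 andbT.
apply/ler_addgt0Pl => e e0; rewrite addr0.
have e20 : 0 < e / 2 by rewrite divr_gt0.
have nP : \forall y \near x, `|P x - P y| < e / 2 by move/cvgrPdist_lt: cP; apply.
have nQ : \forall y \near x, `|Q x - Q y| < e / 2 by move/cvgrPdist_lt: cQ; apply.
have : \forall y \near x, [/\ D y, `|P x - P y| < e / 2 & `|Q x - Q y| < e / 2].
  by apply: filterS3 (open_nbhs_nbhs (conj oD Dx)) nP nQ.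
move=> /nbhs_normP [d /= d0 dP].
pose B : R := `|u| + `|v| + 1.
have B0 : 0 < B by rewrite ltr_wpDl // addr_ge0.
pose t := d / 2 / B.
have t0 : 0 < t by rewrite !divr_gt0.
have inb r s : 0 <= r <= t -> 0 <= s <= t -> ball_ Num.norm x d (x + r *: u + s *: v).
  move=> /andP[r0 rt] /andP[s0 st].
  rewrite /ball_ /= -addrA opprD addNKr normrN.
  rewrite (le_lt_trans (ler_normD _ _)) // !normrZ !ger0_norm //.
  have -> : d = t * B * 2 by rewrite /t !divfK // gt_eqF.
  apply: (@le_lt_trans _ _ (t * `|u| + t * `|v|)).
    by rewrite lerD // ler_wpM2r.
  have : 0 < t * B by rewrite mulr_gt0.
  by rewrite /B !mulrDr mulr1; lra.
have Dt r s (hr : 0 <= r <= t) (hs : 0 <= s <= t) : D (x + r *: u + s *: v).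
  by have [] := dP _ (inb _ _ hr hs).
have Dt' r s (hr : 0 <= r <= t) (hs : 0 <= s <= t) : D (x + r *: v + s *: u).
  by rewrite addrAC; exact: Dt.
have [r [s [/andP[r0 rt] /andP[s0 st] e1]]] := directional_MVT2 t0 Dt (CkW Cf).
have [s' [r' [/andP[s0' st'] /andP[r0' rt'] e2]]] :=
  directional_MVT2 t0 Dt' (CkW Cf).
have PQ : P (x + r *: u + s *: v) = Q (x + r' *: u + s' *: v).
  have tn : t != 0 by rewrite gt_eqF.
  apply: (mulfI tn); apply: (mulfI tn).
  rewrite [X in Q X]addrAC; apply: etrans (esym e1) (etrans _ e2).
  rewrite [X in f X - _](addrAC x) -!addrA; congr (_ + _).
  by rewrite !opprB; ring.
have [|_ hP _] := dP (x + r *: u + s *: v); first by apply: inb; rewrite !ltW.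
have [|_ _ hQ] := dP (x + r' *: u + s' *: v); first by apply: inb; rewrite !ltW.
move: PQ hP hQ; rewrite -/(P x) -/(Q x).
move: (P x) (Q x) (P (x + r *: u + s *: v)) (Q (x + r' *: u + s' *: v)).
move=> p q p' q' -> hP hQ.
by rewrite (le_trans (ler_distD q' _ _)) // [e]splitr ltW // ltrD // distrC.
Qed.

Lemma derive0_locally_cst D f (x : V) : open D -> D x ->
  (forall y, D y -> differentiable f y) ->
  (forall y u, D y -> 'D_u f y = 0) -> \forall y \near x, f y = f x.
Proof.
move=> oD Dx df Df.
have /nbhs_normP[d /= d0 dD] : nbhs x D by exact: open_nbhs_nbhs.
apply/nbhs_normP; exists d => //= y yd.
have seg s : 0 <= s <= 1 -> D (x + s *: (y - x)).
  move=> /andP[s0 s1]; apply: dD; rewrite /ball_ /= opprD addNKr normrN normrZ.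
  by rewrite ger0_norm // (le_lt_trans _ yd) // distrC ler_piMl.
have [c /andP[c0 c1]] := directional_MVT ltr01 seg df.
rewrite scale1r (addrC x) subrK mul1r Df.
  by move/eqP; rewrite subr_eq0 => /eqP.
by apply: seg; rewrite !ltW.
Qed.

End MeanValue.

(** * Smooth functions on a manifold *)

Lemma nearP_open (T : topologicalType) (x : T) (P : T -> Prop) :
  (\forall y \near x, P y) -> exists E : set T,
  [/\ open E, E x & forall y, E y -> P y].
Proof.
move=> nP; have : nbhs x [set y | P y] by exact: nP.
by rewrite nbhsE => -[E [oE Ex] EP]; exists E.
Qed.

Section SmoothManifold.
Context {R : realType} {n : nat} {M : topologicalType}.
Variables (A : set (chart R n M)) (hM : smooth_manifold A).
Local Notation vec := ((M -> R) -> R).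
Implicit Types (c : chart R n M) (p q : M) (f h : M -> R) (v w : vec)
  (X Y Z : M -> vec).

Lemma near_chart c p (P : 'rV[R]_n -> Prop) : A c -> chart_dom c p ->
  (\forall x \near chart_map c p, P x) -> \forall q \near p, P (chart_map c q).
Proof. by move=> /(atlas_chart hM) ic cp; exact: (chart_map_cont ic cp). Qed.

Lemma near_chart_inv c p (P : M -> Prop) : A c -> chart_dom c p ->
  (\forall q \near p, P q) ->
  \forall x \near chart_map c p, P (chart_inv c x).
Proof.
move=> /(atlas_chart hM) ic cp; rewrite -{1}(chart_mapK ic cp) => Pp.
exact: (chart_inv_cont ic (imageP _ cp)).
Qed.

Lemma near_chart_img c p : A c -> chart_dom c p ->
  \forall x \near chart_map c p, (chart_map c @` chart_dom c) x.
Proof.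
move=> /(atlas_chart hM) ic cp; apply: open_nbhs_nbhs; split; last by exists p.
exact: chart_img_open.
Qed.

Lemma near_chart_dom c p : A c -> chart_dom c p ->
  \forall q \near p, chart_dom c q.
Proof.
move=> /(atlas_chart hM) ic cp; apply: open_nbhs_nbhs; split=> //.
exact: chart_dom_open.
Qed.

Lemma chart_imgK c x : A c -> (chart_map c @` chart_dom c) x ->
  chart_dom c (chart_inv c x) /\ chart_map c (chart_inv c x) = x.
Proof. by move=> /(atlas_chart hM) ic [q cq <-]; rewrite (chart_mapK ic). Qed.

(** By the composition rule, as transition maps are smooth. The domain D is shrunk
    into the image of the chart, where chart_inv is an inverse. *)
Lemma smooth_chart c p f : A c -> chart_dom c p -> smooth_at A p f ->
  exists D : set 'rV[R]_n, [/\ open D, D (chart_map c p),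
    D `<=` chart_map c @` chart_dom c & Cinfty D (f \o chart_inv c)].
Proof.
move=> Ac cp [c' [D' [Ac' c'p oD' D'p sf]]].
have [ic ic'] := (atlas_chart hM Ac, atlas_chart hM Ac').
pose D := [set x | [/\ (chart_map c @` chart_dom c) x, chart_dom c' (chart_inv c x)
  & D' (chart_map c' (chart_inv c x))]].
have oD : open D.
  rewrite openE => x [ix c'x D'x].
  have [cx xK] := chart_imgK Ac ix.
  have h1 := near_chart_img Ac cx.
  have h2 := near_chart_inv Ac cx (near_chart_dom Ac' c'x).
  have h3 := near_chart_inv Ac cx (near_chart Ac' c'x (open_nbhs_nbhs (conj oD' D'x))).
  by rewrite /interior /= -xK; apply: filterS3 h1 h2 h3 => y; split.
exists D; split=> //.
- by split; [exists p|rewrite (chart_mapK ic)|rewrite (chart_mapK ic)].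
- by move=> x [].
move=> k.
have rd (x : 'rV[R]_n) : \sum_j x 0 j *: delta_mx 0 j = x.
  by rewrite [RHS]row_sum_delta.
apply: (@Ck_eq _ _ _ _ (fun x => (f \o chart_inv c')
  (\sum_j (chart_map c' (chart_inv c x)) 0 j *: delta_mx 0 j))) => //.
  by move=> x [_ c'x _] /=; rewrite rd (chart_mapK ic').
apply: (Ck_comp oD _ _ (sf k)) => [x [_ _]|j]; first by rewrite rd.
apply: Ck_subset (atlas_compat hM j Ac Ac' k) => x [ix c'x _].
by have [cx xK] := chart_imgK Ac ix; exists (chart_inv c x).
Qed.

Lemma smooth_at_near p f : smooth_at A p f -> \forall q \near p, smooth_at A q f.
Proof.
move=> [c [D [Ac cp oD Dp sf]]].
have Dn : \forall q \near p, D (chart_map c q).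
  by apply: near_chart => //; exact: open_nbhs_nbhs.
apply: filterS2 (near_chart_dom Ac cp) Dn => q cq Dq.
by exists c, D.
Qed.

Lemma smooth_at_eq p f h : (\forall q \near p, f q = h q) ->
  smooth_at A p f -> smooth_at A p h.
Proof.
move=> fh [c [D [Ac cp oD Dp sf]]].
have [E [oE Ep fhE]] := nearP_open (near_chart_inv Ac cp fh).
exists c, (D `&` E); split=> //; first exact: openI.
move=> k; apply: (@Ck_eq _ _ _ _ (f \o chart_inv c)) => [|x [_ Ex]|].
- exact: openI.
- exact: fhE.
- exact: Ck_subset (@subIsetl _ _ _) (sf k).
Qed.

Lemma smooth_cst p (t : R) : smooth_at A p (fun=> t).
Proof.
have [c Ac cp] := atlas_cover hM p.
exists c, setT; split=> //; first exact: openT.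
by move=> k; exact: Ck_cst.
Qed.

Lemma smooth_chart2 c p f h : A c -> chart_dom c p ->
  smooth_at A p f -> smooth_at A p h ->
  exists D : set 'rV[R]_n, [/\ open D, D (chart_map c p),
    Cinfty D (f \o chart_inv c) & Cinfty D (h \o chart_inv c)].
Proof.
move=> Ac cp /(smooth_chart Ac cp)[D [oD Dp _ sf]].
move=> /(smooth_chart Ac cp)[E [oE Ep _ sh]].
exists (D `&` E); split=> //; first exact: openI.
- by move=> k; exact: Ck_subset (@subIsetl _ _ _) (sf k).
- by move=> k; exact: Ck_subset (@subIsetr _ _ _) (sh k).
Qed.

Lemma smoothD p f h : smooth_at A p f -> smooth_at A p h ->
  smooth_at A p (fun q => f q + h q).
Proof.
have [c Ac cp] := atlas_cover hM p.
move=> sf sh; have [D [oD Dp Cf Ch]] := smooth_chart2 Ac cp sf sh.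
by exists c, D; split=> // k; exact: (CkD oD (Cf k) (Ch k)).
Qed.

Lemma smoothM p f h : smooth_at A p f -> smooth_at A p h ->
  smooth_at A p (fun q => f q * h q).
Proof.
have [c Ac cp] := atlas_cover hM p.
move=> sf sh; have [D [oD Dp Cf Ch]] := smooth_chart2 Ac cp sf sh.
by exists c, D; split=> // k; exact: (CkM oD (Cf k) (Ch k)).
Qed.

Lemma smoothN p f : smooth_at A p f -> smooth_at A p (fun q => - f q).
Proof.
move=> /(smoothM (smooth_cst p (-1))); apply: smooth_at_eq.
by apply: nearW => q; rewrite mulN1r.
Qed.

Lemma smoothB p f h : smooth_at A p f -> smooth_at A p h ->
  smooth_at A p (fun q => f q - h q).
Proof. by move=> sf /smoothN; exact: smoothD. Qed.

Lemma smooth_sum (I : Type) (s : seq I) (F : I -> M -> R) p :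
  (forall i, smooth_at A p (F i)) -> smooth_at A p (fun q => \sum_(i <- s) F i q).
Proof.
move=> sF; elim: s => [|i s IH].
  rewrite (_ : (fun _ => _) = fun=> 0); first exact: smooth_cst.
  by apply/funext => x; rewrite big_nil.
rewrite (_ : (fun _ => _) = fun x => F i x + \sum_(j <- s) F j x).
  exact: smoothD.
by apply/funext => x; rewrite big_cons.
Qed.

Lemma smooth_continuous p f : smooth_at A p f -> {for p, continuous f}.
Proof.
move=> [c [D [Ac cp oD Dp sf]]].
have ic := atlas_chart hM Ac.
have cf : {for chart_map c p, continuous (f \o chart_inv c)}.
  by apply: differentiable_continuous; have [+ _] := sf 1%N; exact.
move=> B; rewrite -[X in f X](chart_mapK ic cp) => /cf /(near_chart Ac cp) fB.
apply: filterS2 fB (near_chart_dom Ac cp) => q /=.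
by move=> + cq; rewrite (chart_mapK ic cq).
Qed.

Lemma smooth_comp (E : set R) (F : R -> R) p f : open E -> Cinfty E F ->
  E (f p) -> smooth_at A p f -> smooth_at A p (fun q => F (f q)).
Proof.
move=> oE CF Ef sf; have [c Ac cp] := atlas_cover hM p.
have ic := atlas_chart hM Ac.
have [D [oD Dp Di Cf]] := smooth_chart Ac cp sf.
have nE : \forall x \near chart_map c p, E (f (chart_inv c x)).
  apply: (near_chart_inv Ac cp (P := fun q => E (f q))).
  have cf := smooth_continuous sf; apply: (cf E).
  exact: open_nbhs_nbhs.
have [G [oG Gp GE]] := nearP_open nE.
exists c, (D `&` G); split=> //; first exact: openI.
move=> k; apply: (@Ck_comp1 _ _ (f \o chart_inv c) F k _ E) => //.
- exact: openI.
- by move=> x [_ /GE].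
- exact: Ck_subset (@subIsetl _ _ _) (Cf k).
Qed.

Lemma smoothV p f : smooth_at A p f -> f p != 0 ->
  smooth_at A p (fun q => (f q)^-1).
Proof.
move=> sf f0; apply: (@smooth_comp [set t | t != 0] GRing.inv) => //.
- by move=> k; exact: Ck_inv.
Qed.

End SmoothManifold.

(** * Tangent vectors *)

Section TangentVectors.
Context {R : realType} {n : nat} {M : topologicalType}.
Variables (A : set (chart R n M)) (hM : smooth_manifold A).
Local Notation vec := ((M -> R) -> R).
Implicit Types (c : chart R n M) (p q : M) (f h : M -> R) (v w : vec)
  (X Y Z : M -> vec).

Definition chart_vec c p (u : 'rV[R]_n) : vec := fun f =>
  if `[< smooth_at A p f >] then 'D_u (f \o chart_inv c) (chart_map c p) else 0.

Lemma chart_vecE c p u f : smooth_at A p f ->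
  chart_vec c p u f = 'D_u (f \o chart_inv c) (chart_map c p).
Proof. by move=> sf; rewrite /chart_vec asboolT. Qed.

Lemma chart_vec0 c p u f : ~ smooth_at A p f -> chart_vec c p u f = 0.
Proof. by move=> sf; rewrite /chart_vec asboolF. Qed.

Lemma tangent_chart_vec c p u : A c -> chart_dom c p -> tangent A p (chart_vec c p u).
Proof. by move=> Ac cp; exists c, u. Qed.

Lemma smooth_differentiable c p f : A c -> chart_dom c p -> smooth_at A p f ->
  differentiable (f \o chart_inv c) (chart_map c p).
Proof.
move=> Ac cp /(smooth_chart hM Ac cp)[D [oD Dp _ Cf]].
by have [+ _] := Cf 1%N; exact.
Qed.

Lemma sum_delta_row (x : 'rV[R]_n) : \sum_j x 0 j *: delta_mx 0 j = x.
Proof. by rewrite [RHS]row_sum_delta. Qed.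

(** The chain rule transports the direction from the chart that defines v to
    any other chart. This is why tangent vectors at p form a vector space. *)
Lemma tangentP c p v : A c -> chart_dom c p -> tangent A p v ->
  exists u, v = chart_vec c p u.
Proof.
move=> Ac cp [c' [u' [Ac' c'p ve]]].
have [ic ic'] := (atlas_chart hM Ac, atlas_chart hM Ac').
pose Phi j (x : 'rV[R]_n) := chart_map c (chart_inv c' x) 0 j.
have dPhi j : differentiable (Phi j) (chart_map c' p).
  have [+ _] := atlas_compat hM j Ac' Ac 1%N; apply.
  by exists p.
have [dS dSE] := derive_sum_scale (fun j => delta_mx 0 j : 'rV[R]_n) dPhi.
exists (\sum_j 'D_u' (Phi j) (chart_map c' p) *: delta_mx 0 j).
apply/funext => f; rewrite ve /chart_vec; case: asboolP => // sf.
pose G x := \sum_j Phi j x *: (delta_mx 0 j : 'rV[R]_n).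
have GE x : G x = chart_map c (chart_inv c' x) by rewrite /G sum_delta_row.
have Gp : G (chart_map c' p) = chart_map c p by rewrite GE (chart_mapK ic').
have df := smooth_differentiable Ac cp sf.
rewrite (@near_eq_derive _ _ _ _ ((f \o chart_inv c) \o G)); last first.
  have := near_chart_inv hM Ac' c'p (near_chart_dom hM Ac cp).
  by apply: filterS => x cx /=; rewrite GE (chart_mapK ic).
rewrite deriveE; last by apply: differentiable_comp => //; rewrite Gp.
rewrite diff_comp //; last by rewrite Gp.
by rewrite /= dSE Gp deriveE.
Qed.

Lemma chart_vec_linear c p t u u' : A c -> chart_dom c p ->
  chart_vec c p (t *: u + u') = t *: chart_vec c p u + chart_vec c p u'.
Proof.
move=> Ac cp; apply/funext => f; rewrite !fctE /=.
have [sf|sf] := pselect (smooth_at A p f); last first.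
  by rewrite !chart_vec0 // scaler0 addr0.
have df := smooth_differentiable Ac cp sf.
by rewrite !chart_vecE // !deriveE // linearP.
Qed.

Lemma tangent_lin p t v w : tangent A p v -> tangent A p w ->
  tangent A p (t *: v + w).
Proof.
have [c Ac cp] := atlas_cover hM p.
move=> /(tangentP Ac cp)[u ->] /(tangentP Ac cp)[u' ->].
by rewrite -chart_vec_linear //; exact: tangent_chart_vec.
Qed.

Lemma tangent0 p : tangent A p 0.
Proof.
have [c Ac cp] := atlas_cover hM p.
have tv := tangent_chart_vec 0 Ac cp.
by have := tangent_lin (-1) tv tv; rewrite scaleN1r addNr.
Qed.

Lemma tangentD p v w : tangent A p v -> tangent A p w -> tangent A p (v + w).
Proof. by move=> tv tw; have := tangent_lin 1 tv tw; rewrite scale1r. Qed.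

Lemma tangentZ p t v : tangent A p v -> tangent A p (t *: v).
Proof. by move=> tv; have := tangent_lin t tv (tangent0 p); rewrite addr0. Qed.

Lemma tangentN p v : tangent A p v -> tangent A p (- v).
Proof. by move=> tv; rewrite -scaleN1r; exact: tangentZ. Qed.

Lemma tangentB p v w : tangent A p v -> tangent A p w -> tangent A p (v - w).
Proof. by move=> tv /tangentN; exact: tangentD. Qed.

(** The smoothness test in the definition of tangent vectors is insensitive to
    the choice of a representative of a germ. *)
Lemma tangent_near p v f h : tangent A p v -> (\forall q \near p, f q = h q) ->
  v f = v h.
Proof.
move=> [c [u [Ac cp ve]]] fh; rewrite !ve.
have sfh : smooth_at A p f <-> smooth_at A p h.
  by split; apply: smooth_at_eq hM _ _ _ _ => //; apply: filterS fh.
rewrite (asbool_equiv_eq sfh); case: asboolP => // _.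
by apply: near_eq_derive; exact: (near_chart_inv hM Ac cp fh).
Qed.

Lemma tangent_cst p v (t : R) : tangent A p v -> v (fun=> t) = 0.
Proof.
move=> [c [u [Ac cp ->]]]; case: asboolP => // _.
by rewrite (_ : _ \o _ = cst t) // derive_cst.
Qed.

Lemma tangent_add p v f h : tangent A p v -> smooth_at A p f -> smooth_at A p h ->
  v (fun q => f q + h q) = v f + v h.
Proof.
move=> [c [u [Ac cp ve]]] sf sh; rewrite !ve !asboolT //; last exact: smoothD.
by rewrite -deriveD //; apply: diff_derivable; exact: smooth_differentiable.
Qed.

Lemma tangent_mul p v f h : tangent A p v -> smooth_at A p f -> smooth_at A p h ->
  v (fun q => f q * h q) = v f * h p + f p * v h.
Proof.
move=> [c [u [Ac cp ve]]] sf sh; rewrite !ve !asboolT //; last exact: smoothM.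
have [df dh] := (smooth_differentiable Ac cp sf, smooth_differentiable Ac cp sh).
have -> : (fun q => f q * h q) \o chart_inv c = (f \o chart_inv c) * (h \o chart_inv c).
  by [].
rewrite deriveM; [|exact: diff_derivable..].
rewrite /= (chart_mapK (atlas_chart hM Ac) cp) /GRing.scale /=; ring.
Qed.

Lemma tangent_scale p v t f : tangent A p v -> smooth_at A p f ->
  v (fun q => t * f q) = t * v f.
Proof.
move=> tv sf; rewrite (tangent_mul tv (smooth_cst hM p t) sf).
by rewrite (tangent_cst _ tv) mul0r add0r.
Qed.

Lemma tangent_sumf p v (I : Type) (s : seq I) (F : I -> M -> R) : tangent A p v ->
  (forall i, smooth_at A p (F i)) ->
  v (fun q => \sum_(i <- s) F i q) = \sum_(i <- s) v (F i).
Proof.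
move=> tv sF; elim: s => [|i s IH].
  rewrite big_nil (_ : (fun _ => _) = fun=> 0) ?(tangent_cst _ tv) //.
  by apply/funext => x; rewrite big_nil.
rewrite (_ : (fun _ => _) = fun x => F i x + \sum_(j <- s) F j x).
  by rewrite (tangent_add tv (sF i) (smooth_sum hM s sF)) big_cons IH.
by apply/funext => x; rewrite big_cons.
Qed.

Lemma tangent_comp (E : set R) (F : R -> R) p v f : open E -> Cinfty E F ->
  E (f p) -> tangent A p v -> smooth_at A p f ->
  v (fun q => F (f q)) = derive1 F (f p) * v f.
Proof.
move=> oE CF Ef [c [u [Ac cp ve]]] sf; rewrite !ve !asboolT //; last first.
  exact: (smooth_comp hM oE CF Ef sf).
have df := smooth_differentiable Ac cp sf.
have dF : differentiable F ((f \o chart_inv c) (chart_map c p)).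
  rewrite /= (chart_mapK (atlas_chart hM Ac) cp).
  by have [+ _] := CF 1%N; exact.
rewrite (_ : _ \o _ = F \o (f \o chart_inv c)) //.
rewrite deriveE; last exact: differentiable_comp.
rewrite diff_comp //= -(deriveE _ df) -[X in 'd F _ X]mulr1.
rewrite [LHS]linearZ /= mulrC -derive1E' //.
by rewrite /= (chart_mapK (atlas_chart hM Ac) cp).
Qed.

End TangentVectors.

(** * Vector fields and their commutators *)

Section VectorFields.
Context {R : realType} {n : nat} {M : topologicalType}.
Variables (A : set (chart R n M)) (hM : smooth_manifold A).
Local Notation vec := ((M -> R) -> R).
Implicit Types (c : chart R n M) (p q : M) (f h : M -> R) (v w : vec)
  (X Y Z : M -> vec).

Lemma vfield_tangent p Y : vfield_at A p Y -> tangent A p (Y p).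
Proof. by move=> /nbhs_singleton[]. Qed.

Lemma vfield_smooth p Y f : vfield_at A p Y -> smooth_at A p f ->
  smooth_at A p (fun q => Y q f).
Proof. by move=> /nbhs_singleton[_]; exact. Qed.

Lemma vfield_near p Y : vfield_at A p Y -> \forall q \near p, vfield_at A q Y.
Proof. exact: near_join. Qed.

Lemma vfield_eq p Y Z : (\forall q \near p, Y q = Z q) ->
  vfield_at A p Y -> vfield_at A p Z.
Proof.
move=> /near_join YZ; apply: filterS2 YZ => q YZ [tY sY].
split; first by rewrite -(nbhs_singleton YZ).
move=> f /sY; apply: smooth_at_eq => //.
by apply: filterS YZ => r ->.
Qed.

Lemma vfieldD p Y Z : vfield_at A p Y -> vfield_at A p Z ->
  vfield_at A p (fun q => Y q + Z q).
Proof.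
apply: filterS2 => q [tY sY] [tZ sZ]; split; first exact: tangentD.
by move=> f sf; exact: (smoothD hM (sY _ sf) (sZ _ sf)).
Qed.

Lemma vfieldZ p h Y : smooth_at A p h -> vfield_at A p Y ->
  vfield_at A p (fun q => h q *: Y q).
Proof.
move=> /(smooth_at_near hM); apply: filterS2 => q sh [tY sY].
split; first exact: tangentZ.
by move=> f sf; exact: (smoothM hM sh (sY _ sf)).
Qed.

Lemma vfieldN p Y : vfield_at A p Y -> vfield_at A p (fun q => - Y q).
Proof.
move=> /(vfieldZ (smooth_cst hM p (-1))); apply: vfield_eq.
by apply: nearW => q; rewrite scaleN1r.
Qed.

Lemma vfieldB p Y Z : vfield_at A p Y -> vfield_at A p Z ->
  vfield_at A p (fun q => Y q - Z q).
Proof. by move=> vY /vfieldN; exact: vfieldD. Qed.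

Lemma vfield_chart c p u : A c -> chart_dom c p ->
  vfield_at A p (fun q => chart_vec A c q u).
Proof.
move=> Ac cp; apply: filterS (near_chart_dom hM Ac cp) => q cq.
split; first exact: tangent_chart_vec.
move=> f sf; have [D [oD Dq Di Cf]] := smooth_chart hM Ac cq sf.
exists c, D; split=> // k.
apply: (@Ck_eq _ _ _ _ (fun x => 'D_u (f \o chart_inv c) x)) => //.
  move=> x Dx; have [cx xK] := chart_imgK hM Ac (Di _ Dx).
  by rewrite /= chart_vecE ?xK //; exists c, D; rewrite xK.
by have [_ +] := Cf k.+1; exact.
Qed.

(** A direction that is constant in a chart defines a field; tensorial
    identities for fields thereby become identities for vectors. *)
Lemma tangent_extend p v : tangent A p v -> exists2 Y, vfield_at A p Y & Y p = v.
Proof.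
have [c Ac cp] := atlas_cover hM p.
move=> /(tangentP hM Ac cp)[u ->].
by exists (fun q => chart_vec A c q u) => //; exact: vfield_chart.
Qed.

Definition coord c (j : 'I_n) : M -> R := fun q => chart_map c q 0 j.

Lemma smooth_coord c p j : A c -> chart_dom c p -> smooth_at A p (coord c j).
Proof.
move=> Ac cp; have ic := atlas_chart hM Ac.
exists c, (chart_map c @` chart_dom c); split=> //.
- exact: chart_img_open.
- by have := atlas_compat hM j Ac Ac; rewrite setIid.
Qed.

Lemma derive_coord j (x u : 'rV[R]_n) : 'D_u (fun y : 'rV[R]_n => y 0 j) x = u 0 j.
Proof.
have dc i : differentiable (fun y : 'rV[R]_n => y 0 i) x by exact: differentiable_coord.
have [_ /(_ u)] := derive_sum_scale (fun j => delta_mx 0 j : 'rV[R]_n) dc.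
rewrite (_ : (fun y => _) = id); last by apply/funext => y; rewrite sum_delta_row.
rewrite diff_val => /(congr1 (fun z : 'rV[R]_n => z 0 j)) /= ->.
rewrite summxE (bigD1 j) //= !mxE !eqxx mulr1 big1 ?addr0 // => i ij.
by rewrite !mxE eqxx /= eq_sym (negbTE ij) mulr0.
Qed.

Lemma chart_vec_coord c p u j : A c -> chart_dom c p ->
  chart_vec A c p u (coord c j) = u 0 j.
Proof.
move=> Ac cp; rewrite chart_vecE; last exact: smooth_coord.
rewrite -[RHS](derive_coord j (chart_map c p)); apply: near_eq_derive.
apply: filterS (near_chart_img hM Ac cp) => x ix /=.
by rewrite /coord; have [_ ->] := chart_imgK hM Ac ix.
Qed.

Lemma chart_vec_sum c p (a : 'I_n -> R) : A c -> chart_dom c p ->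
  chart_vec A c p (\sum_j a j *: delta_mx 0 j) =
  \sum_j a j *: chart_vec A c p (delta_mx 0 j).
Proof.
move=> Ac cp.
have c0 : chart_vec A c p 0 = 0.
  have := chart_vec_linear hM (-1) 0 0 Ac cp.
  by rewrite scaler0 add0r scaleN1r addNr.
have cD u u' : chart_vec A c p (u + u') = chart_vec A c p u + chart_vec A c p u'.
  by have := chart_vec_linear hM 1 u u' Ac cp; rewrite !scale1r.
rewrite (big_morph _ cD c0); apply: eq_bigr => j _.
by have := chart_vec_linear hM (a j) (delta_mx 0 j) 0 Ac cp; rewrite c0 !addr0.
Qed.

Lemma tangent_coordE c p v f : A c -> chart_dom c p -> tangent A p v ->
  v f = \sum_j v (coord c j) * chart_vec A c p (delta_mx 0 j) f.
Proof.
move=> Ac cp /(tangentP hM Ac cp)[u ->].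
rewrite -{1}(sum_delta_row u) chart_vec_sum // fct_sumE.
by apply: eq_bigr => j _; rewrite chart_vec_coord.
Qed.

Lemma chart_vec_comm c p f i j : A c -> chart_dom c p -> smooth_at A p f ->
  chart_vec A c p (delta_mx 0 i) (fun q => chart_vec A c q (delta_mx 0 j) f) =
  chart_vec A c p (delta_mx 0 j) (fun q => chart_vec A c q (delta_mx 0 i) f).
Proof.
move=> Ac cp sf.
have [D [oD Dp Di Cf]] := smooth_chart hM Ac cp sf.
have E k l : chart_vec A c p (delta_mx 0 k) (fun q => chart_vec A c q (delta_mx 0 l) f)
   = 'D_(delta_mx 0 k) (fun x => 'D_(delta_mx 0 l) (f \o chart_inv c) x) (chart_map c p).
  rewrite chart_vecE; last exact: vfield_smooth (vfield_chart _ Ac cp) sf.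
  apply: near_eq_derive; apply: filterS (open_nbhs_nbhs (conj oD Dp)) => x Dx /=.
  have [cx xK] := chart_imgK hM Ac (Di _ Dx).
  by rewrite /= chart_vecE ?xK //; exists c, D; rewrite xK.
by rewrite !E; exact: derive_comm oD Dp (Cf 3%N).
Qed.

(** In a chart the second derivatives cancel by symmetry, so that the commutator
    of two fields is again a derivative along a direction. *)
Lemma bracket_tangent p Y Z : vfield_at A p Y -> vfield_at A p Z ->
  tangent A p (bracket A Y Z p).
Proof.
move=> vY vZ; have [c Ac cp] := atlas_cover hM p.
pose dd j q := chart_vec A c q (delta_mx 0 j).
have vd j : vfield_at A p (dd j) by exact: vfield_chart.
pose a (W : M -> vec) j q := W q (coord c j).
have sa W j : vfield_at A p W -> smooth_at A p (a W j).
  by move=> vW; exact: (vfield_smooth vW (smooth_coord j Ac cp)).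
have expand W1 W2 f : vfield_at A p W1 -> vfield_at A p W2 -> smooth_at A p f ->
    W1 p (fun q => W2 q f) = \sum_j W1 p (a W2 j) * dd j p f
      + \sum_j \sum_i a W2 j p * a W1 i p * dd i p (fun q => dd j q f).
  move=> vW1 vW2 sf; have tW1 := vfield_tangent vW1.
  rewrite (@tangent_near _ _ _ _ hM _ _ _ (fun q => \sum_j a W2 j q * dd j q f) tW1).
    have sd j : smooth_at A p (fun q => dd j q f) by exact: vfield_smooth (vd j) sf.
    rewrite (tangent_sumf hM _ tW1) => [|j]; last exact: (smoothM hM (sa _ _ vW2) (sd j)).
    rewrite -big_split; apply: eq_bigr => j _ /=.
    rewrite (tangent_mul hM tW1 (sa _ _ vW2) (sd j)); congr (_ + _).
    rewrite (tangent_coordE _ Ac cp tW1) mulr_sumr.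
    by apply: eq_bigr => i _; rewrite mulrA.
  apply: filterS2 (near_chart_dom hM Ac cp) vW2 => q cq [tq _].
  exact: tangent_coordE.
suff -> : bracket A Y Z p =
    chart_vec A c p (\sum_j (Y p (a Z j) - Z p (a Y j)) *: delta_mx 0 j).
  exact: tangent_chart_vec.
rewrite chart_vec_sum //; apply/funext => f; rewrite fct_sumE.
have [sf|sf] := pselect (smooth_at A p f); last first.
  rewrite /bracket asboolF // big1 // => j _.
  by rewrite fctE chart_vec0 // scaler0.
rewrite /bracket asboolT // (expand _ _ _ vY vZ sf) (expand _ _ _ vZ vY sf).
rewrite [X in _ - (_ + X)]exchange_big /=.
rewrite [X in _ - (_ + X)](_ : _ =
    \sum_j \sum_i a Z j p * a Y i p * dd i p (fun q => dd j q f)); last first.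
  apply: eq_bigr => j _; apply: eq_bigr => i _.
  by rewrite (mulrC (a Y i p)) /dd (chart_vec_comm _ _ Ac cp sf).
rewrite opprD addrACA subrr addr0 -sumrB; apply: eq_bigr => j _.
by rewrite -mulrBl.
Qed.

Lemma vfield_bracket p Y Z : vfield_at A p Y -> vfield_at A p Z ->
  vfield_at A p (bracket A Y Z).
Proof.
move=> /vfield_near vY /vfield_near vZ; apply: filterS2 vY vZ => q vY vZ.
split; first exact: bracket_tangent.
move=> f sf.
have := smoothB hM (vfield_smooth vY (vfield_smooth vZ sf))
  (vfield_smooth vZ (vfield_smooth vY sf)).
apply: smooth_at_eq hM _ _ _ _; apply: filterS (smooth_at_near hM sf) => r sr.
by rewrite /bracket asboolT.
Qed.

End VectorFields.

(** * Quaternionic linear algebra at a point *)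

(** A hyperhermitian symmetric bilinear form, possibly degenerate. The space is a
    subset T of an ambient vector space because it will be a tangent space, which
    lives in the space of functionals on functions. *)
Record quat_space (R : realType) (V : lmodType R) (T : V -> Prop)
    (g : V -> V -> R) (I J K : V -> V) : Prop := {
  qs_T0 : T 0;
  qs_lin : forall t u v, T u -> T v -> T (t *: u + v);
  qs_TI : forall v, T v -> T (I v);
  qs_TJ : forall v, T v -> T (J v);
  qs_TK : forall v, T v -> T (K v);
  qs_Ilin : forall t u v, T u -> T v -> I (t *: u + v) = t *: I u + I v;
  qs_Jlin : forall t u v, T u -> T v -> J (t *: u + v) = t *: J u + J v;
  qs_Klin : forall t u v, T u -> T v -> K (t *: u + v) = t *: K u + K v;
  qs_II : forall v, T v -> I (I v) = - v;
  qs_JJ : forall v, T v -> J (J v) = - v;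
  qs_KK : forall v, T v -> K (K v) = - v;
  qs_IJ : forall v, T v -> I (J v) = K v;
  qs_JI : forall v, T v -> J (I v) = - K v;
  qs_glin : forall t u v w, T u -> T v -> T w ->
    g (t *: u + v) w = t * g u w + g v w;
  qs_gsym : forall v w, T v -> T w -> g v w = g w v;
  qs_gI : forall v w, T v -> T w -> g (I v) (I w) = g v w;
  qs_gJ : forall v w, T v -> T w -> g (J v) (J w) = g v w;
  qs_gK : forall v w, T v -> T w -> g (K v) (K w) = g v w }.

Section QuatSpace.
Context {R : realType} {V : lmodType R} {T : V -> Prop} {g : V -> V -> R}
  {I J K : V -> V}.
Variable qs : quat_space T g I J K.
Implicit Types (u v w z : V) (t : R).

Lemma qT0 : T 0. Proof. exact: qs_T0 qs. Qed.
Lemma qTD u v : T u -> T v -> T (u + v).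
Proof. by move=> Tu Tv; have := qs_lin qs 1 Tu Tv; rewrite scale1r. Qed.
Lemma qTZ t u : T u -> T (t *: u).
Proof. by move=> Tu; have := qs_lin qs t Tu qT0; rewrite addr0. Qed.
Lemma qTN u : T u -> T (- u).
Proof. by move=> Tu; rewrite -scaleN1r; exact: qTZ. Qed.
Lemma qTI u : T u -> T (I u). Proof. exact: (qs_TI qs). Qed.
Lemma qTJ u : T u -> T (J u). Proof. exact: (qs_TJ qs). Qed.
Lemma qTK u : T u -> T (K u). Proof. exact: (qs_TK qs). Qed.

(** Statements about I yield those about J and K by this symmetry. *)
Lemma quat_space_cyc : quat_space T g J K I.
Proof.
have TJ := qTJ; have TK := qTK; have TI := qTI.
have I0 : I 0 = 0.
  have := qs_Ilin qs (-1) qT0 qT0.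
  by rewrite !scaleN1r !addNr.
have IN v : T v -> I (- v) = - I v.
  by move=> Tv; have := qs_Ilin qs (-1) Tv qT0; rewrite I0 !addr0 !scaleN1r.
have KJ v : T v -> K (J v) = - I v.
  by move=> Tv; rewrite -(qs_IJ qs (TJ _ Tv)) (qs_JJ qs Tv) IN.
have JK v : T v -> J (K v) = I v.
  by move=> Tv; rewrite -(qs_IJ qs Tv) (qs_JI qs (TJ _ Tv)) KJ // opprK.
by split=> //; case: qs.
Qed.

End QuatSpace.

(** Membership in T of a linear combination of images under I, J and K; the
    argument extra treats the other operators. *)
Ltac quat_mem qs extra :=
  lazymatch type of qs with quat_space ?T _ ?I ?J ?K =>
  lazymatch goal with |- T ?e => tryif is_evar e then fail else lazymatch e with
    | (_ + _) => apply: (qTD qs); quat_mem qs extra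
    | (- _) => apply: (qTN qs); quat_mem qs extra
    | (_ *: _) => apply: (qTZ qs); quat_mem qs extra
    | I _ => apply: (qTI qs); quat_mem qs extra
    | J _ => apply: (qTJ qs); quat_mem qs extra
    | K _ => apply: (qTK qs); quat_mem qs extra
    | 0 => exact: (qT0 qs)
    | _ => first [assumption | extra; quat_mem qs extra]
    end end end.

Section QuatLinearity.
Context {R : realType} {V : lmodType R} {T : V -> Prop} {g : V -> V -> R}
  {I J K : V -> V}.
Variable qs : quat_space T g I J K.
Implicit Types (u v w z : V) (t : R).

Local Hint Extern 0 (T _) => solve [quat_mem qs ltac:(fail)] : core.

Lemma qI0 : I 0 = 0.
Proof. by have := qs_Ilin qs (-1) (qT0 qs) (qT0 qs); rewrite !scaleN1r !addNr. Qed.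
Lemma qID u v : T u -> T v -> I (u + v) = I u + I v.
Proof. by move=> Tu Tv; have := qs_Ilin qs 1 Tu Tv; rewrite !scale1r. Qed.
Lemma qIZ t u : T u -> I (t *: u) = t *: I u.
Proof. by move=> Tu; have := qs_Ilin qs t Tu (qT0 qs); rewrite qI0 !addr0. Qed.
Lemma qIN u : T u -> I (- u) = - I u.
Proof. by move=> Tu; rewrite -scaleN1r qIZ // scaleN1r. Qed.

Lemma q_gDl u v w : T u -> T v -> T w -> g (u + v) w = g u w + g v w.
Proof.
by move=> Tu Tv Tw; have := qs_glin qs 1 Tu Tv Tw; rewrite scale1r mul1r.
Qed.
Lemma q_g0l w : T w -> g 0 w = 0.
Proof. by move=> Tw; apply: (addrI (g 0 w)); rewrite -q_gDl // !addr0. Qed.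
Lemma q_gZl t u w : T u -> T w -> g (t *: u) w = t * g u w.
Proof.
by move=> Tu Tw; have := qs_glin qs t Tu (qT0 qs) Tw; rewrite q_g0l // !addr0.
Qed.
Lemma q_gNl u w : T u -> T w -> g (- u) w = - g u w.
Proof. by move=> Tu Tw; rewrite -scaleN1r q_gZl // mulN1r. Qed.
Lemma q_gDr w u v : T u -> T v -> T w -> g w (u + v) = g w u + g w v.
Proof. by move=> *; rewrite !(qs_gsym qs (v := w)) // q_gDl. Qed.
Lemma q_gZr t w u : T u -> T w -> g w (t *: u) = t * g w u.
Proof. by move=> *; rewrite !(qs_gsym qs (v := w)) // q_gZl. Qed.
Lemma q_gNr w u : T u -> T w -> g w (- u) = - g w u.
Proof. by move=> *; rewrite !(qs_gsym qs (v := w)) // q_gNl. Qed.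
Lemma q_g0r w : T w -> g w 0 = 0.
Proof. by move=> *; rewrite !(qs_gsym qs (v := w)) // q_g0l. Qed.

Lemma q_gIr u v : T u -> T v -> g u (I v) = - g (I u) v.
Proof.
by move=> Tu Tv; rewrite -(qs_gI qs) // (qs_II qs) // q_gNr.
Qed.

Lemma q_gIflip u v : T u -> T v -> g (I u) v = - g (I v) u.
Proof. by move=> Tu Tv; rewrite (qs_gsym qs) // q_gIr. Qed.

Lemma q_gIid u : T u -> g (I u) u = 0.
Proof. by move=> Tu; have := q_gIflip Tu Tu; lra. Qed.

End QuatLinearity.

Section QuatRules.
Context {R : realType} {V : lmodType R} {T : V -> Prop} {g : V -> V -> R}
  {I J K : V -> V}.
Variable qs : quat_space T g I J K.
Let qs' := quat_space_cyc qs.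
Let qs'' := quat_space_cyc qs'.
Local Hint Extern 0 (T _) => solve [quat_mem qs ltac:(fail)] : core.

Lemma q_JK v : T v -> J (K v) = I v. Proof. exact: (qs_IJ qs'). Qed.
Lemma q_KJ v : T v -> K (J v) = - I v. Proof. exact: (qs_JI qs'). Qed.
Lemma q_KI v : T v -> K (I v) = J v. Proof. exact: (qs_IJ qs''). Qed.
Lemma q_IK v : T v -> I (K v) = - J v. Proof. exact: (qs_JI qs''). Qed.

Definition q_unit := (qs_II qs, qs_JJ qs, qs_KK qs, qs_IJ qs, qs_JI qs,
  q_JK, q_KJ, q_KI, q_IK).
Definition q_lin := (qI0 qs, qI0 qs', qI0 qs'', (qID qs, qID qs', qID qs''),
  (qIZ qs, qIZ qs', qIZ qs''), (qIN qs, qIN qs', qIN qs'')).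
Definition q_gl := (q_gDl qs, q_gZl qs, q_gNl qs, q_g0l qs).
Definition q_gr := (q_gDr qs, q_gZr qs, q_gNr qs, q_g0r qs).
Definition q_gqr := (q_gIr qs, q_gIr qs', q_gIr qs'').
Definition q_gid := (q_gIid qs, q_gIid qs', q_gIid qs'').

End QuatRules.

(** * The deformed metric and connection at a point *)

(** What is known of the torsion tau of an HKT connection at the value x of a
    special homothety of type (a, b), with s = a + b: total skewness, vanishing of
    tau on x, and the commutators of tau (I x), tau (J x), tau (K x) with I, J, K. *)
Record quat_torsion (R : realType) (V : lmodType R) (T : V -> Prop)
    (g : V -> V -> R) (I J K : V -> V) (x : V) (tau : V -> V -> V) (s : R)
    : Prop := {
  qt_T : forall y z, T y -> T z -> T (tau y z);
  qt_lin : forall t y u v, T y -> T u -> T v ->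
    tau y (t *: u + v) = t *: tau y u + tau y v;
  qt_alt : forall y z, T y -> T z -> tau y z = - tau z y;
  qt_skew : forall w y z, T w -> T y -> T z -> g w (tau y z) = - g y (tau w z);
  qt_x : forall y z, T y -> T z -> g x (tau y z) = 0;
  qt_II : forall z, T z -> tau (I x) (I z) = I (tau (I x) z);
  qt_JJ : forall z, T z -> tau (J x) (J z) = J (tau (J x) z);
  qt_KK : forall z, T z -> tau (K x) (K z) = K (tau (K x) z);
  qt_IJ : forall z, T z -> tau (I x) (J z) = J (tau (I x) z) - s *: K z;
  qt_JK : forall z, T z -> tau (J x) (K z) = K (tau (J x) z) - s *: I z;
  qt_KI : forall z, T z -> tau (K x) (I z) = I (tau (K x) z) - s *: J z }.

Lemma quat_torsion_cyc (R : realType) (V : lmodType R) (T : V -> Prop)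
    (g : V -> V -> R) (I J K : V -> V) (x : V) (tau : V -> V -> V) (s : R) :
  quat_torsion T g I J K x tau s -> quat_torsion T g J K I x tau s.
Proof. by case. Qed.

Section TorsionX.
Context {R : realType} {V : lmodType R} {T : V -> Prop} {g : V -> V -> R}
  {I J K : V -> V}.
Variable qs : quat_space T g I J K.
Variables (x : V) (Tx : T x) (tau : V -> V -> V) (s : R).
Hypothesis qt : quat_torsion T g I J K x tau s.

Local Hint Extern 0 (T _) => solve [quat_mem qs ltac:(apply: (qt_T qt))] : core.

(** The shift by (s / 2) L makes tau (L x) commute with I, J and K: it cancels the
    commutators - s K, - s I, - s J, since for instance I J - J I = 2 K. *)
Definition torsion_qlin (L : V -> V) z : V := tau (L x) z + (s / 2) *: L z.

Lemma torsion_qlinT z : T z -> T (torsion_qlin I z). Proof. by rewrite /torsion_qlin =>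
  Tz. Qed.

Lemma torsion_qlinI z : T z -> torsion_qlin I (I z) = I (torsion_qlin I z).
Proof. by move=> Tz; rewrite /torsion_qlin (qt_II qt) // !(q_lin qs). Qed.

Lemma torsion_qlinJ z : T z -> torsion_qlin I (J z) = J (torsion_qlin I z).
Proof.
move=> Tz; rewrite /torsion_qlin (qt_IJ qt) // !(q_lin qs) // !(q_unit qs) //.
rewrite -addrA; congr (_ + _); rewrite scalerN.
rewrite -!scaleNr -scalerDl; congr (_ *: _). rewrite -[RHS]/(- s * 2^-1); lra.
Qed.

Lemma torsion_qlinK z : T z -> torsion_qlin I (K z) = K (torsion_qlin I z).
Proof.
move=> Tz; rewrite -(qs_IJ qs Tz) torsion_qlinI // torsion_qlinJ // (qs_IJ qs) //.
exact: torsion_qlinT.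
Qed.

Lemma torsion_qlin_lin t u v : T u -> T v -> torsion_qlin I (t *: u + v) =
  t *: torsion_qlin I u + torsion_qlin I v.
Proof.
move=> Tu Tv; rewrite /torsion_qlin (qt_lin qt) // (qs_Ilin qs) // !scalerDr !scalerA.
by rewrite (mulrC t) addrACA.
Qed.

Lemma torsion_qlin_skew y z : T y -> T z -> g (torsion_qlin I y) z = - g (torsion_qlin I z) y.
Proof.
move=> Ty Tz; rewrite /torsion_qlin !(q_gl qs) // (q_gIflip qs Ty) //.
rewrite (qs_gsym qs _ Tz) // (qt_alt qt) // (q_gr qs) // (qt_skew qt) //.
rewrite (qt_alt qt Tz) // (q_gr qs) // (qs_gsym qs Ty) //; ring.
Qed.

Lemma torsion_qlinE y z : T y -> T z ->
  g (I x) (tau y z) = g (torsion_qlin I y) z - s / 2 * g (I y) z.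
Proof.
move=> Ty Tz; rewrite torsion_qlin_skew // /torsion_qlin (qt_skew qt) //.
rewrite !(q_gl qs) // (qs_gsym qs Ty) // (q_gIflip qs Tz) //; ring.
Qed.
End TorsionX.

Section Deformation.
Context {R : realType} {V : lmodType R} {T : V -> Prop} {g : V -> V -> R}
  {I J K : V -> V}.
Variable qs : quat_space T g I J K.
Hypothesis nondeg : forall u, T u -> (forall w, T w -> g u w = 0) -> u = 0.
Variables (x : V) (Tx : T x).
Variables (phi psi : R).

Local Hint Extern 0 (T _) => solve [quat_mem qs ltac:(fail)] : core.

(** Up to the factor g x x, the orthogonal projection on the quaternionic line
    of x. *)
Definition qproj z : V :=
  g x z *: x + g (I x) z *: I x + g (J x) z *: J x + g (K x) z *: K x.

Definition qform v w : R :=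
  g x v * g x w + g (I x) v * g (I x) w + g (J x) v * g (J x) w
  + g (K x) v * g (K x) w.

(** The value at a point of f' g + f'' / 2 (d^H mu)^2, since the differential of mu
    is a multiple of g x. *)
Definition deform_form v w : R := phi * g v w + psi * qform v w.

(** The endomorphism G with deform_form v w = g (G v) w is phi on the orthogonal
    of the quaternionic line of x and phi + psi * g x x on this line; this is its
    inverse. *)
Definition deform_form_inv z : V :=
  phi^-1 *: (z - (psi / (phi + psi * g x x)) *: qproj z).

Lemma qprojT z : T (qproj z). Proof. by rewrite /qproj. Qed.
Local Hint Resolve qprojT : core.

Lemma g_qproj z w : T z -> T w -> g (qproj z) w = qform z w.
Proof. by move=> Tz Tw; rewrite /qproj !(q_gl qs) // /qform; ring. Qed.

Lemma qform_qproj z w : T z -> T w -> qform (qproj z) w = g x x * qform z w.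
Proof.
move=> Tz Tw; rewrite /qform /qproj !(q_gr qs) // !(q_gqr qs) // !(q_unit qs) //.
by rewrite !(q_gl qs) // !(q_gid qs) //; ring.
Qed.

Lemma qform_sym v w : qform v w = qform w v.
Proof. by rewrite /qform; ring. Qed.

(** Left multiplication by I permutes 1, I, J, K up to sign, and qform is a sum of
    squares over these four. *)
Lemma qformI v w : T v -> T w -> qform (I v) w = - qform v (I w).
Proof.
move=> Tv Tw; rewrite /qform !(q_gqr qs) // !(q_unit qs) //.
by rewrite !(q_gl qs) //; ring.
Qed.

Lemma deform_form_invT z : T z -> T (deform_form_inv z).
Proof. by move=> Tz; apply: (qTZ qs); apply: (qTD qs) => //; apply/(qTN qs)/(qTZ qs). Qed.

Lemma deform_form_invE z w : phi != 0 -> phi + psi * g x x != 0 -> T z -> T w ->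
  deform_form (deform_form_inv z) w = g z w.
Proof.
move=> p0 l0 Tz Tw.
rewrite /deform_form /deform_form_inv.
move: (qproj z) (qprojT z) (g_qproj Tz Tw) (qform_qproj Tz Tw) => P TP gP qP.
set t := psi / _.
have -> : qform (phi^-1 *: (z - t *: P)) w = phi^-1 * (qform z w - t * qform P w).
  by rewrite /qform !(q_gr qs) //; ring.
by rewrite qP !(q_gl qs) // gP /t; field; rewrite p0 l0.
Qed.

Lemma deform_form_quat_space : quat_space T deform_form I J K.
Proof.
split; try by case: qs.
- move=> t u v w Tu Tv Tw; rewrite /deform_form /qform !(q_gl qs, q_gr qs) //; ring.
- by move=> v w Tv Tw; rewrite /deform_form qform_sym (qs_gsym qs).
- move=> v w Tv Tw; rewrite /deform_form (qs_gI qs) // qformI // (qs_II qs) //.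
  by rewrite /qform !(q_gr qs) //; ring.
- move=> v w Tv Tw; rewrite /deform_form (qs_gJ qs) // /qform.
  rewrite !(q_gqr qs) // !(q_unit qs) // !(q_gl qs) //; ring.
- move=> v w Tv Tw; rewrite /deform_form (qs_gK qs) // /qform.
  rewrite !(q_gqr qs) // !(q_unit qs) // !(q_gl qs) //; ring.
Qed.

Lemma deform_form_nondeg : phi != 0 -> phi + psi * g x x != 0 ->
  forall u, T u -> (forall w, T w -> deform_form u w = 0) -> u = 0.
Proof.
move=> p0 l0 u Tu Eu; apply: nondeg => // w Tw.
have Ti := deform_form_invT Tw.
by rewrite (qs_gsym qs) // -(deform_form_invE p0 l0) // (qs_gsym deform_form_quat_space) // Eu.
Qed.

(** Vector identities are reduced to scalar ones, which ring can settle. *)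
Lemma q_ext u u' : T u -> T u' -> (forall w, T w -> g u w = g u' w) -> u = u'.
Proof.
move=> Tu Tu' E; apply/eqP; rewrite -subr_eq0; apply/eqP/nondeg => [//|w Tw].
by rewrite !(q_gl qs) // E // subrr.
Qed.

Lemma qprojI z : T z -> qproj (I z) = I (qproj z).
Proof.
move=> Tz; have Tp := qprojT z; have TIz := qTI qs Tz.
apply: q_ext => [||w Tw]; [exact: qprojT|exact: (qTI qs)|].
have TIw := qTI qs Tw.
by rewrite g_qproj // qformI // -g_qproj // (q_gIr qs) // opprK.
Qed.

Lemma qproj_lin t z z' : T z -> T z' -> qproj (t *: z + z') = t *: qproj z + qproj z'.
Proof.
move=> Tz Tz'; apply: q_ext => [||w Tw]; first exact: qprojT.
  by apply: (qs_lin qs); exact: qprojT.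
rewrite [RHS](qs_glin qs) //; [|exact: qprojT..].
by rewrite !g_qproj // /qform !(q_gr qs) //; ring.
Qed.

Lemma deform_form_invI z : T z -> deform_form_inv (I z) = I (deform_form_inv z).
Proof.
move=> Tz; rewrite /deform_form_inv qprojI //.
by move: (qproj z) (qprojT z) => P TP; rewrite !(q_lin qs).
Qed.

Lemma deform_form_inv_lin t z z' : T z -> T z' ->
  deform_form_inv (t *: z + z') = t *: deform_form_inv z + deform_form_inv z'.
Proof.
move=> Tz Tz'; rewrite /deform_form_inv qproj_lin //.
move: (qproj z) (qproj z') => P P'.
rewrite [X in _ = X + _]scalerA (mulrC t) -[X in _ = X + _]scalerA -scalerDr.
congr (_ *: _); rewrite scalerBr addrACA; congr (_ + _).
by rewrite scalerDr opprD !scalerA (mulrC t).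
Qed.

End Deformation.
Arguments qproj {R V} g I J K x z.
Arguments qform {R V} g I J K x v w.
Arguments deform_form {R V} g I J K x phi psi v w.
Arguments deform_form_inv {R V} g I J K x phi psi z.

Section DeformationCyc.
Context {R : realType} {V : lmodType R} (g : V -> V -> R) (I J K : V -> V).
Variables (x : V) (phi psi : R).

Lemma deform_form_inv_cyc z : deform_form_inv g J K I x phi psi z =
  deform_form_inv g I J K x phi psi z.
Proof.
by rewrite /deform_form_inv /qproj [X in _ *: (_ - _ *: X)]addrAC (addrAC (_ *: x)).
Qed.
End DeformationCyc.

(** With alpha_q = g (q x) for q = 1, I, J, K, the deformed connection is
    nabla + G^-1 Q, where Q v has to be quaternionic linear, with symmetric part half
    of nabla_v G and with a skew part that makes the torsion a 3-form. The vector
    raw_correction v z = Q v z is a combination of natural tensors of this kind. Its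
    coefficients come from the following conditions. The terms in
    alpha_1 (v) z and alpha_1 (v) sum_q alpha_q (z) q x are half the derivatives of
    phi and psi; the skew terms in psi1 and alpha_r, r = I, J, K, are added to make
    the torsion skew. The symmetric part fixes the sum, a psi / 2, of the coefficients
    of sum_q g (q v) z q x and of its adjoint sum_q alpha_q (z) q v, and the terms
    alpha_r (v) g (r y) z of the torsion fix their difference. Finally
    alpha_r (v) torsion_qlin r z completes the part of the old torsion with values in
    the quaternionic line of x. Here psi1 stands for the derivative of psi along
    alpha_1. *)
Section DeformedConnection.
Context {R : realType} {V : lmodType R} {T : V -> Prop} {g : V -> V -> R}
  {I J K : V -> V}.
Variable qs : quat_space T g I J K.
Let qs' := quat_space_cyc qs.
Let qs'' := quat_space_cyc qs'.
Hypothesis nondeg : forall u, T u -> (forall w, T w -> g u w = 0) -> u = 0.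
Variables (x : V) (Tx : T x) (tau : V -> V -> V) (a b : R).
Hypothesis qt : quat_torsion T g I J K x tau (a + b).
Let qt' := quat_torsion_cyc qt.
Let qt'' := quat_torsion_cyc qt'.
Variables (phi psi psi1 : R).
Hypotheses (phi0 : phi != 0) (lam0 : phi + psi * g x x != 0).

Local Notation S := (torsion_qlin x tau (a + b)).
Local Notation gd := (deform_form g I J K x phi psi).
Local Notation gdi := (deform_form_inv g I J K x phi psi).

Lemma STI z : T z -> T (S I z). Proof. exact: (torsion_qlinT qs Tx qt). Qed.
Lemma STJ z : T z -> T (S J z). Proof. exact: (torsion_qlinT qs' Tx qt'). Qed.
Lemma STK z : T z -> T (S K z). Proof. exact: (torsion_qlinT qs'' Tx qt''). Qed.

Local Hint Extern 0 (T _) => solve [quat_mem qs ltac:(first [apply: STI | apply: STJ |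
  apply: STK
  | apply: (deform_form_invT qs Tx) | apply: (qt_T qt)])] : core.

Definition raw_correction v z : V :=
  ((a - b) / 2 * psi * g x v) *: z
  + (psi1 / 2) *: (
      g x v *: (g x z *: x + g (I x) z *: I x + g (J x) z *: J x + g (K x) z *: K x)
    + g (I x) v *: (g x z *: I x - g (I x) z *: x - g (J x) z *: K x + g (K x) z *: J x)
    + g (J x) v *: (g x z *: J x + g (I x) z *: K x - g (J x) z *: x - g (K x) z *: I x)
    + g (K x) v *: (g x z *: K x - g (I x) z *: J x + g (J x) z *: I x - g (K x) z *: x))
  + (b / 2 * psi) *: (g v z *: x + g (I v) z *: I x + g (J v) z *: J x + g (K v) z *: K x)
  + ((a - b) / 2 * psi) *: (g x z *: v + g (I x) z *: I v + g (J x) z *: J v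
    + g (K x) z *: K v)
  + psi *: (g (I x) v *: S I z + g (J x) v *: S J z + g (K x) v *: S K z).

Lemma raw_correctionT v z : T v -> T z -> T (raw_correction v z).
Proof. by move=> Tv Tz; rewrite /raw_correction. Qed.

Definition correction_form v z w : R :=
  (a - b) / 2 * psi * g x v * g z w
  + psi1 / 2 * (
      g x v * (g x z * g x w + g (I x) z * g (I x) w + g (J x) z * g (J x) w
        + g (K x) z * g (K x) w)
    + g (I x) v * (g x z * g (I x) w - g (I x) z * g x w - g (J x) z * g (K x) w
      + g (K x) z * g (J x) w)
    + g (J x) v * (g x z * g (J x) w + g (I x) z * g (K x) w - g (J x) z
      * g x w - g (K x) z * g (I x) w)
    + g (K x) v * (g x z * g (K x) w - g (I x) z * g (J x) w
      + g (J x) z * g (I x) w - g (K x) z * g x w))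
  + b / 2 * psi * (g v z * g x w + g (I v) z * g (I x) w + g (J v) z * g (J x) w
    + g (K v) z * g (K x) w)
  + (a - b) / 2 * psi * (g x z * g v w + g (I x) z * g (I v) w + g (J x) z * g (J v) w
    + g (K x) z * g (K v) w)
  + psi * (g (I x) v * g (S I z) w + g (J x) v * g (S J z) w + g (K x) v * g (S K z) w).

Lemma g_raw_correction v z w : T v -> T z -> T w ->
  g (raw_correction v z) w = correction_form v z w.
Proof.
move=> Tv Tz Tw; rewrite /raw_correction /correction_form.
move: (S I z) (S J z) (S K z) (STI Tz) (STJ Tz) (STK Tz) => si sj sk Ti Tj Tk.
by rewrite !(q_gl qs) //; ring.
Qed.


Lemma correction_formI v z w : T v -> T z -> T w ->
  correction_form v (I z) w = - correction_form v z (I w).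
Proof.
move=> Tv Tz Tw; rewrite /correction_form !(q_gqr qs) //.
rewrite (torsion_qlinI qs Tx qt) // (torsion_qlinK qs' Tx qt') //
  (torsion_qlinJ qs'' Tx qt'') //.
move: (S I z) (S J z) (S K z) (STI Tz) (STJ Tz) (STK Tz) => si sj sk Ti Tj Tk.
rewrite !(q_unit qs) // !(q_gl qs) //; ring.
Qed.

(** In each summand z enters through a sum over q of terms alpha_q (z) q u or
    g (q v) z q u, or through an operator that commutes with I. *)
Lemma raw_correctionI v z : T v -> T z -> raw_correction v (I z) = I (raw_correction v z).
Proof.
move=> Tv Tz.
have Tc := raw_correctionT Tv Tz; have TIz := qTI qs Tz.
apply: (q_ext qs nondeg) => [||w Tw]; [exact: raw_correctionT|exact: (qTI qs)|].
have TIw := qTI qs Tw.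
by rewrite g_raw_correction // correction_formI // -g_raw_correction // (q_gIr qs) // opprK.
Qed.

Lemma raw_correction_linr t v z z' : T v -> T z -> T z' ->
  raw_correction v (t *: z + z') = t *: raw_correction v z + raw_correction v z'.
Proof.
move=> Tv Tz Tz'.
have [Tc Tc'] := (raw_correctionT Tv Tz, raw_correctionT Tv Tz').
apply: (q_ext qs nondeg) => [||w Tw].
- by apply: raw_correctionT.
- by apply: (qs_lin qs).
rewrite [RHS](qs_glin qs) // !g_raw_correction // /correction_form.
rewrite (torsion_qlin_lin qs Tx qt) // (torsion_qlin_lin qs' Tx qt') //
  (torsion_qlin_lin qs'' Tx qt'') //.
move: (S I z) (S J z) (S K z) (STI Tz) (STJ Tz) (STK Tz) => si sj sk Ti Tj Tk.
move: (S I z') (S J z') (S K z') (STI Tz') (STJ Tz') (STK Tz') => si' sj' sk' Ti' Tj' Tk'.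
by rewrite !(q_gl qs, q_gr qs) //; ring.
Qed.

Lemma raw_correction_linl t v v' z : T v -> T v' -> T z ->
  raw_correction (t *: v + v') z = t *: raw_correction v z + raw_correction v' z.
Proof.
move=> Tv Tv' Tz.
have [Tc Tc'] := (raw_correctionT Tv Tz, raw_correctionT Tv' Tz).
apply: (q_ext qs nondeg) => [||w Tw].
- by apply: raw_correctionT.
- by apply: (qs_lin qs).
rewrite [RHS](qs_glin qs) // !g_raw_correction // /correction_form.
move: (S I z) (S J z) (S K z) (STI Tz) (STJ Tz) (STK Tz) => si sj sk Ti Tj Tk.
by rewrite !(q_lin qs) // !(q_gl qs, q_gr qs) //; ring.
Qed.

(** The right-hand side is the covariant derivative along v of the form
    deform_form when nabla x = (a / 2) id, d phi = (a - b) psi x^flat and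
    d psi = psi1 x^flat. *)
Lemma correction_form_sym v z w : T v -> T z -> T w ->
  correction_form v z w + correction_form v w z =
  (a - b) * psi * g x v * g z w + psi1 * g x v * qform g I J K x z w
  + a / 2 * psi * ((g v z * g x w + g x z * g v w)
    + (g (I v) z * g (I x) w + g (I x) z * g (I v) w)
    + (g (J v) z * g (J x) w + g (J x) z * g (J v) w)
    + (g (K v) z * g (K x) w + g (K x) z * g (K v) w)).
Proof.
move=> Tv Tz Tw; rewrite /correction_form /qform.
rewrite (torsion_qlin_skew qs Tx qt Tw) // (torsion_qlin_skew qs' Tx qt' Tw) //.
rewrite (torsion_qlin_skew qs'' Tx qt'' Tw) //.
move: (S I z) (S J z) (S K z) (STI Tz) (STJ Tz) (STK Tz) => si sj sk Ti Tj Tk.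
by rewrite (qs_gsym qs Tw Tz); field.
Qed.

(** Together with the skewness of the torsion in its last two arguments this says
    that the new torsion is a 3-form. With c the old one, F_r = g (r y) z and
    sigma_r = g (torsion_qlin r y) z, it is the sum of phi c, of the exterior products
    of psi alpha_r with sigma_r + (b - a) / 2 F_r, and of - psi1 times the exterior
    product of alpha_I, alpha_J and alpha_K. *)
Lemma correction_form_torsion_skew v y z : T v -> T y -> T z ->
  gd v (tau y z) + (correction_form y z v - correction_form z y v) =
  - (gd y (tau v z) + (correction_form v z y - correction_form z v y)).
Proof.
move=> Tv Ty Tz; rewrite /deform_form /qform.
rewrite !(qt_x qt) // !(torsion_qlinE qs Tx qt) // !(torsion_qlinE qs' Tx qt') //.
rewrite !(torsion_qlinE qs'' Tx qt'') // (qt_skew qt) //.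
rewrite /correction_form.
rewrite !(torsion_qlin_skew qs Tx qt Tz) // !(torsion_qlin_skew qs' Tx qt' Tz) //.
rewrite !(torsion_qlin_skew qs'' Tx qt'' Tz) //.
rewrite !(torsion_qlin_skew qs Tx qt Tv Ty) // !(torsion_qlin_skew qs' Tx qt' Tv Ty) //.
rewrite !(torsion_qlin_skew qs'' Tx qt'' Tv Ty) //.
rewrite !(qs_gsym qs Tz) // !(q_gIflip qs Tz) // !(q_gIflip qs' Tz) //.
rewrite !(q_gIflip qs'' Tz) // !(q_gIflip qs Ty Tv) // !(q_gIflip qs' Ty Tv) //.
rewrite !(q_gIflip qs'' Ty Tv) // (qs_gsym qs Ty Tv).
by field.
Qed.

Definition correction v z := gdi (raw_correction v z).

Lemma correctionT v z : T v -> T z -> T (correction v z).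
Proof. by move=> Tv Tz; apply: (deform_form_invT qs Tx); exact: raw_correctionT. Qed.

Lemma deform_form_correction v z w : T v -> T z -> T w ->
  gd (correction v z) w = correction_form v z w.
Proof.
by move=> Tv Tz Tw; rewrite -g_raw_correction // (deform_form_invE qs Tx) //;
  exact: raw_correctionT.
Qed.

Lemma correctionI v z : T v -> T z -> correction v (I z) = I (correction v z).
Proof.
by move=> Tv Tz; rewrite /correction raw_correctionI //
  (deform_form_invI qs nondeg) //; exact: raw_correctionT.
Qed.

Lemma correction_linl t v v' z : T v -> T v' -> T z ->
  correction (t *: v + v') z = t *: correction v z + correction v' z.
Proof.
move=> Tv Tv' Tz; rewrite /correction raw_correction_linl //.
by rewrite (deform_form_inv_lin qs nondeg) //; exact: raw_correctionT.
Qed.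

Lemma correction_linr t v z z' : T v -> T z -> T z' ->
  correction v (t *: z + z') = t *: correction v z + correction v z'.
Proof.
move=> Tv Tz Tz'; rewrite /correction raw_correction_linr //.
by rewrite (deform_form_inv_lin qs nondeg) //; exact: raw_correctionT.
Qed.

Lemma correction_torsion_skew v y z : T v -> T y -> T z ->
  gd v (tau y z + (correction y z - correction z y)) =
    - gd y (tau v z + (correction v z - correction z v)).
Proof.
move=> Tv Ty Tz; have gq := deform_form_quat_space qs Tx phi psi.
have [T1 T2] := (correctionT Ty Tz, correctionT Tz Ty).
have [T3 T4] := (correctionT Tv Tz, correctionT Tz Tv).
have [Tt Tt'] := (qt_T qt Ty Tz, qt_T qt Tv Tz).
have split3 u t p q : T u -> T t -> T p -> T q ->
    gd u (t + (p - q)) = gd u t + (gd p u - gd q u).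
  by move=> Tu *; rewrite !(q_gr gq) // !(qs_gsym gq Tu).
rewrite !split3 // !deform_form_correction //; exact: correction_form_torsion_skew.
Qed.

(** The pointwise content of the potential equation: the terms in tau combine
    with the factor a to a - b, which cancels the 2 / (a - b). *)
Lemma deform_form_potential y z (k D : R) : k * (a - b) = 2 -> psi = 2^-1 * D * k ^+ 2 ->
  T y -> T z ->
  gd (I y) z = 2^-1 * ((D * k ^+ 2 * g x y * g (I x) z - D * k ^+ 2 * g x z * g (I x) y
      + phi * k * (a * g (I y) z + g (I x) (tau y z)))
    - (D * k ^+ 2 * g x (- J y) * g (I x) (- J z)
       - D * k ^+ 2 * g x (- J z) * g (I x) (- J y)
      + phi * k * (a * g (I (- J y)) (- J z) + g (I x) (tau (- J y) (- J z))))).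
Proof.
move=> kE psiE Ty Tz.
have STN : S I (- J y) = - J (S I y).
  have TJy := qTJ qs Ty; have := torsion_qlin_lin qs Tx qt (-1) TJy (qT0 qs).
  have S0 : S I 0 = 0.
    have := torsion_qlin_lin qs Tx qt (-1) (qT0 qs) (qT0 qs).
    by rewrite scaler0 addr0 scaleN1r addNr.
  by rewrite S0 !addr0 !scaleN1r (torsion_qlinJ qs Tx qt).
rewrite !(torsion_qlinE qs Tx qt) // STN /deform_form /qform.
move: (S I y) (STI Ty) => si Tsi; rewrite !(q_lin qs) // !(q_unit qs) //.
rewrite !(q_gr qs, q_gl qs) // !(q_gqr qs) // !(q_unit qs) // !(q_gl qs) //.
rewrite psiE.
have -> : phi * g (I y) z = phi * (2^-1 * (k * (a - b))) * g (I y) z.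
  by rewrite kE; field.
by field.
Qed.

End DeformedConnection.
Arguments raw_correction {R V} g I J K x tau a b psi psi1 v z.
Arguments correction {R V} g I J K x tau a b phi psi psi1 v z.

(** Although its formula singles out an order of I, J, K, the correction is
    invariant under their cyclic permutation. *)
Lemma correction_cyc (R : realType) (V : lmodType R) (T : V -> Prop) (g : V -> V -> R)
    (I J K : V -> V) (qs : quat_space T g I J K)
    (nondeg : forall u, T u -> (forall w, T w -> g u w = 0) -> u = 0)
    (x : V) (Tx : T x) (tau : V -> V -> V) (a b : R)
    (qt : quat_torsion T g I J K x tau (a + b)) (phi psi psi1 : R) v z :
  T v -> T z -> correction g J K I x tau a b phi psi psi1 v z
    = correction g I J K x tau a b phi psi psi1 v z.
Proof.
move=> Tv Tz; have qs' := quat_space_cyc qs; have qt' := quat_torsion_cyc qt.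
rewrite /correction deform_form_inv_cyc; congr (deform_form_inv _ _ _ _ _ _ _ _).
apply: (q_ext qs nondeg) => [||w Tw].
- exact: (raw_correctionT qs' Tx qt').
- exact: (raw_correctionT qs Tx qt).
by rewrite (g_raw_correction qs' Tx qt') // (g_raw_correction qs Tx qt) //
  /correction_form; ring.
Qed.

(** * Quaternionic orthonormal bases *)

Section Dimension.
Context {R : realType} {V : lmodType R} {T : V -> Prop} {g : V -> V -> R}
  {I J K : V -> V}.
Variable qs : quat_space T g I J K.

Lemma qT_sum (A : Type) (s : seq A) (F : A -> V) :
  (forall i, T (F i)) -> T (\sum_(i <- s) F i).
Proof.
by move=> TF; elim/big_rec: _ => [|i v _]; [exact: (qT0 qs)|exact: (qTD qs)].
Qed.

Lemma q_g_suml (A : Type) (s : seq A) (c : A -> R) (F : A -> V) w : T w ->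
  (forall i, T (F i)) ->
  g (\sum_(i <- s) c i *: F i) w = \sum_(i <- s) c i * g (F i) w.
Proof.
move=> Tw TF; elim: s => [|i s IH]; first by rewrite !big_nil (q_g0l qs).
rewrite !big_cons (qs_glin qs) ?IH //.
by apply: qT_sum => j; exact: (qTZ qs).
Qed.

Variables (n : nat) (e : 'I_n -> V).
Hypothesis Te : forall i, T (e i).
Hypothesis span : forall v, T v -> exists c : 'I_n -> R, v = \sum_i c i *: e i.

(** Orthogonal vectors of nonzero norm are independent, so the rows of their
    coordinate matrix are. *)
Lemma orthogonal_card k (L : 'I_k -> V) : (forall i, T (L i)) ->
  (forall i, g (L i) (L i) != 0) -> (forall i j, i != j -> g (L i) (L j) = 0) ->
  (k <= n)%N.
Proof.
move=> TL nL oL.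
have /choice[c cE] i := span (TL i).
pose C : 'M[R]_(k, n) := \matrix_(i, j) c i j.
suff /eqP <- : row_free C by exact: rank_leq_col.
rewrite -kermx_eq0; apply/rowV0P => y /sub_kermxP yC.
have y0 : \sum_i y 0 i *: L i = 0.
  under eq_bigr do rewrite cE scaler_sumr.
  rewrite exchange_big /= big1 // => j _.
  under eq_bigr do rewrite scalerA.
  rewrite -scaler_suml; move/matrixP: yC => /(_ 0 j); rewrite !mxE.
  rewrite (eq_bigr (fun i => y 0 i * c i j)) => [->|i _]; last by rewrite mxE.
  by rewrite scale0r.
apply/rowP => i; rewrite mxE; apply: (mulIf (nL i)); rewrite mul0r.
rewrite -[RHS](q_g0l qs (TL i)) -y0 q_g_suml // (bigD1 i) //= big1 ?addr0 // => j ji.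
by rewrite oL // mulr0.
Qed.

Hypothesis indep : forall c : 'I_n -> R, \sum_i c i *: e i = 0 -> forall i, c i = 0.

Lemma span_card k (L : 'I_k -> V) :
  (forall v, T v -> exists c : 'I_k -> R, v = \sum_i c i *: L i) -> (n <= k)%N.
Proof.
move=> spL; have /choice[c cE] i := spL _ (Te i).
pose C : 'M[R]_(n, k) := \matrix_(i, j) c i j.
suff /eqP <- : row_free C by exact: rank_leq_col.
rewrite -kermx_eq0; apply/rowV0P => y /sub_kermxP yC.
apply/rowP => i; rewrite mxE; apply: indep.
under eq_bigr do rewrite cE scaler_sumr.
rewrite exchange_big /= big1 // => j _.
under eq_bigr do rewrite scalerA.
rewrite -scaler_suml; move/matrixP: yC => /(_ 0 j); rewrite !mxE.
rewrite (eq_bigr (fun i => y 0 i * c i j)) => [->|l _]; last by rewrite mxE.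
by rewrite scale0r.
Qed.

Lemma orthogonal_exists k (L : 'I_k -> V) : (forall i, T (L i)) -> (k < n)%N ->
  exists v, [/\ T v, v != 0 & forall i, g v (L i) = 0].
Proof.
move=> TL kn; pose B : 'M[R]_(n, k) := \matrix_(i, j) g (e i) (L j).
have : kermx B != 0.
  rewrite kermx_eq0; apply/negP => /eqP rB.
  by have := rank_leq_col B; rewrite rB leqNgt kn.
move=> /rowV0Pn[y /sub_kermxP yB y0].
exists (\sum_i y 0 i *: e i); split.
- by apply: qT_sum => i; exact: (qTZ qs).
- by apply: contra y0 => /eqP /indep y0; apply/eqP/rowP => i; rewrite y0 mxE.
move=> j; rewrite q_g_suml //; move/matrixP: yB => /(_ 0 j); rewrite !mxE => yB.
by rewrite -[RHS]yB; apply: eq_bigr => i _; rewrite mxE.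
Qed.

End Dimension.

Definition qunit (V : Type) (I J K : V -> V) (j : nat) (v : V) : V :=
  match j with 0 => v | 1 => I v | 2 => J v | _ => K v end.

Section GramSchmidt.
Context {R : realType} {V : lmodType R} {g : V -> V -> R} {I J K : V -> V}.
Implicit Types (T : V -> Prop) (u v w : V).

Definition orthq u v : Prop :=
  [/\ g u v = 0, g (I u) v = 0, g (J u) v = 0 & g (K u) v = 0].

Definition nondeg_on T :=
  forall u, T u -> (forall w, T w -> g u w = 0) -> u = 0.

(** One vector is listed for each quaternionic line; its images under I, J, K,
    which have the same norm, complete the family. *)
Definition qorthonormal T (P N : seq V) : Prop :=
  [/\ forall v, v \in P -> T v /\ g v v = 1,
      forall v, v \in N -> T v /\ g v v = -1 &
      pairwise (fun u v => `[< orthq u v >]) (P ++ N)].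

Section OneVector.
Variables (T : V -> Prop) (qs : quat_space T g I J K).
Let qs' := quat_space_cyc qs.
Let qs'' := quat_space_cyc qs'.

Local Hint Extern 0 (T _) => solve [quat_mem qs ltac:(apply: (qprojT qs))] : core.

Lemma orthq_sym u v : T u -> T v -> orthq u v -> orthq v u.
Proof.
move=> Tu Tv [h1 h2 h3 h4]; split; first by rewrite (qs_gsym qs).
- by rewrite (q_gIflip qs) // h2 oppr0.
- by rewrite (q_gIflip qs') // h3 oppr0.
- by rewrite (q_gIflip qs'') // h4 oppr0.
Qed.

Definition orthq_compl u : V -> Prop := fun v => T v /\ orthq u v.

(** The orthogonal of a quaternionic line is again quaternionic, which allows an
    induction. *)
Lemma orthq_compl_quat_space u : T u -> quat_space (orthq_compl u) g I J K.
Proof.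
move=> Tu; split.
- by split=> //; split; rewrite (q_g0r qs).
- move=> t v w [Tv [v1 v2 v3 v4]] [Tw [w1 w2 w3 w4]]; split=> //; split.
  + by rewrite !(q_gr qs) // v1 w1; ring.
  + by rewrite !(q_gr qs) // v2 w2; ring.
  + by rewrite !(q_gr qs) // v3 w3; ring.
  + by rewrite !(q_gr qs) // v4 w4; ring.
- move=> v [Tv [v1 v2 v3 v4]]; split=> //; split;
    rewrite (q_gqr qs) // ?(q_unit qs) // ?(q_gl qs) // ?v1 ?v2 ?v3 ?v4; ring.
- move=> v [Tv [v1 v2 v3 v4]]; split=> //; split;
    rewrite (q_gqr qs) // ?(q_unit qs) // ?(q_gl qs) // ?v1 ?v2 ?v3 ?v4; ring.
- move=> v [Tv [v1 v2 v3 v4]]; split=> //; split;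
    rewrite (q_gqr qs) // ?(q_unit qs) // ?(q_gl qs) // ?v1 ?v2 ?v3 ?v4; ring.
all: try by move=> t u' v [Tu' _] [Tv _]; case: qs => *; auto.
all: try by move=> u' v [Tu' _] [Tv _]; case: qs => *; auto.
all: try by move=> v [Tv _]; case: qs => *; auto.
by move=> t u' v w [Tu' _] [Tv _] [Tw _]; case: qs => *; auto.
Qed.

Lemma orthq_qproj u v : T u -> T v -> g u u ^+ 2 = 1 ->
  orthq_compl u (v - g u u *: qproj g I J K u v).
Proof.
move=> Tu Tv uu; split; first exact: (qTD qs).
have E y : y - g u u * (y * g u u) = 0 by rewrite mulrCA -expr2 uu mulr1 subrr.
split; rewrite /qproj !(q_gr qs) // ?(q_gqr qs) // ?(q_unit qs) //
  ?(q_gl qs) // ?(q_gid qs) //.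
- by rewrite -[RHS](E (g u v)); ring.
- by rewrite -[RHS](E (g (I u) v)); ring.
- by rewrite -[RHS](E (g (J u) v)); ring.
- by rewrite -[RHS](E (g (K u) v)); ring.
Qed.

Lemma qproj_orthq u w v : T u -> T w -> T v -> orthq u w ->
  qproj g I J K w (v - g u u *: qproj g I J K u v) = qproj g I J K w v.
Proof.
move=> Tu Tw Tv [h1 h2 h3 h4]; rewrite /qproj.
have E y : T y -> g u y = 0 -> g (I u) y = 0 -> g (J u) y = 0 -> g (K u) y = 0 ->
   g y (v - g u u *: qproj g I J K u v) = g y v.
  move=> Ty y1 y2 y3 y4; rewrite /qproj !(q_gr qs) // !(qs_gsym qs Ty) //.
  by rewrite y1 y2 y3 y4; ring.
by rewrite !E //; rewrite (q_gqr qs) // ?(q_unit qs) // ?(q_gl qs) // ?h1 ?h2 ?h3 ?h4 ?oppr0.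
Qed.

Lemma orthq_compl_nondeg u : T u -> g u u ^+ 2 = 1 -> nondeg_on T ->
  nondeg_on (orthq_compl u).
Proof.
move=> Tu uu ndT v [Tv [h1 h2 h3 h4]] Ev; apply: ndT => // w Tw.
have := Ev _ (orthq_qproj Tu Tw uu).
by rewrite /qproj !(q_gr qs) // !(qs_gsym qs Tv) // h1 h2 h3 h4 => <-; ring.
Qed.

Lemma normalize w : T w -> g w w != 0 ->
  exists2 t, t != 0 & g (t *: w) (t *: w) = 1 \/ g (t *: w) (t *: w) = -1.
Proof.
move=> Tw w0.
have sq : Num.sqrt `|g w w| ^+ 2 = `|g w w| by rewrite sqr_sqrtr.
have s0 : Num.sqrt `|g w w| != 0 by rewrite sqrtr_eq0 -ltNge normr_gt0.
exists (Num.sqrt `|g w w|)^-1; first by rewrite invr_eq0.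
rewrite (q_gZr qs) // ?(q_gZl qs) // mulrA -expr2 exprVn sq.
have [p|p|p] := ltgtP (g w w) 0; last by rewrite p eqxx in w0.
- by right; rewrite ltr0_norm // invrN mulNr mulVf.
- by left; rewrite gtr0_norm // mulVf.
Qed.

(** Polarization: a nondegenerate form takes a nonzero value on the diagonal. *)
Lemma exists_unit_vector v : nondeg_on T -> T v -> v != 0 ->
  exists2 u, T u & g u u = 1 \/ g u u = -1.
Proof.
move=> ndT Tv v0.
have [w [Tw w0]] : exists w, T w /\ g w w != 0.
  apply: contrapT => nw; move/negP: v0; apply.
  have iso w : T w -> g w w = 0.
    by move=> Tw; apply/eqP; apply: contrapT => /negP ww; apply: nw; exists w.
  apply/eqP/ndT => // w Tw.
  have := iso _ (qTD qs Tv Tw); rewrite !(q_gr qs, q_gl qs) // !iso //.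
  by rewrite (qs_gsym qs Tw) //; lra.
by have [t t0 ut] := normalize Tw w0; exists (t *: w); first exact: (qTZ qs).
Qed.

End OneVector.

Lemma qorthonormal_cons T u P N : quat_space T g I J K -> T u ->
  qorthonormal (orthq_compl T u) P N ->
  (g u u = 1 -> qorthonormal T (u :: P) N) /\
  (g u u = -1 -> qorthonormal T P (u :: N)).
Proof.
move=> qs Tu [hP hN hPN].
have hP' v : v \in P -> T v /\ g v v = 1 by move=> /hP[[]].
have hN' v : v \in N -> T v /\ g v v = -1 by move=> /hN[[]].
have ou v : v \in P ++ N -> T v /\ orthq u v.
  by rewrite mem_cat => /orP[/hP[]|/hN[]].
split=> uu; split=> //.
- by move=> v; rewrite inE => /predU1P[->|/hP'].
- rewrite /= hPN andbT; apply/allP => v /ou[_ ov]; exact/asboolP.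
- by move=> v; rewrite inE => /predU1P[->|/hN'].
- move: hPN; rewrite !pairwise_cat /= => /and3P[hr -> ->]; rewrite andbT /=.
  apply/andP; split; last first.
    apply/allP => v vN; have [|_ ov] := ou v; first by rewrite mem_cat vN orbT.
    exact/asboolP.
  rewrite allrel_consr hr andbT; apply/allP => v vP; apply/asboolP.
  have [|Tv ov] := ou v; first by rewrite mem_cat vP.
  exact: (orthq_sym qs Tu Tv ov).
Qed.

(** A unit vector exists as long as the space is not zero; its quaternionic line
    is split off, and the bound k on the number of lines decreases. *)
Lemma qorthonormal_basis k T : quat_space T g I J K -> nondeg_on T ->
  (forall P N, qorthonormal T P N -> (size (P ++ N) <= k)%N) ->
  exists P N, qorthonormal T P N /\
    forall v, T v -> v = \sum_(w <- P ++ N) g w w *: qproj g I J K w v.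
Proof.
elim: k T => [|k IH] T qs ndT bnd; have [[u0 [Tu0 u0n]]|triv] :=
    pselect (exists u, T u /\ u != 0); last 1 first.
- exists [::], [::]; split; first by split.
  move=> v Tv; rewrite big_nil; apply/eqP; apply: contrapT => /negP v0.
  by apply: triv; exists v.
- have [u Tu uu] := exists_unit_vector qs ndT Tu0 u0n.
  have [c1 c2] := @qorthonormal_cons T u [::] [::] qs Tu ltac:(by split).
  by case: uu => [/c1/bnd|/c2/bnd].
- exists [::], [::]; split; first by split.
  move=> v Tv; rewrite big_nil; apply/eqP; apply: contrapT => /negP v0.
  by apply: triv; exists v.
have [u Tu uu] := exists_unit_vector qs ndT Tu0 u0n.
have uu2 : g u u ^+ 2 = 1 by case: uu => ->; rewrite ?sqrrN expr1n.
have qsu := orthq_compl_quat_space qs Tu.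
have [||P [N [oPN sPN]]] := IH _ qsu; first exact: orthq_compl_nondeg.
  move=> P N oPN; have [c1 c2] := qorthonormal_cons qs Tu oPN.
  by case: uu => [/c1/bnd|/c2/bnd]; rewrite !size_cat /= ?addnS ltnS.
have sp v : T v -> v = g u u *: qproj g I J K u v
    + \sum_(w <- P ++ N) g w w *: qproj g I J K w v.
  move=> Tv; apply/eqP; rewrite addrC -subr_eq; apply/eqP.
  rewrite [LHS](sPN _ (orthq_qproj qs Tu Tv uu2)).
  apply: eq_big_seq => w wPN; congr (_ *: _).
  have [Tw ow] : T w /\ orthq u w.
    by case: oPN => hP hN _; move: wPN; rewrite mem_cat => /orP[/hP[]|/hN[]].
  exact: (qproj_orthq qs).
have [c1 c2] := qorthonormal_cons qs Tu oPN.
case: uu => uu.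
- exists (u :: P), N; split; first exact: c1.
  by move=> v Tv; rewrite big_cons; exact: sp.
- exists P, (u :: N); split; first exact: c2.
  move=> v Tv; rewrite big_cat /= big_cons addrCA -big_cat /=.
  exact: sp.
Qed.

End GramSchmidt.

(** Indices below d * k are pairs of an index below k and one below d. *)
Lemma sum_divmod (V : nmodType) d k (F : nat -> nat -> V) : (0 < d)%N ->
  \sum_(0 <= i < d * k) F (i %/ d)%N (i %% d)%N = \sum_(0 <= l < k) \sum_(0 <= j < d) F l j.
Proof.
move=> d0; elim: k => [|k IH]; first by rewrite muln0 !big_geq.
rewrite big_nat_recr //= -IH mulnS addnC (@big_cat_nat _ _ _ (d * k)%N) ?leq_addr //=.
congr (_ + _); rewrite -{1}[(d * k)%N]add0n big_addn addKn !big_mkord.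
apply: eq_bigr => j _; rewrite addnC mulnC divnMDl // divn_small // addn0.
by rewrite modnMDl modn_small.
Qed.

Section Signature.
Context {R : realType} {V : lmodType R} {T : V -> Prop} {g : V -> V -> R}
  {I J K : V -> V}.
Variables (qs : quat_space T g I J K) (ndT : nondeg_on (g := g) T).

Definition qfamily (L : seq V) (i : nat) : V :=
  qunit I J K (i %% 4)%N (nth 0 L (i %/ 4)%N).

Lemma qunitT j v : T v -> T (qunit I J K j v).
Proof.
by move=> Tv; case: j => [//|[|[|j]]]; [exact: (qTI qs)|exact: (qTJ qs)|exact: (qTK qs)].
Qed.

Lemma qunit_orthq i j u v : T u -> T v -> orthq (g := g) (I := I) (J := J) (K := K) u v ->
  g (qunit I J K i u) (qunit I J K j v) = 0.
Proof.
move=> Tu Tv [h1 h2 h3 h4].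
have [[TI TJ] TK] := (qTI qs Tu, qTJ qs Tu, qTK qs Tu).
by case: i => [|[|[|i]]]; case: j => [|[|[|j]]] /=; rewrite ?(q_gqr qs) //
  ?(q_unit qs) // ?(q_gl qs) // ?h1 ?h2 ?h3 ?h4 ?oppr0.
Qed.

Lemma qunit_gram i j u : (i < 4)%N -> (j < 4)%N -> T u ->
  g (qunit I J K i u) (qunit I J K j u) = if i == j then g u u else 0.
Proof.
move=> i4 j4 Tu.
have [[TI TJ] TK] := (qTI qs Tu, qTJ qs Tu, qTK qs Tu).
case: i i4 => [|[|[|[|i]]]] // _; case: j j4 => [|[|[|[|j]]]] // _ /=;
  rewrite ?(q_gqr qs) // ?(q_unit qs) // ?(q_gl qs) // ?(q_gid qs) // ?oppr0 ?opprK //.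
Qed.

Lemma qfamily_gram P N i j : qorthonormal (g := g) (I := I) (J := J) (K := K) T P N ->
  (i < 4 * size (P ++ N))%N -> (j < 4 * size (P ++ N))%N ->
  g (qfamily (P ++ N) i) (qfamily (P ++ N) j) =
  if i == j then (if (i < 4 * size P)%N then 1 else -1) else 0.
Proof.
move=> [hP hN hPN] iL jL; set L := P ++ N in iL jL hPN *.
have dL k : (k < 4 * size L)%N -> (k %/ 4 < size L)%N by rewrite ltn_divLR // mulnC.
have TL k : (k < size L)%N -> T (nth 0 L k).
  by move=> /(mem_nth 0); rewrite mem_cat => /orP[/hP[]|/hN[]].
have [ei|ei] := eqVneq (i %/ 4)%N (j %/ 4)%N.
  rewrite /qfamily -ei qunit_gram ?ltn_pmod //; last exact/TL/dL.
  have -> : (i %% 4 == j %% 4)%N = (i == j).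
    by apply/eqP/eqP => [em|->//]; rewrite (divn_eq i 4) (divn_eq j 4) ei em.
  case: eqP => // _; rewrite /L nth_cat ltn_divLR // mulnC.
  case: ltnP => iP.
    by have [] := hP _ (mem_nth 0 (_ : (i %/ 4 < size P)%N)); rewrite // ltn_divLR // mulnC.
  have iN : (i %/ 4 - size P < size N)%N.
    rewrite ltn_subLR -?size_cat ?dL //.
    by rewrite leq_divRL // mulnC.
  by have [] := hN _ (mem_nth 0 iN).
rewrite (_ : i == j = false); last by apply: contra_neqF ei => /eqP ->.
have /(pairwiseP 0) hL := hPN.
have [T1 T2] := (TL _ (dL _ iL), TL _ (dL _ jL)).
apply: qunit_orthq => //; move: ei; rewrite neq_ltn => /orP[ij|ji].
  by apply/asboolP/hL => //; rewrite inE dL.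
by apply: (orthq_sym qs) => //; apply/asboolP/hL => //; rewrite inE dL.
Qed.

Lemma qfamilyT P N i : qorthonormal (g := g) (I := I) (J := J) (K := K) T P N ->
  T (qfamily (P ++ N) i).
Proof.
move=> [hP hN _]; apply: qunitT.
have [/(mem_nth 0)|iL] := ltnP (i %/ 4)%N (size (P ++ N)).
  by rewrite mem_cat => /orP[/hP[]|/hN[]].
by rewrite nth_default //; exact: (qT0 qs).
Qed.

Lemma qfamily_span P N v :
  v = \sum_(w <- P ++ N) g w w *: qproj g I J K w v ->
  exists c : nat -> R, v = \sum_(i < 4 * size (P ++ N)) c i *: qfamily (P ++ N) i.
Proof.
move=> vE; set L := P ++ N in vE *.
pose F l j := (g (nth 0 L l) (nth 0 L l) * g (qunit I J K j (nth 0 L l)) v)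
  *: qunit I J K j (nth 0 L l).
exists (fun i => let w := nth 0 L (i %/ 4)%N in
   g w w * g (qunit I J K (i %% 4)%N w) v).
rewrite -(big_mkord xpredT (fun i => F (i %/ 4)%N (i %% 4)%N)) sum_divmod //.
rewrite {1}vE (big_nth 0); apply: eq_bigr => l _.
rewrite 4?big_nat_recr // big_geq //= add0r /F /= /qproj.
by rewrite !scalerDr !scalerA.
Qed.

Section Basis.
Variables (n : nat) (e : 'I_n -> V).
Hypothesis Te : forall i, T (e i).
Hypothesis span : forall v, T v -> exists c : 'I_n -> R, v = \sum_i c i *: e i.

Lemma qorthonormal_card P N :
  qorthonormal (g := g) (I := I) (J := J) (K := K) T P N ->
  (4 * size (P ++ N) <= n)%N.
Proof.
move=> oPN; apply: (orthogonal_card qs span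
    (L := fun i : 'I_(4 * size (P ++ N)) => qfamily (P ++ N) i)).
- by move=> i; exact: qfamilyT.
- by move=> i; rewrite qfamily_gram // eqxx; case: ifP; rewrite ?oppr_eq0 oner_eq0.
- move=> i j ij; rewrite qfamily_gram // (_ : (i == j :> nat) = false) //.
  exact: negbTE.
Qed.

(** If v were not zero, the orthogonal of x would contain a unit vector, whose
    quaternionic line and that of x would have eight orthogonal vectors. *)
Lemma orthq_line_eq0 x v : (n < 8)%N -> T x -> g x x != 0 -> T v ->
  orthq (g := g) (I := I) (J := J) (K := K) x v -> v = 0.
Proof.
move=> n8 Tx x0 Tv [h1 h2 h3 h4]; have [t t0 ut] := normalize qs Tx x0.
have Tu := qTZ qs t Tx; set u := t *: x in ut Tu.
have uu2 : g u u ^+ 2 = 1 by case: ut => ->; rewrite ?sqrrN expr1n.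
have qsu := orthq_compl_quat_space qs Tu.
have ndu := orthq_compl_nondeg qs Tu uu2 ndT.
apply/eqP; apply: contrapT => /negP v0.
have ov : orthq_compl (g := g) (I := I) (J := J) (K := K) T u v.
  split=> //; have [[TI TJ] TK] := (qTI qs Tx, qTJ qs Tx, qTK qs Tx).
  by split; rewrite /u ?(q_lin qs) // (q_gZl qs) // ?h1 ?h2 ?h3 ?h4 mulr0.
have [w ow ww] := exists_unit_vector qsu ndu ov v0.
have [P [N [oPN sPN]]] : exists P N, qorthonormal (g := g) (I := I) (J := J) (K := K)
    (orthq_compl (g := g) (I := I) (J := J) (K := K) T u) P N /\ size (P ++ N) = 1%N.
  have [c1 c2] := @qorthonormal_cons _ _ g I J K _ w [::] [::] qsu ow ltac:(by split).
  by case: ww => [/c1|/c2] o; [exists [:: w], [::]|exists [::], [:: w]].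
have [c1 c2] := qorthonormal_cons qs Tu oPN.
by case: ut => [/c1|/c2] /qorthonormal_card; rewrite size_cat /= ?addnS ?addSn -size_cat
  sPN leqNgt n8.
Qed.

(** A nondegenerate hyperhermitian form has an orthonormal basis made of
    quaternionic lines; hence its signature consists of multiples of 4. *)
Lemma quat_signature :
  (forall c : 'I_n -> R, \sum_i c i *: e i = 0 -> forall i, c i = 0) ->
  exists (r s : nat) (e' : 'I_n -> V), [/\ n = (4 * r + 4 * s)%N,
    forall i, T (e' i),
    forall v, T v -> exists c : 'I_n -> R, v = \sum_i c i *: e' i &
    forall i j, g (e' i) (e' j) =
      if i == j then (if (i < 4 * r)%N then 1 else -1) else 0].
Proof.
move=> indep.
have [|P [N [oPN sPN]]] := @qorthonormal_basis _ _ g I J K n T qs ndT.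
  by move=> P N /qorthonormal_card; apply: leq_trans; rewrite leq_pmull.
have nE : (4 * size (P ++ N))%N = n.
  apply/eqP; rewrite eqn_leq qorthonormal_card //=.
  apply: (span_card Te indep (L := fun i : 'I_(4 * size (P ++ N)) => qfamily (P ++ N) i)).
  by move=> v /sPN/qfamily_span[c vE]; exists c.
exists (size P), (size N), (fun i => qfamily (P ++ N) i); split.
- by rewrite -nE size_cat mulnDr.
- by move=> i; exact: qfamilyT.
- move=> v /sPN/qfamily_span[c vE]; exists c; rewrite {1}vE.
  by rewrite -!(big_mkord xpredT (fun i => c i *: qfamily (P ++ N) i)) nE.
- by move=> i j; rewrite qfamily_gram ?nE.
Qed.

End Basis.
End Signature.

(** * HKT structures and their torsion tensor *)

Section HKTBasics.
Context {R : realType} {n : nat} {M : topologicalType}.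
Variables (A : set (chart R n M)) (hM : smooth_manifold A).
Local Notation vec := ((M -> R) -> R).
Implicit Types (p q : M) (u v w z : vec) (Y Z : M -> vec).

Section Metric.
Variables (W : set M) (g : M -> vec -> vec -> R) (I J K : M -> vec -> vec).

Lemma hypercomplex_quat_space p : W p -> hypercomplex A W I J K ->
  pseudo_metric A W g -> Defs.hermitian A W g I -> Defs.hermitian A W g J ->
  Defs.hermitian A W g K -> quat_space (tangent A p) (g p) (I p) (J p) (K p).
Proof.
move=> Wp hc pm hI hJ hK.
have [[cI cJ] cK] := (hcplx_I hc, hcplx_J hc, hcplx_K hc).
have [[eI eJ] eK] := (cplx_endo cI, cplx_endo cJ, cplx_endo cK).
split.
- exact: tangent0.
- by move=> *; exact: tangent_lin.
- by move=> v; exact: (endo_tangent eI).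
- by move=> v; exact: (endo_tangent eJ).
- by move=> v; exact: (endo_tangent eK).
- by move=> t u v; exact: (endo_linear eI).
- by move=> t u v; exact: (endo_linear eJ).
- by move=> t u v; exact: (endo_linear eK).
- by move=> v; exact: (cplx_sqr cI).
- by move=> v; exact: (cplx_sqr cJ).
- by move=> v; exact: (cplx_sqr cK).
- by move=> v; exact: (hcplx_IJ hc).
- by move=> v; exact: (hcplx_JI hc).
- by move=> t u v w; exact: (pm_linear pm).
- by move=> v w; exact: (pm_sym pm).
- by move=> v w; exact: hI.
- by move=> v w; exact: hJ.
- by move=> v w; exact: hK.
Qed.

Lemma pseudo_metric_frame p : W p -> pseudo_metric A W g -> 
  quat_space (tangent A p) (g p) (I p) (J p) (K p) ->
  exists e : 'I_n -> vec, [/\ forall i, tangent A p (e i),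
    forall v, tangent A p v -> exists c : 'I_n -> R, v = \sum_i c i *: e i,
    forall c : 'I_n -> R, \sum_i c i *: e i = 0 -> forall i, c i = 0 &
    nondeg_on (g := g p) (tangent A p)].
Proof.
move=> Wp pm qs; have [r [s [e [_ Te span table]]]] := pm_signature pm Wp.
have coef (c : 'I_n -> R) i : g p (\sum_i c i *: e i) (e i) =
    c i * (if (i < 4 * r)%N then 1 else -1).
  rewrite (q_g_suml qs) // (bigD1 i) //= table eqxx big1 ?addr0 // => j ji.
  by rewrite table (negbTE ji) mulr0.
have coef0 (c : 'I_n -> R) i : g p (\sum_i c i *: e i) (e i) = 0 -> c i = 0.
  by rewrite coef; case: ifP => _; rewrite ?mulr1 // mulrN1 => /eqP; rewrite oppr_eq0 => /eqP.
exists e; split=> //.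
  by move=> c c0 i; apply: coef0; rewrite c0 (q_g0l qs).
move=> u /span[c ->] Ec; rewrite big1 // => i _.
by rewrite coef0 ?scale0r //; exact: Ec.
Qed.

End Metric.

Section HKTData.
Variables (W : set M) (g : M -> vec -> vec -> R) (I J K : M -> vec -> vec)
  (nabla : M -> vec -> (M -> vec) -> vec).
Variable hg : HKT A W g I J K nabla.
Let hc := hkt_hypercomplex hg.
Let hconn := hktc_conn (hkt_conn hg).

Lemma hkt_quat p : W p -> quat_space (tangent A p) (g p) (I p) (J p) (K p).
Proof.
move=> Wp; case: hg => h1 h2 h3 h4 h5 _.
exact: (hypercomplex_quat_space Wp h1 h2 h3 h4 h5).
Qed.

Lemma hkt_frame p : W p ->
  exists e : 'I_n -> vec, [/\ forall i, tangent A p (e i),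
    forall v, tangent A p v -> exists c : 'I_n -> R, v = \sum_i c i *: e i,
    forall c : 'I_n -> R, \sum_i c i *: e i = 0 -> forall i, c i = 0 &
    nondeg_on (g := g p) (tangent A p)].
Proof. by move=> Wp; exact: (pseudo_metric_frame Wp (hkt_metric hg) (hkt_quat Wp)). Qed.

Lemma hkt_nondeg p : W p -> nondeg_on (g := g p) (tangent A p).
Proof. by move=> /hkt_frame[e []]. Qed.

Lemma hkt_ext p v w : W p -> tangent A p v -> tangent A p w ->
  (forall u, tangent A p u -> g p u v = g p u w) -> v = w.
Proof.
move=> Wp Tv Tw E; have qs := hkt_quat Wp.
apply: (q_ext qs (hkt_nondeg Wp)) => // u Tu.
by rewrite !(qs_gsym qs _ Tu) // E.
Qed.

Lemma hkt_cyc : HKT A W g J K I nabla.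
Proof.
case: (hg) => hcp pm hI hJ hK [c1 c2 c3 c4 c5 c6 c7]; split=> //.
case: hcp => cI cJ cK _ _; split=> // p v Wp Tv; have qs := hkt_quat Wp.
  exact: (q_JK qs).
exact: (q_KJ qs).
Qed.

Lemma vf_I p Y : W p -> vfield_at A p Y -> vfield_at A p (ap I Y).
Proof. by move=> Wp; exact: (endo_smooth (cplx_endo (hcplx_I hc)) Wp). Qed.

Lemma vf_cov p Y Z : W p -> vfield_at A p Y -> vfield_at A p Z ->
  vfield_at A p (cov nabla Y Z).
Proof. exact: (conn_smooth hconn). Qed.

Lemma vf_torsion p Y Z : W p -> vfield_at A p Y -> vfield_at A p Z ->
  vfield_at A p (torsion A nabla Y Z).
Proof.
move=> Wp vY vZ; apply: (vfieldB hM); last exact: vfield_bracket.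
by apply: (vfieldB hM); exact: vf_cov.
Qed.

Lemma torsion_tangent p Y Z : W p -> vfield_at A p Y -> vfield_at A p Z ->
  tangent A p (torsion A nabla Y Z p).
Proof. by move=> Wp vY vZ; exact: vfield_tangent (vf_torsion Wp vY vZ). Qed.

Lemma torsion_alt p Y Z : W p -> vfield_at A p Y -> vfield_at A p Z ->
  torsion A nabla Y Z p = - torsion A nabla Z Y p.
Proof.
move=> Wp vY vZ; have qs := hkt_quat Wp.
have [T1 T2] := (torsion_tangent Wp vY vZ, torsion_tangent Wp vZ vY).
apply: (hkt_ext Wp) => // [|u]; first exact: (qTN qs).
move=> /(tangent_extend hM)[V vV <-]; rewrite (q_gNr qs) //; last exact: vfield_tangent.
exact: (hktc_skew23 (hkt_conn hg)).
Qed.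

(** Total skewness moves Y to the slot where c is visibly tensorial. *)
Lemma torsion_val1 p Y Y' Z : W p -> vfield_at A p Y -> vfield_at A p Y' ->
  vfield_at A p Z -> Y p = Y' p -> torsion A nabla Y Z p = torsion A nabla Y' Z p.
Proof.
move=> Wp vY vY' vZ YY'.
apply: (hkt_ext Wp); [exact: torsion_tangent..|].
move=> u /(tangent_extend hM)[V vV <-].
have := hktc_skew12 (hkt_conn hg) Wp vV vY vZ.
have := hktc_skew12 (hkt_conn hg) Wp vV vY' vZ.
by rewrite /torsion3 YY' => <-.
Qed.

Definition field_through p v : M -> vec :=
  match pselect (tangent A p v) with
  | left h => s2val (cid2 (tangent_extend hM h)) | right _ => fun=> 0 end.

Lemma field_throughP p v : tangent A p v ->
  vfield_at A p (field_through p v) /\ field_through p v p = v.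
Proof.
move=> Tv; rewrite /field_through; case: pselect => // h.
by split; case: cid2.
Qed.

(** It is locked because rewriting with the linearity of g would otherwise unfold
    it into the difference that defines the torsion. *)
Definition torsion_tensor p u v : vec :=
  locked (torsion A nabla (field_through p u) (field_through p v) p).

Lemma torsion_tensorE p Y Z : W p -> vfield_at A p Y -> vfield_at A p Z ->
  torsion A nabla Y Z p = torsion_tensor p (Y p) (Z p).
Proof.
move=> Wp vY vZ.
have [vY' Y'p] := field_throughP (vfield_tangent vY).
have [vZ' Z'p] := field_throughP (vfield_tangent vZ).
rewrite /torsion_tensor -lock (torsion_val1 Wp vY vY') // torsion_alt //
  (torsion_val1 Wp vZ vZ') //.
by rewrite -torsion_alt.
Qed.

Lemma torsion_tensorT p u v : W p -> tangent A p u -> tangent A p v ->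
  tangent A p (torsion_tensor p u v).
Proof.
rewrite /torsion_tensor -!lock.
by move=> Wp /field_throughP[vu _] /field_throughP[vv _]; exact: torsion_tangent.
Qed.

Lemma torsion_tensor_alt p u v : W p -> tangent A p u -> tangent A p v ->
  torsion_tensor p u v = - torsion_tensor p v u.
Proof.
rewrite /torsion_tensor -!lock.
by move=> Wp /field_throughP[vu _] /field_throughP[vv _]; exact: torsion_alt.
Qed.

Lemma torsion_tensor_skew p w u v : W p -> tangent A p w -> tangent A p u -> tangent A p v ->
  g p w (torsion_tensor p u v) = - g p u (torsion_tensor p w v).
Proof.
rewrite /torsion_tensor -!lock.
move=> Wp /field_throughP[vw ew] /field_throughP[vu eu] /field_throughP[vv _].
have := hktc_skew12 (hkt_conn hg) Wp vw vu vv.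
by rewrite /torsion3 ew eu.
Qed.

Lemma torsion_tensor_lin p t y u v : W p -> tangent A p y -> tangent A p u -> tangent A p v ->
  torsion_tensor p y (t *: u + v) = t *: torsion_tensor p y u + torsion_tensor p y v.
Proof.
move=> Wp Ty Tu Tv; have qs := hkt_quat Wp.
have TT z : tangent A p z -> tangent A p (torsion_tensor p y z) by exact: torsion_tensorT.
have Tuv := qs_lin qs t Tu Tv.
apply: (hkt_ext Wp) => [||w Tw]; first exact: TT.
  by apply: (qs_lin qs); exact: TT.
have E z : tangent A p z -> g p w (torsion_tensor p y z) = g p z (torsion_tensor p w y).
  move=> Tz; rewrite torsion_tensor_alt // (q_gNr qs) //; last exact: torsion_tensorT.
  by rewrite torsion_tensor_skew // opprK.
have TT' := torsion_tensorT Wp Tw Ty.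
have [T1 T2] := (TT _ Tu, TT _ Tv); have T3 := qTZ qs t T1.
by rewrite [RHS](q_gDr qs) // (q_gZr qs) // !E // (qs_glin qs).
Qed.

(** The torsion terms cancel by total skewness, as they vanish for the Levi-Civita
    connection. *)
Lemma killing_eq p (E : M -> vec) t u v : W p -> vfield_on A W E ->
  lie_metric A W E g t -> tangent A p u -> tangent A p v ->
  g p (nabla p u E) v + g p u (nabla p v E) = t * g p u v.
Proof.
move=> Wp vE lE /(tangent_extend hM)[Y vY <-] /(tangent_extend hM)[Z vZ <-].
have vEp := vE _ Wp; have qs := hkt_quat Wp.
have [[TY TZ] TE] := (vfield_tangent vY, vfield_tangent vZ, vfield_tangent vEp).
have ct F V : vfield_at A p F -> tangent A p V -> tangent A p (nabla p V F).
  by move=> vF TV; exact: (conn_tangent hconn).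
rewrite -(lE _ _ _ Wp vY vZ).
rewrite (hktc_g (hkt_conn hg) Wp TE vY vZ).
have brE F : vfield_at A p F -> bracket A E F p =
    nabla p (E p) F - nabla p (F p) E - torsion_tensor p (E p) (F p).
  move=> vF; rewrite -torsion_tensorE // /torsion /cov opprB addrC subrK //.
have [T1 T2] := (torsion_tensorT Wp TE TY, torsion_tensorT Wp TE TZ).
rewrite !brE // !(q_gr qs, q_gl qs) //; do ?exact: ct; do ?exact: (qTN qs);
  try by apply: (qTD qs); [exact: ct|apply: (qTN qs); exact: ct].
- rewrite (qs_gsym qs T1 TZ) (torsion_tensor_skew Wp TZ TE TY) (torsion_tensor_skew Wp TY
  TE TZ).
  by rewrite (torsion_tensor_alt Wp TZ TY) (q_gNr qs) //; [ring|exact: torsion_tensorT].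
all: by apply: (qTN qs); exact: ct.
Qed.

End HKTData.
End HKTBasics.

(** * Special homotheties *)

Lemma special_homothety_cyc (R : realType) (n : nat) (M : topologicalType)
    (A : set (chart R n M)) W g I J K X a b :
  special_homothety A W g I J K X a b -> special_homothety A W g J K I X a b.
Proof. by case. Qed.

Section Homothety.
Context {R : realType} {n : nat} {M : topologicalType}.
Variables (A : set (chart R n M)) (hM : smooth_manifold A).
Local Notation vec := ((M -> R) -> R).
Implicit Types (p q : M) (u v w z : vec) (Y Z : M -> vec).

(** The Killing equations of X and of IX together: nabla X - (a / 2) id, which is
    skew, is symmetric when composed with I. *)
Lemma homothety_cov_sym W g I J K nabla X a b p u v : HKT A W g I J K nabla ->
  special_homothety A W g I J K X a b -> W p -> tangent A p u -> tangent A p v ->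
  g p (nabla p u X) (I p v) - a / 2 * g p u (I p v) =
  g p (nabla p (I p u) X) v - a / 2 * g p (I p u) v.
Proof.
move=> hg hX Wp Tu Tv; have qs := hkt_quat hM hg Wp.
have vX := sh_field hX Wp.
have vIX : vfield_on A W (ap I X).
  by move=> q Wq; apply: (vf_I hg Wq); exact: (sh_field hX Wq).
have D w : tangent A p w -> tangent A p (nabla p w X).
  by move=> Tw; exact: (conn_tangent (hktc_conn (hkt_conn hg))).
have [[Du Dv] TIu] := (D _ Tu, D _ Tv, qTI qs Tu).
have DIu := D _ TIu.
have par w : tangent A p w -> nabla p w (ap I X) = I p (nabla p w X).
  by move=> Tw; exact: (hktc_I (hkt_conn hg)).
have := killing_eq hM hg Wp vIX (sh_Ig hX) Tu Tv.
have := killing_eq hM hg Wp (sh_field hX) (sh_g hX) TIu Tv.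
rewrite !par // mul0r !(q_gIr qs) //; lra.
Qed.

Section NablaX.
Variables (W : set M) (oW : open W) (g : M -> vec -> vec -> R)
  (I J K : M -> vec -> vec) (nabla : M -> vec -> (M -> vec) -> vec).
Variable hg : HKT A W g I J K nabla.
Variables (X : M -> vec) (a b : R).
Hypothesis hX : special_homothety A W g I J K X a b.
Let hg' := hkt_cyc hM hg.
Let hg'' := hkt_cyc hM hg'.
Let hX' := special_homothety_cyc hX.
Let hX'' := special_homothety_cyc hX'.
Let hconn := hktc_conn (hkt_conn hg).

(** With B the form of nabla X - (a / 2) id, one has B (K u, w) = B (u, IJ w) =
    B (JI u, w) = - B (K u, w) by homothety_cov_sym for K, I and J. *)
Lemma nabla_X p v : W p -> tangent A p v -> nabla p v X = (a / 2) *: v.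
Proof.
move=> Wp Tv; have qs := hkt_quat hM hg Wp.
have D w : tangent A p w -> tangent A p (nabla p w X).
  by move=> Tw; exact: (conn_tangent hconn _ Tw (sh_field hX Wp)).
pose B u w := g p (nabla p u X) w - a / 2 * g p u w.
have BI u w Tu Tw := @homothety_cov_sym _ _ _ _ _ _ _ _ _ p u w hg hX Wp Tu Tw.
have BJ u w Tu Tw := @homothety_cov_sym _ _ _ _ _ _ _ _ _ p u w hg' hX' Wp Tu Tw.
have BK u w Tu Tw := @homothety_cov_sym _ _ _ _ _ _ _ _ _ p u w hg'' hX'' Wp Tu Tw.
have BN u w : tangent A p u -> tangent A p w -> B (- u) w = - B u w.
  move=> Tu Tw; have T0 := tangent0 hM p.
  have D0 : nabla p 0 X = 0.
    have := conn_linear hconn (-1) Wp T0 T0 (sh_field hX Wp).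
    by rewrite !scaleN1r !addNr.
  have := conn_linear hconn (-1) Wp Tu T0 (sh_field hX Wp).
  rewrite D0 !addr0 !scaleN1r /B => ->.
  by rewrite !(q_gNl qs) //; [ring|exact: D].
have B0 u w : tangent A p u -> tangent A p w -> B (K p u) w = 0.
  move=> Tu Tw; have [[TIu TJw] TKu] := (qTI qs Tu, qTJ qs Tw, qTK qs Tu).
  have e1 : B (K p u) w = B u (K p w) by exact/esym/BK.
  have e2 : B u (K p w) = B (I p u) (J p w) by rewrite -(qs_IJ qs Tw); exact: BI.
  have e3 : B (I p u) (J p w) = - B (K p u) w.
    by rewrite -BN // -(qs_JI qs Tu); exact: BJ.
  lra.
apply: (q_ext qs (hkt_nondeg hM hg Wp)) => [||w Tw]; first exact: D.
  exact: (qTZ qs).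
rewrite (q_gZl qs) //; apply/eqP; rewrite -subr_eq0; apply/eqP.
have TKv := qTK qs Tv.
have := B0 _ _ (qTN qs TKv) Tw.
by rewrite (q_lin qs) // (qs_KK qs) // opprK.
Qed.

Lemma nabla_IX p v : W p -> tangent A p v -> nabla p v (ap I X) = (a / 2) *: I p v.
Proof.
move=> Wp Tv; have qs := hkt_quat hM hg Wp.
rewrite (hktc_I (hkt_conn hg) Wp Tv (sh_field hX Wp)) nabla_X //.
by rewrite (q_lin qs).
Qed.

Lemma X_tangent p : W p -> tangent A p (X p).
Proof. by move=> Wp; exact: vfield_tangent (sh_field hX Wp). Qed.

Lemma vf_IX p : W p -> vfield_at A p (ap I X).
Proof. by move=> Wp; exact: (vf_I hg Wp (sh_field hX Wp)). Qed.

Lemma torsion_IX p Z : W p -> vfield_at A p Z ->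
  torsion_tensor hM nabla p (I p (X p)) (Z p) =
  nabla p (I p (X p)) Z - (a / 2) *: I p (Z p) - bracket A (ap I X) Z p.
Proof.
move=> Wp vZ; rewrite -(torsion_tensorE hM hg Wp (vf_IX Wp) vZ).
by rewrite /torsion /cov nabla_IX //; exact: vfield_tangent.
Qed.

Hypotheses (ha : a != 0) (hab : a != b).
Let mu := homothety_potential g X a b.
Let kappa := 2 / (a - b).

Lemma smooth_potential p : W p -> smooth_at A p mu.
Proof.
move=> Wp; have vX := sh_field hX Wp.
exact: (smoothM hM (smooth_cst hM p _) (pm_smooth (hkt_metric hg) Wp vX vX)).
Qed.

Lemma d_potential p v : W p -> tangent A p v -> v mu = kappa * g p (X p) v.
Proof.
move=> Wp Tv; have vX := sh_field hX Wp; have qs := hkt_quat hM hg Wp.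
have Tx := X_tangent Wp.
rewrite (tangent_scale hM _ Tv (pm_smooth (hkt_metric hg) Wp vX vX)).
rewrite (hktc_g (hkt_conn hg) Wp Tv vX vX) nabla_X //.
rewrite (q_gZl qs) // (q_gZr qs) // (qs_gsym qs Tv) // /kappa.
by field; rewrite ha subr_eq0 hab.
Qed.

(** The form g X is closed, being a multiple of the differential of the potential,
    and its exterior derivative is the contraction of the torsion with X. *)
Lemma torsion_X0 p y z : W p -> tangent A p y -> tangent A p z ->
  g p (X p) (torsion_tensor hM nabla p y z) = 0.
Proof.
move=> Wp /(tangent_extend hM)[Y vY <-] /(tangent_extend hM)[Z vZ <-].
have qs := hkt_quat hM hg Wp; have Tx := X_tangent Wp.
have [TY TZ] := (vfield_tangent vY, vfield_tangent vZ).
have vX := sh_field hX Wp.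
have dmu F : vfield_at A p F ->
    \forall q \near p, F q mu = kappa * g q (X q) (F q).
  move=> vF; apply: filterS2 (open_nbhs_nbhs (conj oW Wp)) vF => q Wq [TF _].
  exact: d_potential.
have Tb := bracket_tangent hM vY vZ.
have k0 : kappa != 0.
  by rewrite mulf_neq0 ?invr_eq0 ?subr_eq0 // pnatr_eq0.
have cYZ : tangent A p (nabla p (Y p) Z) by exact: (conn_tangent hconn).
have cZY : tangent A p (nabla p (Z p) Y) by exact: (conn_tangent hconn).
have Tt := torsion_tensorT hM hg Wp TY TZ.
have brE : bracket A Y Z p =
    nabla p (Y p) Z + (- nabla p (Z p) Y - torsion_tensor hM nabla p (Y p) (Z p)).
  by rewrite -(torsion_tensorE hM hg Wp vY vZ) /torsion /cov addrA opprB addrC subrK.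
have := d_potential Wp Tb.
rewrite {1}/bracket asboolT; last exact: smooth_potential.
rewrite (tangent_near hM TY (dmu _ vZ)) (tangent_near hM TZ (dmu _ vY)).
rewrite (tangent_scale hM _ TY (pm_smooth (hkt_metric hg) Wp vX vZ)).
rewrite (tangent_scale hM _ TZ (pm_smooth (hkt_metric hg) Wp vX vY)).
rewrite (hktc_g (hkt_conn hg) Wp TY vX vZ) (hktc_g (hkt_conn hg) Wp TZ vX vY).
rewrite !nabla_X // !(q_gZl qs) // (qs_gsym qs TY) // -mulrBr.
move=> /(mulfI k0); rewrite brE.
move: (nabla p (Y p) Z) (nabla p (Z p) Y) cYZ cZY => n1 n2 T1 T2.
have T3 := qTN qs T2; have T4 := qTN qs Tt; have T5 := qTD qs T3 T4.
rewrite (q_gDr qs) // (q_gDr qs) // !(q_gNr qs) // (qs_gsym qs TZ) //; lra.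
Qed.

(** As nabla (IX) = (a / 2) I, the Lie derivative along IX differs from - T(IX, .)
    by a covariant derivative, which commutes with I, J, K, and by a multiple of
    I. *)
Lemma torsion_IX_I p z : W p -> tangent A p z ->
  torsion_tensor hM nabla p (I p (X p)) (I p z) =
    I p (torsion_tensor hM nabla p (I p (X p)) z).
Proof.
move=> Wp /(tangent_extend hM)[Z vZ <-]; have qs := hkt_quat hM hg Wp.
have TZ := vfield_tangent vZ; have TIX := qTI qs (X_tangent Wp).
have vIZ := vf_I hg Wp vZ.
rewrite torsion_IX // (torsion_IX Wp vIZ).
have cT : tangent A p (nabla p (I p (X p)) Z) by exact: (conn_tangent hconn).
have bT := bracket_tangent hM (vf_IX Wp) vZ.
rewrite (hktc_I (hkt_conn hg) Wp TIX vZ).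
have /eqP := sh_II hX Wp vZ; rewrite scale0r subr_eq0 => /eqP ->.
have [T1 T2] := (qTZ qs (a / 2) (qTI qs TZ), qTN qs bT).
move: (nabla _ _ _) (bracket _ _ _ _) cT bT T2 => n1 n2 cT bT T2.
have T3 := qTN qs T1; have T4 := qTD qs cT T3; have TIZ := qTI qs TZ.
by rewrite !(qID qs) // !(qIN qs) // !(qIZ qs).
Qed.

Lemma torsion_IX_J p z : W p -> tangent A p z ->
  torsion_tensor hM nabla p (I p (X p)) (J p z) =
  J p (torsion_tensor hM nabla p (I p (X p)) z) - (a + b) *: K p z.
Proof.
move=> Wp /(tangent_extend hM)[Z vZ <-]; have qs := hkt_quat hM hg Wp.
have qs' := quat_space_cyc qs.
have TZ := vfield_tangent vZ; have TIX := qTI qs (X_tangent Wp).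
have vJZ := vf_I hg' Wp vZ.
rewrite torsion_IX // (torsion_IX Wp vJZ).
have cT : tangent A p (nabla p (I p (X p)) Z) by exact: (conn_tangent hconn).
have bT := bracket_tangent hM (vf_IX Wp) vZ.
rewrite (hktc_J (hkt_conn hg) Wp TIX vZ).
have /eqP := sh_IJ hX Wp vZ; rewrite subr_eq => /eqP ->.
have TIZ := qTI qs TZ; have TKZ := qTK qs TZ.
have [T1 T2] := (qTZ qs (a / 2) TIZ, qTN qs bT).
have T3 := qTN qs T1; rewrite (qs_IJ qs) //.
move: (nabla _ _ _) (bracket _ _ _ _) cT bT T2 => n1 n2 cT bT T2.
have T4 := qTD qs cT T3.
rewrite !(qID qs') // !(qIN qs') // !(qIZ qs') // (qs_JI qs) //.
apply/funext => h; rewrite !fctE /GRing.scale /=; by field.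
Qed.

End NablaX.

Section TorsionAlongX.
Variables (W : set M) (oW : open W) (g : M -> vec -> vec -> R)
  (I J K : M -> vec -> vec) (nabla : M -> vec -> (M -> vec) -> vec).
Variable hg : HKT A W g I J K nabla.
Variables (X : M -> vec) (a b : R).
Hypothesis hX : special_homothety A W g I J K X a b.
Hypotheses (ha : a != 0) (hab : a != b).
Let hg' := hkt_cyc hM hg.
Let hg'' := hkt_cyc hM hg'.
Let hX' := special_homothety_cyc hX.
Let hX'' := special_homothety_cyc hX'.

Lemma hkt_quat_torsion p : W p ->
  quat_torsion (tangent A p) (g p) (I p) (J p) (K p) (X p) (torsion_tensor hM nabla p) (a + b).
Proof.
move=> Wp; split.
- by move=> y z; exact: (torsion_tensorT hM hg).
- by move=> t y u v; exact: (torsion_tensor_lin hM hg).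
- by move=> y z; exact: (torsion_tensor_alt hM hg).
- by move=> w y z; exact: (torsion_tensor_skew hM hg).
- by move=> y z; exact: (torsion_X0 oW hg hX).
- by move=> z; exact: (torsion_IX_I hg hX).
- by move=> z; exact: (torsion_IX_I hg' hX').
- by move=> z; exact: (torsion_IX_I hg'' hX'').
- by move=> z; exact: (torsion_IX_J hg hX).
- by move=> z; exact: (torsion_IX_J hg' hX').
- by move=> z; exact: (torsion_IX_J hg'' hX'').
Qed.

End TorsionAlongX.
End Homothety.

(** * Potentials *)

Lemma Cinfty_derive1 (R : realType) (E : set R) (f : R -> R) :
  Cinfty E f -> Cinfty E (derive1 f).
Proof.
move=> Cf k; have [_ /(_ 1)] := Cf k.+1.
by congr Ck; apply/funext => x; rewrite derive1E.
Qed.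

Section Potential.
Context {R : realType} {n : nat} {M : topologicalType}.
Variables (A : set (chart R n M)) (hM : smooth_manifold A).
Local Notation vec := ((M -> R) -> R).
Implicit Types (p q : M) (u v w z : vec) (Y Z : M -> vec).
Variables (W : set M) (oW : open W).

Section OneOrder.
Variables (g : M -> vec -> vec -> R)
  (I J K : M -> vec -> vec) (nabla : M -> vec -> (M -> vec) -> vec).
Variable hg : HKT A W g I J K nabla.
Variables (X : M -> vec) (a b : R).
Hypothesis hX : special_homothety A W g I J K X a b.
Hypotheses (ha : a != 0) (hab : a != b).
Let hg' := hkt_cyc hM hg.
Let mu := homothety_potential g X a b.
Let kappa := 2 / (a - b).
Variables (E : set R) (oE : open E) (f : R -> R) (Cf : Cinfty E f).
Hypothesis muE : forall p, W p -> E (mu p).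

Let Cf1 := Cinfty_derive1 Cf.

Lemma near_W p : W p -> \forall q \near p, W q.
Proof. by move=> Wp; exact: open_nbhs_nbhs. Qed.

Lemma d_fpotential p v : W p -> tangent A p v ->
  v (f \o mu) = derive1 f (mu p) * (kappa * g p (X p) v).
Proof.
move=> Wp Tv; rewrite -(d_potential hM hg hX ha hab Wp Tv).
exact: (tangent_comp hM oE Cf (muE Wp) Tv (smooth_potential hM hg hX Wp)).
Qed.

Lemma smooth_df p : W p -> smooth_at A p (fun q => derive1 f (mu q)).
Proof.
by move=> Wp; exact: (smooth_comp hM oE Cf1 (muE Wp) (smooth_potential hM hg hX Wp)).
Qed.

Lemma d_dfpotential p v : W p -> tangent A p v ->
  v (fun q => derive1 f (mu q)) = derive1n 2 f (mu p) * (kappa * g p (X p) v).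
Proof.
move=> Wp Tv; rewrite -(d_potential hM hg hX ha hab Wp Tv).
exact: (tangent_comp hM oE Cf1 (muE Wp) Tv (smooth_potential hM hg hX Wp)).
Qed.

Lemma dI0E p v : W p -> tangent A p v ->
  dJ0 I (f \o mu) p v = derive1 f (mu p) * kappa * g p (I p (X p)) v.
Proof.
move=> Wp Tv; have qs := hkt_quat hM hg Wp; have TIv := qTI qs Tv.
have Tx := X_tangent hX Wp.
rewrite /dJ0 /act1 /d0 (d_fpotential Wp); last exact: (qTN qs).
by rewrite (q_gNr qs) // (q_gIr qs) // opprK mulrA.
Qed.

(** The product rule and nabla (IX) = (a / 2) I. Only the values of al on tangent
    vectors near p matter, so al may be any expression of h (IX)^flat. *)
Lemma d1_IX_form (al : M -> vec -> R) (h : M -> R) p Y Z : W p ->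
  smooth_at A p h -> vfield_at A p Y -> vfield_at A p Z ->
  (forall q v, W q -> tangent A q v -> al q v = h q * g q (I q (X q)) v) ->
  d1 A al Y Z p = Y p h * g p (I p (X p)) (Z p) - Z p h * g p (I p (X p)) (Y p)
    + h p * (a * g p (I p (Y p)) (Z p) + g p (I p (X p)) (torsion_tensor hM nabla p (Y p)
      (Z p))).
Proof.
move=> Wp sh vY vZ alE; have qs := hkt_quat hM hg Wp.
have [TY TZ] := (vfield_tangent vY, vfield_tangent vZ).
have Tx := X_tangent hX Wp; have TIx := qTI qs Tx.
have vIX := vf_IX hg hX Wp.
have nE F : vfield_at A p F ->
    \forall q \near p, al q (F q) = h q * g q (ap I X q) (F q).
  by move=> vF; apply: filterS2 (near_W Wp) vF => q Wq [TF _]; exact: alE.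
have Tb := bracket_tangent hM vY vZ.
have sg F : vfield_at A p F -> smooth_at A p (fun q => g q (ap I X q) (F q)).
  by move=> vF; exact: (pm_smooth (hkt_metric hg)).
rewrite /d1 (tangent_near hM TY (nE _ vZ)) (tangent_near hM TZ (nE _ vY)).
rewrite alE // (tangent_mul hM TY sh (sg _ vZ)) (tangent_mul hM TZ sh (sg _ vY)).
rewrite (hktc_g (hkt_conn hg) Wp TY vIX vZ) (hktc_g (hkt_conn hg) Wp TZ vIX vY).
rewrite !(nabla_IX hM hg hX) // -(torsion_tensorE hM hg Wp vY vZ).
have cYZ : tangent A p (nabla p (Y p) Z) by exact: (conn_tangent (hktc_conn (hkt_conn hg))).
have cZY : tangent A p (nabla p (Z p) Y) by exact: (conn_tangent (hktc_conn (hkt_conn hg))).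
rewrite /torsion /cov /ap.
move: (nabla _ _ _) (nabla _ _ _) (bracket _ _ _ _) cYZ cZY Tb => n1 n2 br T1 T2 T3.
have [T4 T5] := (qTN qs T2, qTN qs T3); have T6 := qTD qs T1 T4.
have [TIY TIZ] := (qTI qs TY, qTI qs TZ).
rewrite !(q_gDr qs) // !(q_gNr qs) // !(q_gZl qs) // (q_gIflip qs TZ) //.
by field.
Qed.

Lemma deformed_metricE p v w : W p -> tangent A p v -> tangent A p w ->
  deformed_metric g I J K mu f p v w =
  deform_form (g p) (I p) (J p) (K p) (X p) (derive1 f (mu p))
    (2^-1 * derive1n 2 f (mu p) * kappa ^+ 2) v w.
Proof.
move=> Wp Tv Tw; have qs := hkt_quat hM hg Wp; have Tx := X_tangent hX Wp.
have mN (L : vec -> vec) u : tangent A p (L u) -> (- L u) mu = - kappa * g p (X p) (L u).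
  move=> TL; rewrite (d_potential hM hg hX ha hab Wp (qTN qs TL)) (q_gNr qs) //.
  by rewrite mulrN mulNr.
rewrite /deformed_metric /dH2 /act1 /d0 !mN; try by [exact: (qTI qs)|exact: (qTJ
  qs)|exact: (qTK qs)].
rewrite !(d_potential hM hg hX ha hab Wp) // !(q_gqr qs) // /deform_form /qform.
by rewrite -/kappa; ring.
Qed.

(** Both d_I and J d_K map f(mu) to a multiple of (IX)^flat, so that the right-hand
    side is the difference of an exterior derivative and its image under J, which
    deform_form_potential computes. *)
Lemma fpotential_eq : potential_eq A W (f \o mu) (deformed_metric g I J K mu f) I J K.
Proof.
move=> p Y Z Wp vY vZ; have qs := hkt_quat hM hg Wp.
have qt := hkt_quat_torsion hM oW hg hX ha hab Wp.
have [TY TZ] := (vfield_tangent vY, vfield_tangent vZ).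
have Tx := X_tangent hX Wp.
have sh : smooth_at A p (fun q => derive1 f (mu q) * kappa).
  exact: (smoothM hM (smooth_df Wp) (smooth_cst hM p kappa)).
have dh v : tangent A p v -> v (fun q => derive1 f (mu q) * kappa) =
    derive1n 2 f (mu p) * kappa ^+ 2 * g p (X p) v.
  move=> Tv; rewrite (tangent_mul hM Tv (smooth_df Wp) (smooth_cst hM p kappa)).
  by rewrite (tangent_cst kappa Tv) (d_dfpotential Wp Tv); ring.
have vJ F : vfield_at A p F -> vfield_at A p (fun q => - ap J F q).
  by move=> vF; apply: (vfieldN hM); exact: (vf_I hg' Wp).
rewrite (d1_IX_form Wp sh vY vZ dI0E).
rewrite /dJ1 /act2 (d1_IX_form Wp sh (vJ _ vY) (vJ _ vZ)); last first.
  move=> q v Wq Tv; have qsq := hkt_quat hM hg Wq; have Txq := X_tangent hX Wq.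
  have TJv := qTJ qsq Tv; have [TN TK] := (qTN qsq TJv, qTK qsq TJv).
  have TIv := qTI qsq Tv.
  rewrite /act1 /dJ0 /act1 /d0 (d_fpotential Wq); last exact/(qTN qsq)/(qTK qsq).
  rewrite !(q_lin (quat_space_cyc qsq)) // (q_KJ qsq) // opprK.
  rewrite (q_gNr qsq) // (q_gIr qsq) // opprK; ring.
have [TJY TJZ] := (qTN qs (qTJ qs TY), qTN qs (qTJ qs TZ)).
rewrite /kform deformed_metricE //; last exact: (qTI qs).
rewrite !dh // /ap.
apply: (deform_form_potential qs Tx qt) => //.
by rewrite /kappa divfK // subr_eq0.
Qed.

Lemma smooth_fpotential : smooth_on A W (f \o mu).
Proof.
by move=> p Wp; exact: (smooth_comp hM oE Cf (muE Wp) (smooth_potential hM hg hX Wp)).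
Qed.

End OneOrder.
End Potential.

(** * The HKT structure of the deformed metric *)

Lemma quat_space_eq (R : realType) (V : lmodType R) (T : V -> Prop)
    (g g' : V -> V -> R) (I J K : V -> V) :
  (forall v w, T v -> T w -> g' v w = g v w) ->
  quat_space T g I J K -> quat_space T g' I J K.
Proof.
move=> E qs; have [[TI TJ] TK] := (qs_TI qs, qs_TJ qs, qs_TK qs).
split; try by case: qs.
- by move=> t u v w Tu Tv Tw; rewrite !E ?(qs_glin qs) //; exact: (qs_lin qs).
- by move=> v w Tv Tw; rewrite !E // (qs_gsym qs).
- by move=> v w Tv Tw; rewrite !E ?(qs_gI qs) //; exact: TI.
- by move=> v w Tv Tw; rewrite !E ?(qs_gJ qs) //; exact: TJ.
- by move=> v w Tv Tw; rewrite !E ?(qs_gK qs) //; exact: TK.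
Qed.

Section DeformedMetric.
Context {R : realType} {n : nat} {M : topologicalType}.
Variables (A : set (chart R n M)) (hM : smooth_manifold A).
Local Notation vec := ((M -> R) -> R).
Implicit Types (p q : M) (u v w z : vec) (Y Z : M -> vec).
Variables (W : set M) (oW : open W).
Variables (X : M -> vec) (a b : R) (ha : a != 0) (hab : a != b).
Let kappa := 2 / (a - b).
Variables (E : set R) (oE : open E) (f : R -> R) (Cf : Cinfty E f).
Let Cf1 := Cinfty_derive1 Cf.
Let Cf2 := Cinfty_derive1 Cf1.

Section OneOrder.
Variables (g : M -> vec -> vec -> R)
  (I J K : M -> vec -> vec) (nabla : M -> vec -> (M -> vec) -> vec).
Variable hg : HKT A W g I J K nabla.
Hypothesis hX : special_homothety A W g I J K X a b.
Let hg' := hkt_cyc hM hg.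
Let hg'' := hkt_cyc hM hg'.
Let hX' := special_homothety_cyc hX.
Let hX'' := special_homothety_cyc hX'.
Let mu := homothety_potential g X a b.
Hypothesis muE : forall p, W p -> E (mu p).

(** The coefficients of the deformed metric as a form phi g + psi qform, and the
    derivative of psi along X^flat. *)
Definition dphi p : R := derive1 f (mu p).
Definition dpsi p : R := 2^-1 * derive1n 2 f (mu p) * kappa ^+ 2.
Definition dpsi1 p : R := 2^-1 * derive1n 3 f (mu p) * kappa ^+ 3.

Lemma smooth_dphi p : W p -> smooth_at A p dphi.
Proof.
by move=> Wp; exact: (smooth_comp hM oE Cf1 (muE Wp) (smooth_potential hM hg hX Wp)).
Qed.

Lemma smooth_d2f p : W p -> smooth_at A p (fun q => derive1n 2 f (mu q)).
Proof.
by move=> Wp; exact: (smooth_comp hM oE Cf2 (muE Wp) (smooth_potential hM hg hX Wp)).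
Qed.

Lemma smooth_dpsi p : W p -> smooth_at A p dpsi.
Proof.
move=> Wp; apply: (smoothM hM); last exact: smooth_cst.
by apply: (smoothM hM); [exact: smooth_cst|exact: smooth_d2f].
Qed.

Lemma smooth_dpsi1 p : W p -> smooth_at A p dpsi1.
Proof.
move=> Wp; apply: (smoothM hM); last exact: smooth_cst.
apply: (smoothM hM); first exact: smooth_cst.
exact: (smooth_comp hM oE (Cinfty_derive1 Cf2) (muE Wp) (smooth_potential hM hg hX Wp)).
Qed.

Lemma d_dphi p v : W p -> tangent A p v -> v dphi = (a - b) * dpsi p * g p (X p) v.
Proof.
move=> Wp Tv; rewrite /dphi (d_dfpotential hM hg hX ha hab oE Cf muE Wp Tv) /dpsi /kappa.
by field; rewrite subr_eq0.
Qed.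

Lemma d_dpsi p v : W p -> tangent A p v -> v dpsi = dpsi1 p * g p (X p) v.
Proof.
move=> Wp Tv; have s2 := smooth_d2f Wp.
have s3 := smoothM hM (smooth_cst hM p 2^-1) s2.
rewrite (tangent_mul hM Tv s3 (smooth_cst hM p _)) (tangent_cst _ Tv).
rewrite (tangent_scale hM _ Tv s2).
rewrite (tangent_comp hM oE Cf2 (muE Wp) Tv (smooth_potential hM hg hX Wp)).
have E3 : derive1n 3 f = derive1 (derive1n 2 f) by [].
have -> : v mu = kappa * g p (X p) v by exact: (d_potential hM hg hX ha hab Wp Tv).
rewrite /dpsi1 E3; move: kappa => k.
move: (derive1 (derive1n 2 f) (mu p)) (g p (X p) v) (derive1n 2 f _) => D y D2.
by ring.
Qed.

Local Notation gf := (deformed_metric g I J K mu f).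
Local Notation gd p := (deform_form (g p) (I p) (J p) (K p) (X p) (dphi p) (dpsi p)).

Lemma deformed_metric_formE p v w : W p -> tangent A p v -> tangent A p w ->
  gf p v w = gd p v w.
Proof. exact: (deformed_metricE hM hg hX ha hab). Qed.

Lemma deform_form_quat p : W p -> quat_space (tangent A p) (gd p) (I p) (J p) (K p).
Proof.
by move=> Wp; apply: deform_form_quat_space; [exact: (hkt_quat hM hg Wp)|exact:
  (X_tangent hX Wp)].
Qed.

Lemma gf_quat p : W p -> quat_space (tangent A p) (gf p) (I p) (J p) (K p).
Proof. by move=> Wp; apply: quat_space_eq (deform_form_quat Wp) => v w;
  exact: deformed_metric_formE. Qed.

Lemma vf_JX p : W p -> vfield_at A p (ap J X). Proof. exact: (vf_IX hg' hX'). Qed.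
Lemma vf_KX p : W p -> vfield_at A p (ap K X). Proof. exact: (vf_IX hg'' hX''). Qed.

Lemma smooth_g p Y Z : W p -> vfield_at A p Y -> vfield_at A p Z ->
  smooth_at A p (fun q => g q (Y q) (Z q)).
Proof. exact: (pm_smooth (hkt_metric hg)). Qed.

Lemma gf_smooth p Y Z : W p -> vfield_at A p Y -> vfield_at A p Z ->
  smooth_at A p (fun q => gf q (Y q) (Z q)).
Proof.
move=> Wp vY vZ.
apply: (@smooth_at_eq _ _ _ _ hM _ (fun q => gd q (Y q) (Z q))).
  apply: filterS3 (near_W oW Wp) vY vZ => q Wq [TY _] [TZ _].
  by rewrite deformed_metric_formE.
have vX := sh_field hX Wp; have vIX := vf_IX hg hX Wp.
have [vJX vKX] := (vf_JX Wp, vf_KX Wp).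
apply: (smoothD hM); first exact: (smoothM hM (smooth_dphi Wp) (smooth_g Wp vY vZ)).
apply: (smoothM hM); first exact: smooth_dpsi.
by do 3?apply: (smoothD hM); apply: (smoothM hM);
  apply: (pm_smooth (hkt_metric hg)).
Qed.

Hypothesis phi0 : forall p, W p -> dphi p != 0.
Hypothesis lam0 : forall p, W p -> dphi p + dpsi p * g p (X p) (X p) != 0.

(** The signature comes from quat_signature, for g_f may be of opposite signs
    relative to g on the quaternionic line of X and on its orthogonal. *)
Lemma gf_pseudo_metric : pseudo_metric A W gf.
Proof.
split.
- by move=> p t u v w Wp; exact: (qs_glin (gf_quat Wp)).
- by move=> p v w Wp; exact: (qs_gsym (gf_quat Wp)).
- exact: gf_smooth.
move=> p Wp; have [e [Te span indep nd]] := hkt_frame hM hg Wp.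
have ndf := deform_form_nondeg (hkt_quat hM hg Wp) nd (X_tangent hX Wp) (phi0 Wp) (lam0 Wp).
have [r [s [e' [nE Te' span' table]]]] := quat_signature (deform_form_quat Wp) ndf Te
  span indep.
by exists r, s, e'; split=> // i j; rewrite deformed_metric_formE.
Qed.

Definition deformed_nabla : M -> vec -> (M -> vec) -> vec := fun p v Z =>
  nabla p v Z + correction (g p) (I p) (J p) (K p) (X p) (torsion_tensor hM nabla p) a b
    (dphi p) (dpsi p) (dpsi1 p) v (Z p).

Section AtPoint.
Variables (p : M) (Wp : W p).
Let qs := hkt_quat hM hg Wp.
Let nd := hkt_nondeg hM hg Wp.
Let Tx := X_tangent hX Wp.
Let qt := hkt_quat_torsion hM oW hg hX ha hab Wp.
Local Notation P := (correction (g p) (I p) (J p) (K p) (X p) (torsion_tensor hM nabla p) a b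
    (dphi p) (dpsi p) (dpsi1 p)).

Lemma PT v z : tangent A p v -> tangent A p z -> tangent A p (P v z).
Proof. exact: (correctionT qs Tx qt). Qed.

Lemma deform_form_P v z w : tangent A p v -> tangent A p z -> tangent A p w ->
  gd p (P v z) w = correction_form (g := g p) (I := I p) (J := J p) (K := K p)
    (X p) (torsion_tensor hM nabla p) a b (dpsi p) (dpsi1 p) v z w.
Proof.
exact: (deform_form_correction qs Tx qt _ (phi0 Wp) (lam0 Wp)).
Qed.

Lemma deformed_nablaT v Z : tangent A p v -> vfield_at A p Z ->
  tangent A p (deformed_nabla p v Z).
Proof.
move=> Tv vZ; apply: (tangentD hM).
  exact: (conn_tangent (hktc_conn (hkt_conn hg))).
by apply: PT => //; exact: vfield_tangent.
Qed.

Lemma deformed_nabla_leibniz v h Z : tangent A p v -> smooth_at A p h -> vfield_at A p Z ->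
  deformed_nabla p v (fun q => h q *: Z q) = v h *: Z p + h p *: deformed_nabla p v Z.
Proof.
move=> Tv sh vZ; have TZ := vfield_tangent vZ.
rewrite /deformed_nabla (conn_leibniz (hktc_conn (hkt_conn hg))) //.
have P0 : P v 0 = 0.
  have := correction_linr qs nd Tx qt (dphi p) (dpsi p) (dpsi1 p) (-1) Tv (qT0 qs) (qT0 qs).
  by rewrite scaler0 addr0 scaleN1r addNr.
have := correction_linr qs nd Tx qt (dphi p) (dpsi p) (dpsi1 p) (h p) Tv TZ (qT0 qs).
by rewrite !addr0 P0 addr0 => ->; rewrite scalerDr addrA.
Qed.

Lemma deformed_nabla_add v Y Z : tangent A p v -> vfield_at A p Y -> vfield_at A p Z ->
  deformed_nabla p v (fun q => Y q + Z q) = deformed_nabla p v Y + deformed_nabla p v Z.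
Proof.
move=> Tv vY vZ; have [TY TZ] := (vfield_tangent vY, vfield_tangent vZ).
rewrite /deformed_nabla (conn_add (hktc_conn (hkt_conn hg))) //.
have := correction_linr qs nd Tx qt (dphi p) (dpsi p) (dpsi1 p) 1 Tv TY TZ.
by rewrite !scale1r => ->; rewrite addrACA.
Qed.

Lemma deformed_nabla_linear t v w Z : tangent A p v -> tangent A p w -> vfield_at A p Z ->
  deformed_nabla p (t *: v + w) Z = t *: deformed_nabla p v Z + deformed_nabla p w Z.
Proof.
move=> Tv Tw vZ; have TZ := vfield_tangent vZ.
rewrite /deformed_nabla (conn_linear (hktc_conn (hkt_conn hg))) //.
rewrite (correction_linl qs nd Tx qt) // scalerDr addrACA //.
Qed.

Lemma deformed_nabla_I v Y : tangent A p v -> vfield_at A p Y ->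
  deformed_nabla p v (ap I Y) = I p (deformed_nabla p v Y).
Proof.
move=> Tv vY; have TY := vfield_tangent vY.
rewrite /deformed_nabla (hktc_I (hkt_conn hg)) // /ap (correctionI qs nd Tx qt) //.
rewrite (qID qs) //; last exact: PT.
exact: (conn_tangent (hktc_conn (hkt_conn hg))).
Qed.

Lemma torsion_deformed_nabla Y Z : vfield_at A p Y -> vfield_at A p Z ->
  torsion A deformed_nabla Y Z p =
  torsion_tensor hM nabla p (Y p) (Z p) + (P (Y p) (Z p) - P (Z p) (Y p)).
Proof.
move=> vY vZ; rewrite -(torsion_tensorE hM hg Wp vY vZ) /torsion /cov /deformed_nabla.
move: (nabla _ _ _) (nabla _ _ _) (P _ _) (P _ _) => n1 n2 P1 P2.
move: (bracket _ _ _ _) => br.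
by apply/funext => h; rewrite !fctE; ring.
Qed.

Lemma deformed_nabla_skew12 V Y Z : vfield_at A p V -> vfield_at A p Y -> vfield_at A p Z ->
  torsion3 A gf deformed_nabla V Y Z p = - torsion3 A gf deformed_nabla Y V Z p.
Proof.
move=> vV vY vZ; have [TV TY] := (vfield_tangent vV, vfield_tangent vY).
have TZ := vfield_tangent vZ; rewrite /torsion3 !torsion_deformed_nabla //.
have tT u v : tangent A p u -> tangent A p v ->
    tangent A p (torsion_tensor hM nabla p u v + (P u v - P v u)).
  move=> Tu Tv; apply: (tangentD hM); first exact: (torsion_tensorT hM hg).
  by apply: (tangentB hM); exact: PT.
rewrite !deformed_metric_formE //; do ?exact: tT.
exact: (correction_torsion_skew qs Tx qt _ (phi0 Wp) (lam0 Wp)).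
Qed.

Lemma deformed_nabla_skew23 V Y Z : vfield_at A p V -> vfield_at A p Y -> vfield_at A p Z ->
  torsion3 A gf deformed_nabla V Y Z p = - torsion3 A gf deformed_nabla V Z Y p.
Proof.
move=> vV vY vZ; have [TV TY] := (vfield_tangent vV, vfield_tangent vY).
have TZ := vfield_tangent vZ; rewrite /torsion3 !torsion_deformed_nabla //.
have tT u v : tangent A p u -> tangent A p v ->
    tangent A p (torsion_tensor hM nabla p u v + (P u v - P v u)).
  move=> Tu Tv; apply: (tangentD hM); first exact: (torsion_tensorT hM hg).
  by apply: (tangentB hM); exact: PT.
rewrite (torsion_tensor_alt hM hg Wp) // -[P (Y p) (Z p) - _]opprB -opprD.
by rewrite (q_gNr (gf_quat Wp)) //; exact: tT.
Qed.

(** The derivative of the deformed metric is expanded by the product rule; its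
    covariant part is the symmetric part of the correction. *)
Lemma deformed_nabla_parallel v Y Z : tangent A p v -> vfield_at A p Y -> vfield_at A p Z ->
  v (fun q => gf q (Y q) (Z q)) = gf p (deformed_nabla p v Y) (Z p)
    + gf p (Y p) (deformed_nabla p v Z).
Proof.
move=> Tv vY vZ; have [TY TZ] := (vfield_tangent vY, vfield_tangent vZ).
have gdq := deform_form_quat Wp.
have [TnY TnZ] := (deformed_nablaT Tv vY, deformed_nablaT Tv vZ).
have cT F : vfield_at A p F -> tangent A p (nabla p v F).
  by move=> vF; exact: (conn_tangent (hktc_conn (hkt_conn hg))).
rewrite [RHS](_ : _ = gd p (nabla p v Y) (Z p) + gd p (Y p) (nabla p v Z) +
    (gd p (P v (Y p)) (Z p) + gd p (P v (Z p)) (Y p))); last first.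
  have [TPY TPZ] := (PT Tv TY, PT Tv TZ); have [cY cZ] := (cT _ vY, cT _ vZ).
  rewrite !deformed_metric_formE // /deformed_nabla (q_gDl gdq) // (q_gDr gdq) //.
  by rewrite (qs_gsym gdq TY TPZ); ring.
rewrite !deform_form_P // (correction_form_sym qs Tx qt) //.
have vX := sh_field hX Wp; have vIX := vf_IX hg hX Wp.
have [vJX vKX] := (vf_JX Wp, vf_KX Wp).
rewrite (@tangent_near _ _ _ _ hM _ _ _ (fun q => gd q (Y q) (Z q)) Tv); last first.
  by apply: filterS3 (near_W oW Wp) vY vZ => q Wq [TYq _] [TZq _];
    rewrite deformed_metric_formE.
have par F G : vfield_at A p F -> vfield_at A p G -> v (fun q => g q (F q) (G q)) =
    g p (nabla p v F) (G p) + g p (F p) (nabla p v G).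
  by move=> vF vG; exact: (hktc_g (hkt_conn hg)).
have sg := smooth_g Wp.
have dq F : vfield_at A p F -> v (fun q => g q (F q) (Y q) * g q (F q) (Z q)) =
    (g p (nabla p v F) (Y p) + g p (F p) (nabla p v Y)) * g p (F p) (Z p)
    + g p (F p) (Y p) * (g p (nabla p v F) (Z p) + g p (F p) (nabla p v Z)).
  by move=> vF; rewrite (tangent_mul hM Tv (sg _ _ vF vY) (sg _ _ vF vZ)) !par.
have sq F : vfield_at A p F -> smooth_at A p (fun q => g q (F q) (Y q) * g q (F q) (Z q)).
  by move=> vF; exact: (smoothM hM (sg _ _ vF vY) (sg _ _ vF vZ)).
have s12 := smoothD hM (sq _ vX) (sq _ vIX).
have s123 := smoothD hM s12 (sq _ vJX).
have s1234 := smoothD hM s123 (sq _ vKX).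
have sp := smoothM hM (smooth_dphi Wp) (sg _ _ vY vZ).
have sps := smoothM hM (smooth_dpsi Wp) s1234.
rewrite {1}/deform_form {1}/qform.
rewrite (tangent_add hM Tv sp sps) (tangent_mul hM Tv (smooth_dphi Wp) (sg _ _ vY vZ)).
rewrite (tangent_mul hM Tv (smooth_dpsi Wp) s1234).
rewrite (tangent_add hM Tv s123 (sq _ vKX)) (tangent_add hM Tv s12 (sq _ vJX)).
rewrite (tangent_add hM Tv (sq _ vX) (sq _ vIX)) !dq // par //.
rewrite (d_dphi Wp Tv) (d_dpsi Wp Tv).
rewrite (nabla_X hM hg hX Wp Tv) (nabla_IX hM hg hX Wp Tv).
rewrite (nabla_IX hM hg' hX' Wp Tv) (nabla_IX hM hg'' hX'' Wp Tv) /ap.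
move: (nabla p v Y) (nabla p v Z) (cT _ vY) (cT _ vZ) => nY nZ TY' TZ'.
have [[TIv TJv] TKv] := (qTI qs Tv, qTJ qs Tv, qTK qs Tv).
rewrite !(q_gZl qs) // /deform_form /qform; by field.
Qed.

End AtPoint.

Lemma vf_torsion_qlin (L : M -> vec -> vec) p Z : W p -> vfield_at A p (ap L X) ->
  vfield_at A p (ap L Z) -> vfield_at A p Z ->
  vfield_at A p (fun q => torsion_qlin (X q) (torsion_tensor hM nabla q) (a + b) (L q) (Z q)).
Proof.
move=> Wp vLX vLZ vZ; apply: (vfieldD hM); last first.
  exact: (vfieldZ hM (smooth_cst hM p _) vLZ).
apply: vfield_eq hM _ _ _ _ (vf_torsion hM hg Wp vLX vZ).
apply: filterS3 (near_W oW Wp) (vfield_near vLX) (vfield_near vZ) => q Wq vLXq vZq.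
exact: (torsion_tensorE hM hg Wq vLXq vZq).
Qed.

Lemma vf_raw_correction p Y Z : W p -> vfield_at A p Y -> vfield_at A p Z ->
  vfield_at A p (fun q => raw_correction (g q) (I q) (J q) (K q) (X q) (torsion_tensor hM
    nabla q) a b
    (dpsi q) (dpsi1 q) (Y q) (Z q)).
Proof.
move=> Wp vY vZ.
have vX := sh_field hX Wp; have vIX := vf_IX hg hX Wp.
have [vJX vKX] := (vf_JX Wp, vf_KX Wp).
have [[vIY vJY] vKY] := (vf_I hg Wp vY, vf_I hg' Wp vY, vf_I hg'' Wp vY).
have [[vIZ vJZ] vKZ] := (vf_I hg Wp vZ, vf_I hg' Wp vZ, vf_I hg'' Wp vZ).
have vSI := vf_torsion_qlin Wp vIX vIZ vZ; have vSJ := vf_torsion_qlin Wp vJX vJZ vZ.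
have vSK := vf_torsion_qlin Wp vKX vKZ vZ.
have sp := smooth_dpsi Wp; have sp1 := smooth_dpsi1 Wp.
have sc t : smooth_at A p (fun=> t) by exact: smooth_cst.
have sg := smooth_g Wp.
rewrite /raw_correction.
repeat first [ assumption | exact: sc | apply: sg
  | apply: (vfieldB hM) | apply: (vfieldD hM) | apply: (vfieldZ hM)
  | apply: (smoothM hM) ].
Qed.

Lemma vf_deform_form_inv p C : W p -> vfield_at A p C ->
  vfield_at A p (fun q => deform_form_inv (g q) (I q) (J q) (K q) (X q) (dphi q) (dpsi q)
    (C q)).
Proof.
move=> Wp vC.
have vX := sh_field hX Wp; have vIX := vf_IX hg hX Wp.
have [vJX vKX] := (vf_JX Wp, vf_KX Wp).
have [sp sp1] := (smooth_dphi Wp, smooth_dpsi Wp).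
have sg := smooth_g Wp.
rewrite /deform_form_inv /qproj; apply: (vfieldZ hM).
  by apply: (smoothV hM) => //; exact: phi0.
apply: (vfieldB hM) => //; apply: (vfieldZ hM).
  apply: (smoothM hM) => //; apply: (smoothV hM); last exact: lam0.
  by apply: (smoothD hM) => //; apply: (smoothM hM) => //; apply: sg.
repeat first [ assumption | apply: sg | apply: (vfieldD hM) | apply: (vfieldZ hM)].
Qed.

Lemma deformed_nabla_connection : connection A W deformed_nabla.
Proof.
split.
- by move=> p v Z Wp; exact: deformed_nablaT.
- by move=> p t v w Z Wp; exact: deformed_nabla_linear.
- by move=> p v Y Z Wp; exact: deformed_nabla_add.
- by move=> p v h Z Wp; exact: deformed_nabla_leibniz.
move=> p Y Z Wp vY vZ; apply: (vfieldD hM); first exact: (vf_cov hg).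
exact: (vf_deform_form_inv Wp (vf_raw_correction Wp vY vZ)).
Qed.

End OneOrder.

Section Cyclic.
Variables (g : M -> vec -> vec -> R)
  (I J K : M -> vec -> vec) (nabla : M -> vec -> (M -> vec) -> vec).
Variable hg : HKT A W g I J K nabla.
Hypothesis hX : special_homothety A W g I J K X a b.
Let mu := homothety_potential g X a b.

Lemma deformed_metric_cyc :
  deformed_metric g J K I mu f = deformed_metric g I J K mu f.
Proof.
apply/funext => p; apply/funext => v; apply/funext => w.
by rewrite /deformed_metric /dH2; congr (_ + _ * _); ring.
Qed.

Lemma deformed_nabla_cyc p v Y : W p -> tangent A p v -> vfield_at A p Y ->
  deformed_nabla g J K I nabla p v Y = deformed_nabla g I J K nabla p v Y.
Proof.
move=> Wp Tv vY; congr (_ + _).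
apply: (correction_cyc (hkt_quat hM hg Wp) (hkt_nondeg hM hg Wp) (X_tangent hX Wp)
  (hkt_quat_torsion hM oW hg hX ha hab Wp)) => //.
exact: vfield_tangent.
Qed.

End Cyclic.

Section DeformedHKT.
Variables (g : M -> vec -> vec -> R)
  (I J K : M -> vec -> vec) (nabla : M -> vec -> (M -> vec) -> vec).
Variable hg : HKT A W g I J K nabla.
Hypothesis hX : special_homothety A W g I J K X a b.
Let hg' := hkt_cyc hM hg.
Let hg'' := hkt_cyc hM hg'.
Let hX' := special_homothety_cyc hX.
Let hX'' := special_homothety_cyc hX'.
Let mu := homothety_potential g X a b.
Hypothesis muE : forall p, W p -> E (mu p).
Hypothesis phi0 : forall p, W p -> derive1 f (mu p) != 0.
Hypothesis lam0 : forall p, W p ->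
  derive1 f (mu p) + dpsi g p * g p (X p) (X p) != 0.

Lemma deformed_HKT :
  HKT A W (deformed_metric g I J K mu f) I J K (deformed_nabla g I J K nabla).
Proof.
have q := gf_quat hg hX.
split.
- exact: hkt_hypercomplex hg.
- exact: (gf_pseudo_metric hg hX muE phi0 lam0).
- by move=> p v w Wp; exact: (qs_gI (q _ Wp)).
- by move=> p v w Wp; exact: (qs_gJ (q _ Wp)).
- by move=> p v w Wp; exact: (qs_gK (q _ Wp)).
split.
- exact: (deformed_nabla_connection hg hX muE phi0 lam0).
- by move=> p v Y Z Wp; exact: (deformed_nabla_parallel hg hX muE phi0 lam0).
- by move=> p v Y Wp; exact: (deformed_nabla_I hg hX).
- move=> p v Y Wp Tv vY; have vJY := vf_I hg' Wp vY.
  by rewrite -!(deformed_nabla_cyc hg hX) //; exact: (deformed_nabla_I hg' hX').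
- move=> p v Y Wp Tv vY; have vKY := vf_I hg'' Wp vY.
  rewrite -!(deformed_nabla_cyc hg hX) // -!(deformed_nabla_cyc hg' hX') //.
  exact: (deformed_nabla_I hg'' hX'').
- by move=> p V Y Z Wp; exact: (deformed_nabla_skew12 hg hX phi0 lam0).
- by move=> p V Y Z Wp; exact: (deformed_nabla_skew23 hg hX).
Qed.

End DeformedHKT.
End DeformedMetric.

(** * Lie derivatives of the deformed metric *)

Lemma bracket_alt (R : realType) (n : nat) (M : topologicalType)
  (A : set (chart R n M)) Y Z p : bracket A Y Z p = - bracket A Z Y p.
Proof.
apply/funext => h; rewrite fctE /bracket; case: asboolP => _; last by rewrite oppr0.
by rewrite opprB.
Qed.

Lemma bracket_self (R : realType) (n : nat) (M : topologicalType)
  (A : set (chart R n M)) Y p : bracket A Y Y p = 0.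
Proof.
by apply/funext => h; rewrite /bracket; case: asboolP => // _; rewrite subrr.
Qed.

Section DeformedHomothety.
Context {R : realType} {n : nat} {M : topologicalType}.
Variables (A : set (chart R n M)) (hM : smooth_manifold A).
Local Notation vec := ((M -> R) -> R).
Implicit Types (p q : M) (u v w z : vec) (Y Z : M -> vec).
Variables (W : set M) (oW : open W).
Variables (X : M -> vec) (a b : R) (ha : a != 0) (hab : a != b).
Let kappa := 2 / (a - b).
Variables (E : set R) (oE : open E) (f : R -> R) (Cf : Cinfty E f).

Section Brackets.
Variables (g : M -> vec -> vec -> R)
  (I J K : M -> vec -> vec) (nabla : M -> vec -> (M -> vec) -> vec).
Variable hg : HKT A W g I J K nabla.
Hypothesis hX : special_homothety A W g I J K X a b.

Lemma bracket_X_IX p : W p -> bracket A X (ap I X) p = 0.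
Proof.
move=> Wp; have qs := hkt_quat hM hg Wp; have Tx := X_tangent hX Wp.
have qt := hkt_quat_torsion hM oW hg hX ha hab Wp.
have TIx := qTI qs Tx; have vX := sh_field hX Wp; have vIX := vf_IX hg hX Wp.
have t0 : torsion_tensor hM nabla p (X p) (ap I X p) = 0.
  apply: (q_ext qs (hkt_nondeg hM hg Wp)) => [||w Tw].
  - exact: (torsion_tensorT hM hg).
  - exact: (qT0 qs).
  rewrite (q_g0l qs) // (qs_gsym qs) //; last exact: (torsion_tensorT hM hg).
  by rewrite (qt_skew qt) // (qt_x qt) // oppr0.
have := torsion_tensorE hM hg Wp vX vIX; rewrite t0 /torsion /cov.
rewrite (nabla_IX hM hg hX Wp Tx) (nabla_X hM hg hX Wp TIx) subrr sub0r => /eqP.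
by rewrite oppr_eq0 => /eqP.
Qed.

End Brackets.

Section OneOrder.
Variables (g : M -> vec -> vec -> R)
  (I J K : M -> vec -> vec) (nabla : M -> vec -> (M -> vec) -> vec).
Variable hg : HKT A W g I J K nabla.
Hypothesis hX : special_homothety A W g I J K X a b.
Let hg' := hkt_cyc hM hg.
Let hg'' := hkt_cyc hM hg'.
Let hX' := special_homothety_cyc hX.
Let hX'' := special_homothety_cyc hX'.
Let mu := homothety_potential g X a b.
Hypothesis muE : forall p, W p -> E (mu p).

Local Notation gf := (deformed_metric g I J K mu f).
Local Notation phi := (dphi X a b f g).
Local Notation psi := (dpsi X a b f g).
Local Notation qf p := (qform (g p) (I p) (J p) (K p) (X p)).

Lemma d_phi p v : W p -> tangent A p v -> v phi = (a - b) * psi p * g p (X p) v.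
Proof. exact: (d_dphi hM ha hab oE Cf hg hX). Qed.

Lemma d_psi p v : W p -> tangent A p v -> v psi = dpsi1 X a b f g p * g p (X p) v.
Proof. exact: (d_dpsi hM ha hab oE Cf hg hX). Qed.

(** The forms g (q X) of which the deformed metric is made have Lie derivative
    t g (q X) + g [Xi, q X]. *)
Lemma lie_deformed (Xi : M -> vec) t p Y Z : vfield_on A W Xi ->
  lie_metric A W Xi g t -> W p -> vfield_at A p Y -> vfield_at A p Z ->
  let br (F : M -> vec) := bracket A Xi F p in
  let al (F : M -> vec) V := g p (F p) (V p) in
  let be (F : M -> vec) V := t * al F V + g p (br F) (V p) in
  Xi p (fun q => gf q (Y q) (Z q)) - gf p (bracket A Xi Y p) (Z p)
    - gf p (Y p) (bracket A Xi Z p) =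
  (Xi p phi + t * phi p) * g p (Y p) (Z p) + Xi p psi * qf p (Y p) (Z p)
  + psi p * ((be X Y * al X Z + al X Y * be X Z)
    + (be (ap I X) Y * al (ap I X) Z + al (ap I X) Y * be (ap I X) Z)
    + (be (ap J X) Y * al (ap J X) Z + al (ap J X) Y * be (ap J X) Z)
    + (be (ap K X) Y * al (ap K X) Z + al (ap K X) Y * be (ap K X) Z)).
Proof.
move=> vXi lXi Wp vY vZ /=.
have [TY TZ] := (vfield_tangent vY, vfield_tangent vZ).
have vXip := vXi _ Wp; have Tv := vfield_tangent vXip.
have qs := hkt_quat hM hg Wp.
have vX := sh_field hX Wp; have vIX := vf_IX hg hX Wp.
have [vJX vKX] := (vf_IX hg' hX' Wp, vf_IX hg'' hX'' Wp).
have bT F : vfield_at A p F -> tangent A p (bracket A Xi F p).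
  by move=> vF; exact: (bracket_tangent hM vXip vF).
have [TbY TbZ] := (bT _ vY, bT _ vZ).
have sg F G : vfield_at A p F -> vfield_at A p G ->
    smooth_at A p (fun q => g q (F q) (G q)).
  exact: (pm_smooth (hkt_metric hg)).
have lie F G : vfield_at A p F -> vfield_at A p G -> Xi p (fun q => g q (F q) (G q)) =
    t * g p (F p) (G p) + g p (bracket A Xi F p) (G p) + g p (F p) (bracket A Xi G p).
  by move=> vF vG; rewrite -(lXi _ _ _ Wp vF vG); ring.
rewrite (@tangent_near _ _ _ _ hM _ _ _ (fun q => deform_form (g q) (I q) (J q) (K q) (X q)
   (phi q) (psi q) (Y q) (Z q)) Tv); last first.
  apply: filterS3 (near_W oW Wp) vY vZ => q Wq [TYq _] [TZq _].
  exact: (deformed_metric_formE hM ha hab f hg hX).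
rewrite !(deformed_metric_formE hM ha hab f hg hX Wp) //.
have sphi := smooth_dphi hM oE Cf hg hX muE Wp.
have spsi := smooth_dpsi hM oE Cf hg hX muE Wp.
have dq F : vfield_at A p F -> Xi p (fun q => g q (F q) (Y q) * g q (F q) (Z q)) =
  Xi p (fun q => g q (F q) (Y q)) * g p (F p) (Z p)
  + g p (F p) (Y p) * Xi p (fun q => g q (F q) (Z q)).
  by move=> vF; rewrite (tangent_mul hM Tv (sg _ _ vF vY) (sg _ _ vF vZ)).
have sq F : vfield_at A p F -> smooth_at A p (fun q => g q (F q) (Y q) * g q (F q) (Z q)).
  by move=> vF; exact: (smoothM hM (sg _ _ vF vY) (sg _ _ vF vZ)).
have s12 := smoothD hM (sq _ vX) (sq _ vIX).
have s123 := smoothD hM s12 (sq _ vJX).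
have s1234 := smoothD hM s123 (sq _ vKX).
have sp := smoothM hM sphi (sg _ _ vY vZ).
have sps := smoothM hM spsi s1234.
rewrite {1}/deform_form {1}/qform.
rewrite (tangent_add hM Tv sp sps) (tangent_mul hM Tv sphi (sg _ _ vY vZ)).
rewrite (tangent_mul hM Tv spsi s1234).
rewrite (tangent_add hM Tv s123 (sq _ vKX)) (tangent_add hM Tv s12 (sq _ vJX)).
rewrite (tangent_add hM Tv (sq _ vX) (sq _ vIX)) !dq // !lie //.
rewrite /deform_form /qform /ap.
move: (Xi p phi) (Xi p psi) (phi p) (psi p) => c1 c2 c3 c4; ring.
Qed.

(** X commutes with IX, JX, KX, and X mu = a mu. *)
Lemma lie_deformed_X p Y Z : W p -> vfield_at A p Y -> vfield_at A p Z ->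
  X p (fun q => gf q (Y q) (Z q)) - gf p (bracket A X Y p) (Z p)
    - gf p (Y p) (bracket A X Z p) =
  (a * mu p * derive1n 2 f (mu p) + a * derive1 f (mu p)) * g p (Y p) (Z p)
  + 2^-1 * kappa ^+ 2 * (a * mu p * derive1n 3 f (mu p) + 2 * a * derive1n 2 f (mu p))
     * qf p (Y p) (Z p).
Proof.
move=> Wp vY vZ; have qs := hkt_quat hM hg Wp; have Tx := X_tangent hX Wp.
have := lie_deformed (sh_field hX) (sh_g hX) Wp vY vZ; cbv zeta => ->.
rewrite bracket_self (bracket_X_IX hg hX) // (bracket_X_IX hg' hX') //.
rewrite (bracket_X_IX hg'' hX'') // (d_phi Wp) // (d_psi Wp) //.
have [TY TZ] := (vfield_tangent vY, vfield_tangent vZ).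
rewrite !(q_g0l qs) // /dphi /dpsi /dpsi1 -/mu.
have muE' : g p (X p) (X p) = a * (a - b) / 2 * mu p.
  by rewrite /mu /homothety_potential; field; rewrite ha subr_eq0 hab.
rewrite muE' /qform /ap /kappa.
move: (mu p) (derive1 f (mu p)) (derive1n 2 f (mu p)) (derive1n 3 f (mu p)) => m f1 f2 f3. 
by field; rewrite subr_eq0.
Qed.

(** IX annihilates mu, commutes with X and IX, and rotates JX and KX into each
    other, which preserves the sum of their squares. *)
Lemma lie_deformed_IX : lie_metric A W (ap I X) gf 0.
Proof.
move=> p Y Z Wp vY vZ; have qs := hkt_quat hM hg Wp; have Tx := X_tangent hX Wp.
have vIX : vfield_on A W (ap I X) by move=> q; exact: (vf_IX hg hX).
have := lie_deformed vIX (sh_Ig hX) Wp vY vZ; cbv zeta => ->.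
have [TY TZ] := (vfield_tangent vY, vfield_tangent vZ).
have TIx := qTI qs Tx; have vX := sh_field hX Wp.
have [TJx TKx] := (qTJ qs Tx, qTK qs Tx).
have bX : bracket A (ap I X) X p = 0.
  by rewrite bracket_alt (bracket_X_IX hg hX) // oppr0.
have bJ : bracket A (ap I X) (ap J X) p = b *: K p (X p).
  have /eqP := sh_IJ hX Wp vX; rewrite bX.
  by rewrite (qI0 (quat_space_cyc qs)) subr0 => /eqP.
have bK : bracket A (ap I X) (ap K X) p = - (b *: J p (X p)).
  have bKX : bracket A (ap K X) X p = 0.
    by rewrite bracket_alt (bracket_X_IX hg'' hX'') // oppr0.
  have /eqP := sh_KI hX Wp vX; rewrite bKX (qI0 qs) subr0 => /eqP bKI.
  by rewrite bracket_alt bKI.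
rewrite bX bJ bK bracket_self (d_phi Wp) // (d_psi Wp) //.
have TbJ := qTZ qs b TJx.
rewrite !(q_g0l qs) // !(q_gNl qs) // !(q_gZl qs) // (q_gqr qs) // (q_gid qs) //.
rewrite /ap; ring.
Qed.

End OneOrder.

(** The two equations say that the two coefficients in lie_deformed_X are those
    of a' g_f; the conditions on I, J, K do not involve the metric. *)
Lemma deformed_special_homothety (g : M -> vec -> vec -> R)
  (I J K : M -> vec -> vec) (nabla : M -> vec -> (M -> vec) -> vec)
  (hg : HKT A W g I J K nabla) (hX : special_homothety A W g I J K X a b)
  (mu := homothety_potential g X a b) (a' : R) : 
  (forall p, W p -> E (mu p)) ->
  (forall p, W p -> a * mu p * derive1n 2 f (mu p) + a * derive1 f (mu p)
    = a' * derive1 f (mu p)) ->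
  (forall p, W p -> a * mu p * derive1n 3 f (mu p) + 2 * a * derive1n 2 f (mu p)
    = a' * derive1n 2 f (mu p)) ->
  special_homothety A W (deformed_metric g I J K mu f) I J K X a' b.
Proof.
move=> muE h1 h2; have hg' := hkt_cyc hM hg; have hg'' := hkt_cyc hM hg'.
have hX' := special_homothety_cyc hX; have hX'' := special_homothety_cyc hX'.
split; try by case: hX.
- move=> p Y Z Wp vY vZ; have [TY TZ] := (vfield_tangent vY, vfield_tangent vZ).
  rewrite (lie_deformed_X hg hX muE Wp vY vZ).
  rewrite (deformed_metric_formE hM ha hab f hg hX Wp) //
    /deform_form /dphi /dpsi -/mu -/kappa.
  move: (h1 _ Wp) (h2 _ Wp); move: kappa (mu p) => k m.
  move: (derive1 f m) (derive1n 2 f m) (derive1n 3 f m) => f1 f2 f3 -> ->; ring.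
- exact: (lie_deformed_IX hg hX muE).
- rewrite -(deformed_metric_cyc X a b f g I J K); exact: (lie_deformed_IX hg' hX' muE).
- rewrite -(deformed_metric_cyc X a b f g I J K) -(deformed_metric_cyc X a b f g J K I).
  exact: (lie_deformed_IX hg'' hX'' muE).
Qed.

End DeformedHomothety.

(** * Powers and logarithm of the absolute value *)

Section AbsPow.
Context {R : realType}.
Implicit Types (k t : R).

Lemma near_gt0_norm t : 0 < t -> \forall y \near t, y = `|y|.
Proof.
move=> t0; have : \forall y \near t, 0 < y by exact: lt_nbhsr.
by apply: filterS => y y0; rewrite gtr0_norm.
Qed.

Lemma near_lt0_norm t : t < 0 -> \forall y \near t, - y = `|y|.
Proof.
move=> t0; have : \forall y \near t, y < 0 by exact: lt_nbhsl.
by apply: filterS => y y0; rewrite ltr0_norm.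
Qed.

Lemma is_derive_norm (F d : R -> R) t : t != 0 ->
  (forall y : R, 0 < y -> is_derive y 1 F (d y)) ->
  is_derive t 1 (fun y : R => F `|y| : R) (Num.sg t * d `|t|).
Proof.
move=> t0 dF; have [tn|tp|tE] := ltgtP t 0; last by rewrite tE eqxx in t0.
- apply: (@near_eq_is_derive _ _ _ (fun y : R => F (- y) : R)).
    by apply: filterS (near_lt0_norm tn) => y <-.
  rewrite ltr0_sg // ltr0_norm //.
  rewrite mulrC; apply: (@is_derive1_comp _ F -%R t (d (- t)) (-1)).
  by apply: dF; rewrite oppr_gt0.
- apply: (@near_eq_is_derive _ _ _ F).
    by apply: filterS (near_gt0_norm tp) => y <-.
  by rewrite gtr0_sg // gtr0_norm // mul1r; exact: dF.
Qed.

Lemma sg_invr_norm t : t != 0 -> Num.sg t * `|t|^-1 = t^-1.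
Proof.
move=> t0; have [tn|tp|tE] := ltgtP t 0; last by rewrite tE eqxx in t0.
- by rewrite ltr0_sg // ltr0_norm // invrN mulrNN mul1r.
- by rewrite gtr0_sg // gtr0_norm // mul1r.
Qed.

Lemma is_derive_abs_pow k t : t != 0 ->
  is_derive t 1 (abs_pow k) (k * (abs_pow k t * t^-1)).
Proof.
move=> t0; have t0' : `|t| != 0 by rewrite normr_eq0.
have := @is_derive_norm (fun y => y `^ k) (fun y => k * y `^ (k - 1)) t t0.
move=> /(_ (fun y y0 => is_derive1_powR k y0)) H.
apply: (is_derive_eq H); rewrite powRB; last by rewrite t0' implybT.
by rewrite powRr1 // -(sg_invr_norm t0) /abs_pow; ring.
Qed.

Lemma is_derive_log_abs t : t != 0 -> is_derive t 1 log_abs t^-1.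
Proof.
move=> t0; have := @is_derive_norm (@ln R) GRing.inv t t0.
move=> /(_ (fun y y0 => is_derive1_ln y0)) H.
by apply: (is_derive_eq H); rewrite sg_invr_norm.
Qed.

Lemma is_derive_differentiable (f : R -> R) t d : is_derive t 1 f d -> differentiable f t.
Proof. by move=> [df _]; exact/derivable1_diffP. Qed.

Lemma derive_linear1 (f : R -> R) t d u : is_derive t 1 f d -> 'D_u f t = u * d.
Proof.
move=> df; have dif := is_derive_differentiable df.
rewrite deriveE // -[X in 'd f t X]mulr1 [LHS]linearZ /= -deriveE //.
by have [_ ->] := df.
Qed.

Lemma open_neq0 : open [set t : R | t != 0]. Proof. exact: open_neq. Qed.

Lemma Cinfty_abs_pow k : Cinfty [set t : R | t != 0] (abs_pow k).
Proof.
move=> j; elim: j => [//|j IH]; split=> [t t0|u].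
  exact: is_derive_differentiable (is_derive_abs_pow k t0).
apply: (@Ck_eq _ _ _ _ (fun t : R => (u * k) * (abs_pow k t * t^-1)) _ open_neq0).
  by move=> t t0; rewrite (derive_linear1 _ (is_derive_abs_pow k t0)) -mulrA.
apply: (CkM open_neq0); first exact: Ck_cst.
by apply: (CkM open_neq0) => //; exact: Ck_inv.
Qed.

Lemma Cinfty_log_abs : Cinfty [set t : R | t != 0] log_abs.
Proof.
move=> [//|j]; split=> [t t0|u].
  exact: is_derive_differentiable (is_derive_log_abs t0).
apply: (@Ck_eq _ _ _ _ (fun t : R => u * t^-1) _ open_neq0).
  by move=> t t0; rewrite (derive_linear1 _ (is_derive_log_abs t0)).
by apply: (CkM open_neq0); [exact: Ck_cst|exact: Ck_inv].
Qed.

(** A family closed under derivation that contains the derivatives of both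
    abs_pow and log_abs, the latter with k = 0. *)
Definition spow c k m t : R := c * (abs_pow k t * t^-1 ^+ m).

Lemma is_derive_spow c k m t : t != 0 ->
  is_derive t 1 (spow c k m) (spow (c * (k - m%:R)) k m.+1 t).
Proof.
move=> t0; have da := is_derive_abs_pow k t0.
have di : is_derive t 1 (fun y : R => y^-1) (- t ^- 2).
  have := @is_deriveV R id t 1 1 t0 (is_derive_id t 1).
  move=> H; apply: (is_derive_eq H); exact: mulr1.
have dX := is_deriveX m di.
have dM := is_deriveM da dX.
have dc := is_deriveZ c dM.
have -> : spow c k m = c \*: (abs_pow k * (fun y : R => y^-1) ^+ m).
  by apply/funext => y; rewrite /spow !fctE.
apply: (is_derive_eq dc).
rewrite /spow /GRing.scale /= exprfctE -exprVn.
case: m {dX dM dc} => [|m] /=; first by ring.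
by rewrite !exprS; ring.
Qed.

Lemma derive1_spow (f : R -> R) c k m t : t != 0 ->
  (forall y, y != 0 -> f y = spow c k m y) ->
  derive1 f t = spow (c * (k - m%:R)) k m.+1 t.
Proof.
move=> t0 fE; rewrite derive1E.
rewrite (@near_eq_derive _ _ _ _ (spow c k m)); last first.
  by apply: near_open open_neq0 t0 _ => y y0; exact: fE.
by have [_ ->] := is_derive_spow c k m t0.
Qed.

End AbsPow.

(** * Restriction to open subsets and locally constant functions *)

Section Restriction.
Context {R : realType} {n : nat} {M : topologicalType}.
Variables (A : set (chart R n M)) (W W' : set M) (WW' : W `<=` W').
Local Notation vec := ((M -> R) -> R).

Lemma endo_on_sub (J : M -> vec -> vec) : endo_on A W' J -> endo_on A W J.
Proof. by case=> h1 h2 h3; split=> *; [apply: h1|apply: h2|apply: h3]; auto. Qed.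

Lemma complex_structure_sub (J : M -> vec -> vec) :
  complex_structure A W' J -> complex_structure A W J.
Proof.
case=> h1 h2 h3; split; first exact: endo_on_sub.
- by move=> p v /WW'; exact: h2.
- by move=> p Y Z /WW'; exact: h3.
Qed.

Lemma HKT_sub g I J K nabla : HKT A W' g I J K nabla -> HKT A W g I J K nabla.
Proof.
case=> [[cI cJ cK h1 h2] [m1 m2 m3 m4] hI hJ hK [[c1 c2 c3 c4 c5] k1 k2 k3 k4 k5 k6]].
split.
- split; do ?exact: complex_structure_sub.
  + by move=> p v /WW'; exact: h1.
  + by move=> p v /WW'; exact: h2.
- split.
  + by move=> p t u v w /WW'; exact: m1.
  + by move=> p v w /WW'; exact: m2.
  + by move=> p Y Z /WW'; exact: m3.
  + by move=> p /WW'; exact: m4.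
- by move=> p v w /WW'; exact: hI.
- by move=> p v w /WW'; exact: hJ.
- by move=> p v w /WW'; exact: hK.
split.
- split.
  + by move=> p v Z /WW'; exact: c1.
  + by move=> p t v w Z /WW'; exact: c2.
  + by move=> p v Y Z /WW'; exact: c3.
  + by move=> p v h Z /WW'; exact: c4.
  + by move=> p Y Z /WW'; exact: c5.
- by move=> p v Y Z /WW'; exact: k1.
- by move=> p v Y /WW'; exact: k2.
- by move=> p v Y /WW'; exact: k3.
- by move=> p v Y /WW'; exact: k4.
- by move=> p V Y Z /WW'; exact: k5.
- by move=> p V Y Z /WW'; exact: k6.
Qed.

Lemma special_homothety_sub g I J K X a b :
  special_homothety A W' g I J K X a b -> special_homothety A W g I J K X a b.
Proof.
case=> h1 h2 h3 h4 h5 h6 h7 h8 h9 h10 h11; split.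
- by move=> p /WW'; exact: h1.
- by move=> p Y Z /WW'; exact: h2.
- by move=> p Y Z /WW'; exact: h3.
- by move=> p Y Z /WW'; exact: h4.
- by move=> p Y Z /WW'; exact: h5.
- by move=> p Y /WW'; exact: h6.
- by move=> p Y /WW'; exact: h7.
- by move=> p Y /WW'; exact: h8.
- by move=> p Y /WW'; exact: h9.
- by move=> p Y /WW'; exact: h10.
- by move=> p Y /WW'; exact: h11.
Qed.

End Restriction.

Section LocallyConstant.
Context {R : realType} {n : nat} {M : topologicalType}.
Variables (A : set (chart R n M)) (hM : smooth_manifold A).

Lemma locally_cst_component (T : Type) (F : M -> T) (U : set M) p q :
  (forall r, U r -> \forall s \near r, F s = F r) ->
  connected_component U p q -> F q = F p.
Proof.
move=> lc Cq; have [Up|nUp] := pselect (U p); last first.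
  by move: Cq; rewrite connected_component_out.
pose C := connected_component U p.
have sCU : C `<=` U by exact: connected_component_sub.
pose B := C `&` [set r | F r = F p].
have BC : B = C; last by have [_] : B q by rewrite BC.
apply: (@component_connected _ U p).
- by exists p; split=> //; exact: connected_component_refl.
- exists ([set r | F r = F p]^°); first exact: open_interior.
  apply/seteqP; split=> r [Cr Fr]; split=> //.
    apply: filterS (lc _ (sCU _ Cr)) => s sr /=; by rewrite sr.
  exact: (interior_subset Fr).
exists (~` ([set r | F r <> F p]^°)).
  by rewrite closedC; exact: open_interior.
apply/seteqP; split=> r [Cr Fr]; split=> //.
  by move=> /interior_subset; apply.
apply: contrapT => nF; apply: Fr.
by apply: filterS (lc _ (sCU _ Cr)) => s sr /=; rewrite sr.
Qed.

(** In a chart this is the mean value theorem on a ball. *)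
Lemma zero_differential_locally_cst (U : set M) (F : M -> R) q : open U -> U q ->
  (forall r, U r -> smooth_at A r F) ->
  (forall r v, U r -> tangent A r v -> v F = 0) -> \forall r \near q, F r = F q.
Proof.
move=> oU Uq sF dF; have [c Ac cq] := atlas_cover hM q.
have ic := atlas_chart hM Ac.
have [D [oD Dq Di Cf]] := smooth_chart hM Ac cq (sF _ Uq).
have [E [oE Eq EU]] := nearP_open (near_chart_inv hM Ac cq
  (open_nbhs_nbhs (conj oU Uq))).
have dDE x : (D `&` E) x -> differentiable (F \o chart_inv c) x.
  by move=> [Dx _]; have [+ _] := Cf 1%N; exact.
have zero x u : (D `&` E) x -> 'D_u (F \o chart_inv c) x = 0.
  move=> [Dx Ex]; have [cx xK] := chart_imgK hM Ac (Di _ Dx).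
  have Ux := EU _ Ex; rewrite -[x in LHS]xK -(chart_vecE _ _ (sF _ Ux)).
  by apply: (dF _ _ Ux); exact: tangent_chart_vec.
have := derive0_locally_cst (openI oD oE) (conj Dq Eq) dDE zero.
move=> /(near_chart hM Ac cq); apply: filterS2 (near_chart_dom hM Ac cq) => r cr /=.
by rewrite (chart_mapK ic cr) (chart_mapK ic cq).
Qed.

End LocallyConstant.

(** * The deformations by powers and the logarithm, and their uniqueness *)

Section Deformations.
Context {R : realType} {n : nat} {M : topologicalType}.
Variables (A : set (chart R n M)) (hM : smooth_manifold A).
Local Notation vec := ((M -> R) -> R).
Implicit Types (p q : M) (u v w z : vec) (Y Z : M -> vec).
Variables (g : M -> vec -> vec -> R)
  (I J K : M -> vec -> vec) (nabla : M -> vec -> (M -> vec) -> vec).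
Variables (hg : HKT A setT g I J K nabla) (X : M -> vec) (a b : R).
Hypothesis hX : special_homothety A setT g I J K X a b.
Hypotheses (ha : a != 0) (hab : a != b).
Let mu := homothety_potential g X a b.
Let U := [set p | mu p != 0].
Let kappa := 2 / (a - b).
Let gdef := deformed_metric g I J K mu.

Lemma smooth_mu p : smooth_at A p mu.
Proof. by apply: (smooth_potential hM hg hX). Qed.

Lemma open_U : open U.
Proof.
rewrite openE => p Up; have cmu := smooth_continuous hM (smooth_mu p).
exact: (cmu _ (open_nbhs_nbhs (conj open_neq0 Up))).
Qed.

Let hgU : HKT A U g I J K nabla := HKT_sub (@subsetT _ U) hg.
Let hXU : special_homothety A U g I J K X a b := special_homothety_sub (@subsetT _ U) hX.

Lemma normX p : g p (X p) (X p) = a * (a - b) / 2 * mu p.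
Proof. by rewrite /mu /homothety_potential; field; rewrite ha subr_eq0 hab. Qed.

Lemma normX_neq0 p : U p -> g p (X p) (X p) != 0.
Proof.
rewrite /U /= => m0; have ab0 : a - b != 0 by rewrite subr_eq0.
by rewrite normX mulf_neq0 // mulf_neq0 ?invr_eq0 ?pnatr_eq0 // mulf_neq0.
Qed.

(** The equation for I is cyclically symmetric, and so is the deformed metric. *)
Lemma deformed_fpotential (W : set M) (E : set R) (f : R -> R) :
  open W -> open E -> Cinfty E f -> (forall p, W p -> E (mu p)) ->
  HKT_potential A W (f \o mu) (gdef f) I J K.
Proof.
move=> oW oE Cf muE.
have hgW := HKT_sub (@subsetT _ W) hg.
have hXW := special_homothety_sub (@subsetT _ W) hX.
have hgW' := hkt_cyc hM hgW; have hgW'' := hkt_cyc hM hgW'.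
have hXW' := special_homothety_cyc hXW; have hXW'' := special_homothety_cyc hXW'.
split.
- exact: (smooth_fpotential hM hgW hXW oE Cf muE).
- exact: (fpotential_eq hM oW hgW hXW ha hab oE Cf muE).
- have := fpotential_eq hM oW hgW' hXW' ha hab oE Cf muE.
  by rewrite (deformed_metric_cyc X a b f g I J K).
- have := fpotential_eq hM oW hgW'' hXW'' ha hab oE Cf muE.
  by rewrite (deformed_metric_cyc X a b f g J K I) (deformed_metric_cyc X a b f g I J K).
Qed.

Lemma deformed_metric_id : gdef id = g.
Proof.
apply/funext => p; apply/funext => v; apply/funext => w.
rewrite /gdef /deformed_metric derive1_id mul1r.
have -> : derive1n 2 (id : R -> R) (mu p) = 0.
  rewrite /derive1n /= (_ : derive1 id = cst 1) ?derive1_cst //.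
  by apply/funext => t; rewrite derive1_id.
by rewrite mulr0 mul0r addr0.
Qed.

Lemma mu_potential : HKT_potential A setT mu g I J K.
Proof.
have Cid : Cinfty setT (id : R -> R).
  move=> [//|k]; split=> [t _|u]; first exact: ex_diff.
  by under eq_fun do rewrite derive_id; exact: Ck_cst.
by have := deformed_fpotential openT openT Cid (fun p _ => Logic.I);
  rewrite deformed_metric_id.
Qed.

(** For f' = c |t|^k / t one has t f'' = (k - 1) f', whence the homothety equations
    with a' = k a, and the factor f' + a / (a - b) t f'' of g_f on the quaternionic
    line of X is f' (k a - b) / (a - b). *)
Lemma spow_deformation (f : R -> R) (c k : R) : c != 0 -> k * a != b ->
  Cinfty [set t : R | t != 0] f ->
  (forall t, t != 0 -> derive1 f t = spow c k 1 t) ->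
  deformation_on A U g I J K X mu f (k * a) b.
Proof.
move=> c0 kab Cf f1.
have f2 t : t != 0 -> derive1n 2 f t = spow (c * (k - 1)) k 2 t.
  by move=> t0; rewrite /derive1n /= (derive1_spow t0 f1).
have f3 t : t != 0 -> derive1n 3 f t = spow (c * (k - 1) * (k - 2)) k 3 t.
  by move=> t0; rewrite -[derive1n 3 f]/(derive1 (derive1n 2 f)) (derive1_spow t0 f2).
have sp0 t : t != 0 -> abs_pow k t != 0.
  by move=> t0; rewrite gt_eqF // powR_gt0 // normr_gt0.
split.
- eexists; apply: (deformed_HKT hM open_U ha hab open_neq0 Cf hgU hXU) => //.
    move=> p Up; rewrite f1 // /spow expr1.
    by rewrite !mulf_neq0 ?invr_eq0 // sp0.
  move=> p Up; rewrite /dpsi -/mu f1 // f2 // normX.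
  rewrite [X in X != 0](_ : _ = c * (abs_pow k (mu p) / mu p) * (k * a - b) / (a - b)).
    by rewrite !mulf_neq0 ?invr_eq0 ?subr_eq0 // sp0.
  rewrite /spow; field; rewrite subr_eq0 hab; exact: Up.
- exact: (deformed_fpotential open_U open_neq0 Cf).
apply: (deformed_special_homothety hM open_U ha hab open_neq0 Cf hgU hXU) => //.
- by move=> p Up; rewrite f1 // f2 // /spow; field; exact: Up.
- by move=> p Up; rewrite f2 // f3 // /spow; field; exact: Up.
Qed.

Lemma derive1_abs_pow (k t : R) : t != 0 -> derive1 (abs_pow k) t = spow k k 1 t.
Proof.
by move=> t0; rewrite derive1E; have [_ ->] := is_derive_abs_pow k t0; rewrite /spow expr1.
Qed.

Lemma derive1_log_abs (t : R) : t != 0 -> derive1 log_abs t = spow 1 0 1 t.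
Proof.
move=> t0; rewrite derive1E; have [_ ->] := is_derive_log_abs t0.
by rewrite /spow /abs_pow powRr0 expr1 !mul1r.
Qed.

(** The deformed metric of a function with derivative |t|^k / t, which is
    proportional to that of |t|^k, and that of log |t| for k = 0. *)
Definition model_metric (k : R) : M -> vec -> vec -> R := fun q =>
  deform_form (g q) (I q) (J q) (K q) (X q) (spow 1 k 1 (mu q))
    (2^-1 * spow (k - 1) k 2 (mu q) * kappa ^+ 2).

Lemma gdefE f q v w : U q -> tangent A q v -> tangent A q w ->
  gdef f q v w = deform_form (g q) (I q) (J q) (K q) (X q) (derive1 f (mu q))
    (2^-1 * derive1n 2 f (mu q) * kappa ^+ 2) v w.
Proof. by move=> Uq; exact: (deformed_metricE hM hgU hXU ha hab f Uq). Qed.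

Lemma gdef_abs_pow k q v w : U q -> tangent A q v -> tangent A q w ->
  gdef (abs_pow k) q v w = k * model_metric k q v w.
Proof.
move=> Uq Tv Tw; rewrite gdefE // derive1_abs_pow //.
rewrite -[derive1n 2 _]/(derive1 (derive1 (abs_pow k))).
rewrite (derive1_spow Uq (@derive1_abs_pow k)) /model_metric /deform_form /spow.
move: kappa (mu q) => r m; ring.
Qed.

Lemma gdef_log_abs q v w : U q -> tangent A q v -> tangent A q w ->
  gdef log_abs q v w = model_metric 0 q v w.
Proof.
move=> Uq Tv Tw; rewrite gdefE // derive1_log_abs //.
rewrite -[derive1n 2 _]/(derive1 (derive1 log_abs)).
rewrite (derive1_spow Uq derive1_log_abs) /model_metric /deform_form /spow.
move: kappa (mu q) => r m; ring.
Qed.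

(** Separation of variables: u mu |mu|^-k has zero differential. *)
Lemma homogeneous_on_component (u u1 : M -> R) (k : R) p :
  (forall q, U q -> smooth_at A q u) ->
  (forall q v, U q -> tangent A q v -> v u = u1 q * v mu) ->
  (forall q, U q -> mu q * u1 q + u q = k * u q) ->
  U p -> u p != 0 -> exists2 c, c != 0 &
    forall q, connected_component U p q -> u q = c * spow 1 k 1 (mu q).
Proof.
move=> su du ode Up u0.
have ab0 q : U q -> abs_pow k (mu q) != 0.
  by move=> Uq; rewrite gt_eqF // powR_gt0 // normr_gt0.
have abN q : abs_pow (- k) (mu q) = (abs_pow k (mu q))^-1 by exact: powRN.
pose F q := u q * (mu q * abs_pow (- k) (mu q)).
have sa q : U q -> smooth_at A q (fun r => abs_pow (- k) (mu r)).
  by move=> Uq; exact: (smooth_comp hM open_neq0 (Cinfty_abs_pow (- k)) Uq (smooth_mu q)).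
have sma q : U q -> smooth_at A q (fun r => mu r * abs_pow (- k) (mu r)).
  by move=> Uq; exact: (smoothM hM (smooth_mu q) (sa _ Uq)).
have sF q : U q -> smooth_at A q F.
  by move=> Uq; exact: (smoothM hM (su _ Uq) (sma _ Uq)).
have dF q v : U q -> tangent A q v -> v F = 0.
  move=> Uq Tv; rewrite (tangent_mul hM Tv (su _ Uq) (sma _ Uq)).
  rewrite (tangent_mul hM Tv (smooth_mu q) (sa _ Uq)) (du _ _ Uq Tv).
  rewrite (tangent_comp hM open_neq0 (Cinfty_abs_pow (- k)) Uq Tv (smooth_mu q)).
  rewrite derive1_abs_pow //.
  have -> : u1 q = (k * u q - u q) / mu q.
    by rewrite -(ode _ Uq) addrK mulrAC mulfV // mul1r.
  by rewrite /spow; field; exact: Uq.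
have cF q : connected_component U p q -> F q = F p.
  apply: locally_cst_component => r Ur.
  exact: (zero_differential_locally_cst hM open_U Ur).
exists (F p).
  by rewrite /F abN mulf_neq0 // mulf_neq0 // invr_eq0; exact: ab0.
move=> q Cq; have Uq : U q := connected_component_sub Cq.
rewrite -(cF _ Cq) /F abN /spow.
by field; rewrite ab0 // andbT; exact: Uq.
Qed.

Section Converse.
Variables (D : set R) (f : R -> R) (a' b' : R) (oD : open D).
Hypotheses (muD : forall p, U p -> D (mu p)) (Cf : Cinfty D f).
Hypothesis hdef : deformation_on A U g I J K X mu f a' b'.

Let qsU q : U q -> quat_space (tangent A q) (g q) (I q) (J q) (K q).
Proof. exact: (hkt_quat hM hgU). Qed.

Lemma converse_nondeg q : U q -> nondeg_on (g := gdef f q) (tangent A q).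
Proof. by move=> Uq; case: hdef => -[nb hgf] _ _; exact: (hkt_nondeg hM hgf Uq). Qed.

Lemma X_neq0 q : U q -> X q != 0.
Proof.
move=> Uq; have qs := qsU Uq; apply: contraTneq Uq => X0.
rewrite /U /= negbK; have := normX q; rewrite X0 (q_g0l qs); last exact: (qT0 qs).
move=> /esym/eqP; rewrite !mulf_eq0 invr_eq0 subr_eq0 (negbTE ha) (negbTE hab).
by rewrite pnatr_eq0.
Qed.

(** The Lie derivative of J along IX does not involve the metric; it is compared
    on X, which does not vanish on U. *)
Lemma converse_b q : U q -> b' = b.
Proof.
move=> Uq; have qs := qsU Uq; have vX := sh_field hXU Uq.
have Tx := vfield_tangent vX; have TK := qTK qs Tx.
case: hdef => _ _ sh; have := sh_IJ sh Uq vX; rewrite (sh_IJ hXU Uq vX).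
move=> /eqP; rewrite eq_sym -subr_eq0 -scalerBl scaler_eq0 subr_eq0 => /orP[/eqP //|].
move=> /eqP K0; have := qs_KK qs Tx; rewrite K0.
rewrite (qI0 (quat_space_cyc (quat_space_cyc qs))) => /esym/eqP.
by rewrite oppr_eq0 (negbTE (X_neq0 Uq)).
Qed.

Lemma converse_lie q y z : U q -> tangent A q y -> tangent A q z ->
  (a * mu q * derive1n 2 f (mu q) + a * derive1 f (mu q)) * g q y z
  + 2^-1 * kappa ^+ 2 * (a * mu q * derive1n 3 f (mu q) + 2 * a * derive1n 2 f (mu q))
     * qform (g q) (I q) (J q) (K q) (X q) y z =
  a' * (derive1 f (mu q) * g q y z + 2^-1 * derive1n 2 f (mu q) * kappa ^+ 2
     * qform (g q) (I q) (J q) (K q) (X q) y z).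
Proof.
move=> Uq Ty Tz; have [[Y vY Yy] [Z vZ Zz]] := (tangent_extend hM Ty, tangent_extend hM Tz).
case: hdef => _ _ sh; have := sh_g sh Uq vY vZ.
rewrite (lie_deformed_X hM open_U ha hab oD Cf hgU hXU muD Uq vY vZ).
rewrite -/(gdef f q) gdefE ?Yy ?Zz //.
Qed.

Let h q := derive1 f (mu q) + a / (a - b) * (mu q * derive1n 2 f (mu q)).

Lemma normX_psi q : 2^-1 * derive1n 2 f (mu q) * kappa ^+ 2 * g q (X q) (X q)
  = a / (a - b) * (mu q * derive1n 2 f (mu q)).
Proof.
by rewrite normX /kappa; move: (mu q) (derive1n 2 f _) => m c; field; rewrite subr_eq0.
Qed.

Lemma gdef_X q w : U q -> tangent A q w -> gdef f q (X q) w = h q * g q (X q) w.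
Proof.
move=> Uq Tw; have qs := qsU Uq; have Tx := X_tangent hXU Uq.
rewrite gdefE // /deform_form /qform !(q_gid qs) // /h -normX_psi; ring.
Qed.

Lemma h_neq0 q : U q -> h q != 0.
Proof.
move=> Uq; apply: contra (X_neq0 Uq) => /eqP h0; apply/eqP.
apply: (converse_nondeg Uq) => [|w Tw]; first exact: (X_tangent hXU Uq).
by rewrite gdef_X // h0 mul0r.
Qed.

(** The equation converse_lie on X: it says that mu h' = (a' / a - 1) h, where h
    is the factor of g_f on the quaternionic line of X. *)
Lemma converse_h q : U q ->
  a * mu q * derive1n 2 f (mu q) + a * derive1 f (mu q)
  + a / (a - b) * mu q * (a * mu q * derive1n 3 f (mu q) + 2 * a * derive1n 2 f (mu q))
  = a' * h q.
Proof.
move=> Uq; have qs := qsU Uq; have Tx := X_tangent hXU Uq.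
have x0 := normX_neq0 Uq.
apply: (mulIf x0); have := converse_lie Uq Tx Tx.
rewrite /qform !(q_gid qs) // !mul0r !addr0.
rewrite /h normX /kappa.
move: (mu q) (derive1 f (mu q)) (derive1n 2 f (mu q)) (derive1n 3 f (mu q)) => m f1 f2 f3 E.
transitivity ((a * m * f2 + a * f1) * (a * (a - b) / 2 * m) +
  2^-1 * (2 / (a - b)) ^+ 2 * (a * m * f3 + 2 * a * f2) *
  (a * (a - b) / 2 * m * (a * (a - b) / 2 * m))).
  by field; rewrite subr_eq0.
by rewrite E; field; rewrite subr_eq0.
Qed.

Let k := a' / a.

Let smooth_Df (j : nat) q : U q -> smooth_at A q (fun r => derive1n j f (mu r)).
Proof.
move=> Uq; have Cj : Cinfty D (derive1n j f).
  by elim: j => [//|j IH]; exact: Cinfty_derive1.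
exact: (smooth_comp hM oD Cj (muD Uq) (smooth_mu q)).
Qed.

Let d_Df (j : nat) q v : U q -> tangent A q v ->
  v (fun r => derive1n j f (mu r)) = derive1n j.+1 f (mu q) * v mu.
Proof.
move=> Uq Tv; have Cj : Cinfty D (derive1n j f).
  by elim: j => [//|j IH]; exact: Cinfty_derive1.
exact: (tangent_comp hM oD Cj (muD Uq) Tv (smooth_mu q)).
Qed.

Lemma h_on_component p : U p -> exists2 c, c != 0 &
  forall q, connected_component U p q -> h q = c * spow 1 k 1 (mu q).
Proof.
move=> Up.
pose h1 q := derive1n 2 f (mu q)
  + a / (a - b) * (derive1n 2 f (mu q) + mu q * derive1n 3 f (mu q)).
have smf q : U q -> smooth_at A q (fun r => mu r * derive1n 2 f (mu r)).
  by move=> Uq; exact: (smoothM hM (smooth_mu q) (smooth_Df 2 Uq)).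
have sc q : U q -> smooth_at A q (fun r => a / (a - b) * (mu r * derive1n 2 f (mu r))).
  by move=> Uq; exact: (smoothM hM (smooth_cst hM q _) (smf _ Uq)).
apply: (@homogeneous_on_component h h1 k p) => //; last exact: h_neq0.
- by move=> q Uq; exact: (smoothD hM (smooth_Df 1 Uq) (sc _ Uq)).
- move=> q v Uq Tv; rewrite (tangent_add hM Tv (smooth_Df 1 Uq) (sc _ Uq)).
  rewrite (tangent_scale hM _ Tv (smf _ Uq)).
  rewrite (tangent_mul hM Tv (smooth_mu q) (smooth_Df 2 Uq)).
  rewrite (d_Df 1 Uq Tv) (d_Df 2 Uq Tv) /h1.
  move: (mu q) (derive1n 2 f (mu q)) (derive1n 3 f (mu q)) (v mu) => m f2 f3 dm.
  by ring.
move=> q Uq; have := converse_h Uq; rewrite /h1 /h /k.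
move: (mu q) (derive1 f (mu q)) (derive1n 2 f (mu q)) (derive1n 3 f (mu q)) => m f1 f2 f3 E.
apply: (mulfI ha).
rewrite [RHS](_ : _ = a' * (f1 + a / (a - b) * (m
  * f2))); last by field; rewrite ha subr_eq0 hab.
by rewrite -E; field; rewrite subr_eq0.
Qed.

(** In dimension 4 the quaternionic line of X is the whole tangent space, so that
    g_f = h g. The model metric is likewise (k a - b) / (a - b) |mu|^k / mu times g,
    with k a = a' different from b. *)
Lemma converse_dim4 p : (n < 8)%N -> a' != b -> U p -> exists2 c, c != 0 &
  forall q v w, connected_component U p q -> tangent A q v -> tangent A q w ->
    gdef f q v w = c * model_metric k q v w.
Proof.
move=> n8 ab Up; have [c c0 cE] := h_on_component Up.
have kab : k * a - b != 0 by rewrite /k divfK // subr_eq0.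
exists (c * ((a - b) / (k * a - b))).
  by rewrite !mulf_neq0 ?invr_eq0 // subr_eq0.
move=> q v w Cq Tv Tw; have Uq : U q := connected_component_sub Cq.
have qs := qsU Uq; have Tx := X_tangent hXU Uq.
have x0 := normX_neq0 Uq.
have [e [Te span indep nd]] := hkt_frame hM hgU Uq.
have full y z : tangent A q y -> tangent A q z ->
    qform (g q) (I q) (J q) (K q) (X q) y z = g q (X q) (X q) * g q y z.
  move=> Ty Tz; have Tp := qprojT qs Tx y.
  have Tyx := qTZ qs (g q (X q) (X q)) Ty.
  have Tsub := qTD qs Tyx (qTN qs Tp).
  have -> : g q (X q) (X q) * g q y z = g q (g q (X q) (X q) *: y) z.
    by rewrite (q_gZl qs).
  rewrite -(g_qproj qs Tx Ty Tz); congr (g q _ z).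
  apply/eqP; rewrite eq_sym -subr_eq0; apply/eqP.
  apply: (orthq_line_eq0 qs nd span n8 Tx x0 Tsub).
  have TL (L : vec -> vec) : tangent A q (L (X q)) ->
    qform (g q) (I q) (J q) (K q) (X q) y (L (X q))
      = g q (X q) (X q) * g q (L (X q)) y -> g q (L (X q)) (g q (X q) (X q) *: y
       - qproj (g q) (I q) (J q) (K q) (X q) y) = 0.
    move=> TLx E; rewrite (qs_gsym qs) // (q_gDl qs) //; last exact: (qTN qs).
    by rewrite (q_gZl qs) // (q_gNl qs) // (g_qproj qs Tx Ty TLx) E (qs_gsym qs Ty) // subrr.
  have [[TIx TJx] TKx] := (qTI qs Tx, qTJ qs Tx, qTK qs Tx).
  split; [apply: (TL id)|apply: TL|apply: TL|apply: TL] => //;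
    rewrite /qform ?(q_gqr qs) // ?(q_unit qs) // ?(q_gl qs) // ?(q_gid qs) //; ring.
rewrite gdefE // /model_metric /deform_form full //.
have := cE _ Cq; rewrite /h -normX_psi.
have Uq' : mu q != 0 by exact: Uq.
rewrite normX /kappa /spow.
move: (mu q) (derive1 f (mu q)) (derive1n 2 f (mu q)) (abs_pow k (mu q)) Uq' => m f1 f2
  ak m0 E.
transitivity (c * (1 * (ak * m^-1 ^+ 1)) * g q v w); first by rewrite -E; ring.
by field; rewrite subr_eq0 hab kab m0.
Qed.

(** In higher dimension a vector orthogonal to the quaternionic line of X isolates
    the equation for f'. *)
Lemma converse_dim8 p : (4 < n)%N -> U p -> exists2 c, c != 0 &
  forall q v w, connected_component U p q -> tangent A q v -> tangent A q w ->
    gdef f q v w = c * model_metric k q v w.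
Proof.
move=> n4 Up.
have perp q : U q -> exists v, [/\ tangent A q v, v != 0 &
    forall w, tangent A q w -> qform (g q) (I q) (J q) (K q) (X q) v w = 0].
  move=> Uq; have qs := qsU Uq; have Tx := X_tangent hXU Uq.
  have [e [Te span indep nd]] := hkt_frame hM hgU Uq.
  have TL (i : 'I_4) : tangent A q (qunit (I q) (J q) (K q) i (X q)).
    exact: (qunitT qs).
  have [v [Tv v0 vL]] := orthogonal_exists qs Te indep TL n4.
  exists v; split=> // w Tw; rewrite /qform.
  have [[TIx TJx] TKx] := (qTI qs Tx, qTJ qs Tx, qTK qs Tx).
  have := vL (inord 0); have := vL (inord 1); have := vL (inord 2); have := vL (inord 3).
  rewrite !inordK //= !(qs_gsym qs Tv) // => -> -> -> ->; ring.
have f1n0 q : U q -> derive1 f (mu q) != 0.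
  move=> Uq; have [v [Tv v0 qv]] := perp _ Uq.
  apply: contra v0 => /eqP f10; apply/eqP; apply: (converse_nondeg Uq) => // w Tw.
  by rewrite gdefE // /deform_form f10 qv // mul0r mulr0 addr0.
have ode q : U q -> mu q * derive1n 2 f (mu q) + derive1 f (mu q) = k * derive1 f (mu q).
  move=> Uq; have [v [Tv v0 qv]] := perp _ Uq.
  have [w [Tw vw]] : exists w, tangent A q w /\ g q v w != 0.
    apply: contrapT => nw; move/negP: v0; apply; apply/eqP.
    apply: (hkt_nondeg hM hgU Uq) => // w Tw; apply/eqP; apply: contrapT => /negP gw.
    by apply: nw; exists w.
  have := converse_lie Uq Tv Tw; rewrite qv // !mulr0 !addr0 [a' * _]mulrA => /(mulIf vw) E.
  by apply: (mulfI ha); rewrite mulrDr mulrA E /k; field.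
have [c c0 cE] := @homogeneous_on_component (fun q => derive1 f (mu q))
  (fun q => derive1n 2 f (mu q)) k p (fun q Uq => smooth_Df 1 Uq)
  (fun q v Uq Tv => d_Df 1 Uq Tv) ode Up (f1n0 _ Up).
exists c => // q v w Cq Tv Tw; have Uq : U q := connected_component_sub Cq.
have Uq' : mu q != 0 by exact: Uq.
rewrite gdefE // /model_metric /deform_form.
have -> : derive1n 2 f (mu q) = c * spow (k - 1) k 2 (mu q).
  have := ode _ Uq; rewrite (cE _ Cq) /spow.
  move: (mu q) (derive1n 2 f (mu q)) (abs_pow k (mu q)) Uq' => m f2 ak m0 E.
  by apply: (mulfI m0); rewrite -[LHS](addrK (c * (1 * (ak * m^-1 ^+ 1)))) E; field.
rewrite (cE _ Cq); move: kappa => r; ring.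
Qed.

(** The model metric is degenerate on X when k a = b. *)
Lemma model_neq0 p c : U p -> c != 0 ->
  (forall v w, tangent A p v -> tangent A p w -> gdef f p v w = c * model_metric k p v w) ->
  k * a != b.
Proof.
move=> Up c0 E; apply: contra (X_neq0 Up) => /eqP kab; apply/eqP.
have qs := qsU Up; have Tx := X_tangent hXU Up.
apply: (converse_nondeg Up) => // w Tw.
have Up' : mu p != 0 by exact: Up.
rewrite E // /model_metric /deform_form /qform !(q_gid qs) // normX /kappa /spow -kab.
have kab1 : a - k * a != 0 by rewrite kab subr_eq0.
move: (mu p) (abs_pow k (mu p)) Up' => m ak m0.
by field; rewrite m0 kab1.
Qed.

End Converse.
End Deformations.

Unset Implicit Arguments.

Theorem proposition3p1 (R : realType) (m : nat) (M : topologicalType)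
    (A : set (chart R (4 * m) M)) (hM : smooth_manifold A)
    (g : M -> ((M -> R) -> R) -> ((M -> R) -> R) -> R)
    (I J K : M -> ((M -> R) -> R) -> ((M -> R) -> R))
    (nabla : M -> ((M -> R) -> R) -> (M -> ((M -> R) -> R)) -> ((M -> R) -> R))
    (hg : HKT A setT g I J K nabla)
    (X : M -> ((M -> R) -> R)) (a b : R)
    (hX : special_homothety A setT g I J K X a b)
    (ha : a != 0) (hab : a != b) :
  let mu := homothety_potential g X a b in
  let U := [set p | mu p != 0] in
  let gdef := deformed_metric g I J K mu in
  [/\ HKT_potential A setT mu g I J K,
      (forall k : R, k != 0 -> k != b / a ->
        deformation_on A U g I J K X mu (abs_pow k) (k * a) b),
      (b != 0 -> deformation_on A U g I J K X mu log_abs 0 b) &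
      (forall (D : set R) (f : R -> R) (a' b' : R),
        open D -> (forall p, U p -> D (mu p)) -> Cinfty D f ->
        deformation_on A U g I J K X mu f a' b' ->
        (1 < m)%N \/ a' != b' ->
        forall p, U p ->
          b' = b /\
          ((exists k : R, [/\ k != 0, k != b / a, a' = k * a &
              homothetic_on A (connected_component U p)
                (gdef f) (gdef (abs_pow k))]) \/
           [/\ b != 0, a' = 0 &
              homothetic_on A (connected_component U p)
                (gdef f) (gdef log_abs)]))].
Proof.
move=> mu U gdef; split.
- exact: (mu_potential hM hg hX ha hab).
- move=> k k0 kba; apply: (spow_deformation hM hg hX ha hab (c := k)) => //.
  + by apply: contra kba => /eqP <-; rewrite mulfK.
  + exact: Cinfty_abs_pow.
  + exact: derive1_abs_pow.
- move=> b0; rewrite -[X in deformation_on _ _ _ _ _ _ _ _ _ X _](mul0r a).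
  apply: (spow_deformation hM hg hX ha hab (c := 1)) => //.
  + by rewrite mul0r eq_sym.
  + exact: Cinfty_log_abs.
  + exact: derive1_log_abs.
move=> D f a' b' oD muD Cf hdef hm p Up.
have bb := converse_b hM hg hX ha hab hdef Up.
split=> //.
have refl := connected_component_refl (Up : U p).
have [c c0 cE] : exists2 c, c != 0 &
    forall q v w, connected_component U p q -> tangent A q v -> tangent A q w ->
    gdef f q v w = c * model_metric g I J K X a b (a' / a) q v w.
  have [m1|m1] := ltnP 1 m.
    by apply: (converse_dim8 hM hg hX ha hab oD muD Cf hdef) => //; lia.
  apply: (converse_dim4 hM hg hX ha hab oD muD Cf hdef) => //; first by lia.
  by case: hm => [|ab']; [rewrite ltnNge m1|rewrite -bb].
have kab : a' / a * a != b.
  exact: (model_neq0 hM hg hX ha hab hdef Up c0 (fun v w => cE p v w refl)).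
have sub q : connected_component U p q -> U q by exact: connected_component_sub.
have [k0|k0] := eqVneq (a' / a) 0.
  right; move: kab; rewrite k0 mul0r eq_sym => b0; split=> //.
    by move/eqP: k0; rewrite mulf_eq0 invr_eq0 (negbTE ha) orbF => /eqP.
  exists c => // q v w Cq Tv Tw; rewrite cE // k0.
  by rewrite /gdef /mu (gdef_log_abs hM hg hX ha hab (sub _ Cq)).
left; exists (a' / a); split=> //.
- by apply: contra kab => /eqP ->; rewrite divfK.
- by rewrite divfK.
(* The metric of |t|^k is k times the model metric. *)
exists (c / (a' / a)); first by rewrite mulf_neq0 ?invr_eq0.
move=> q v w Cq Tv Tw; rewrite cE // /gdef /mu (gdef_abs_pow hM hg hX ha hab _ (sub _ Cq)) //.
by rewrite mulrA divfK.
Qed.
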